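(* Let $G$ be a 3-connected cubic graph on $n$ vertices with a distinguished root $r\in V(G)$. If every peripheral cycle of $G$ has length at most $q$, then the graph $G-r$ has at least $2^{n/(2q)}$ decompositions into a spanning tree and a 2-base, i.e. there are at least $2^{n/(2q)}$ partitions of $E(G-r)$ into $\{T,B\}$ where $T$ is the edge-set of a spanning tree of $G-r$ and $B$ is a 2-base of $G-r$.
   Context: Graphs are finite. A graph is 3-connected if it has more than three vertices and remains connected after deleting any set of fewer than three vertices. A graph is cubic if all degrees equal 3, and subcubic if all degrees are at most 3. $G-r$ is obtained by deleting the vertex $r$ and its incident edges; $G-S$ for $S\subseteq E(G)$ is obtained by deleting the edges of $S$ while keeping all vertices. In a subcubic graph $G=(V,E)$, an edge-set $S\subseteq E$ is peripheral if $G-S$ is connected; a subgraph (in particular a cycle) $H\subseteq G$ is peripheral if $E(H)$ is peripheral. For a positive integer $k$ and $S\subseteq E$, the $k$-closure $\langle S\rangle_k$ is the minimal edge-set $R$ with $S\subseteq R\subseteq E$ such that every cycle $C\subseteq G$ with $E(C)\setminus R\neq\emptyset$ has at least $k+1$ edges not in $R$. A set $S\subseteq E$ is a $k$-base of $G$ if $\langle S\rangle_k=E$. *)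

(* Defs.v *)
From HB Require Import structures.
From mathcomp Require Import all_boot.

Set Implicit Arguments.
Unset Strict Implicit.
Unset Printing Implicit Defensive.

(* Simple graphs suffice here: a 3-connected cubic multigraph has neither loops
   nor parallel edges. Edges are two-element vertex sets, and vertex and edge
   sets live in a common ambient finite type, so that the subgraphs of a graph
   are again of type [graph V]. *)

Definition wf_graph (V : finType) (p : {set V} * {set {set V}}) : bool :=
  [forall e in p.2, (#|e| == 2) && (e \subset p.1)].

Record graph (V : finType) : Type := Graph {
  graph_val :> {set V} * {set {set V}};
  graph_wf : wf_graph graph_val }.

HB.instance Definition _ (V : finType) := [isSub for @graph_val V].
HB.instance Definition _ (V : finType) := [Finite of graph V by <:].

Definition vset (V : finType) (G : graph V) : {set V} := (val G).1.
Definition eset (V : finType) (G : graph V) : {set {set V}} := (val G).2.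

Section Graphs.
Variable V : finType.
Implicit Types (G H C : graph V) (S R T B : {set {set V}}) (X : {set V}).

Definition subgraph H G : bool :=
  (vset H \subset vset G) && (eset H \subset eset G).

Definition adj G : rel V := [rel x y | [set x; y] \in eset G].

Definition degree G (x : V) : nat := #|[set e in eset G | x \in e]|.

Definition cubic G : bool := [forall x in vset G, degree G x == 3].

Definition connected G : bool :=
  (vset G != set0) &&
  [forall x in vset G, forall y in vset G, connect (adj G) x y].

Lemma del_vertices_wf G X :
  wf_graph (vset G :\: X, [set e in eset G | [disjoint e & X]]).
Proof.
apply/forall_inP=> e; rewrite inE => /andP[eG eX].
have /andP[-> sub] := forall_inP (graph_wf G) _ eG.
by rewrite /= subsetD sub.
Qed.

Definition del_vertices G X : graph V := Graph (del_vertices_wf G X).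

Definition del_vertex G (r : V) : graph V := del_vertices G [set r].

Lemma del_edges_wf G S : wf_graph (vset G, eset G :\: S).
Proof.
apply/forall_inP=> e; rewrite inE => /andP[_].
exact: (forall_inP (graph_wf G)).
Qed.

Definition del_edges G S : graph V := Graph (del_edges_wf G S).

Definition k_connected (k : nat) G : bool :=
  (k < #|vset G|) &&
  [forall X : {set V},
     (X \subset vset G) && (#|X| < k) ==> connected (del_vertices G X)].

(* The vertices of C can be listed as s = x_0, ..., x_(m-1), without repetition
   and with m >= 3, so that the edges of C are exactly the pairs of cyclically
   consecutive vertices. *)
Definition is_cycle C : bool :=
  [exists s : #|vset C|.-tuple V,
     [&& uniq s, 2 < size s, vset C == [set x in s]
       & eset C == [set [set x; next s x] | x in s]]].

Definition cycle_of G C : bool := is_cycle C && subgraph C G.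

Definition cycle_length C : nat := #|eset C|.

Definition acyclic G : bool := [forall C : graph V, ~~ cycle_of G C].

Definition is_tree G : bool := connected G && acyclic G.

Definition spanning_tree_edges G T : bool :=
  [exists H : graph V,
     [&& subgraph H G, vset H == vset G, is_tree H & eset H == T]].

Definition peripheral G S : bool :=
  (S \subset eset G) && connected (del_edges G S).

Definition peripheral_cycle G C : bool :=
  cycle_of G C && peripheral G (eset C).

Definition k_closed (k : nat) G R : bool :=
  [forall C : graph V,
     cycle_of G C && (eset C :\: R != set0) ==> (k.+1 <= #|eset C :\: R|)].

Definition k_closed_over (k : nat) G S R : bool :=
  [&& S \subset R, R \subset eset G & k_closed k G R].

(* For S contained in the edge set, this intersection is itself k-closed over S,
   hence it is the unique minimal such set: see [k_closureE]. *)
Definition k_closure (k : nat) G S : {set {set V}} :=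
  \bigcap_(R | k_closed_over k G S R) R.

Lemma k_closed_overT k G S :
  S \subset eset G -> k_closed_over k G S (eset G).
Proof.
move=> SG; rewrite /k_closed_over SG subxx /=.
apply/forallP=> C; apply/implyP=> /andP[/andP[_ /andP[_ CG]]].
by rewrite setD_eq0 CG.
Qed.

Lemma k_closure_closed k G S :
  S \subset eset G -> k_closed_over k G S (k_closure k G S).
Proof.
move=> SG; apply/and3P; split.
- by apply/bigcapsP=> R /and3P[].
- exact: bigcap_inf (k_closed_overT k SG).
apply/forallP=> C; apply/implyP=> /andP[cC /set0Pn[e]].
rewrite inE => /andP[eK eC].
have [R kR eR] : exists2 R, k_closed_over k G S R & e \notin R.
  apply/exists_inP; apply: contraR eK => /exists_inPn h.
  by apply/bigcapP=> R /h; rewrite negbK.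
have /and3P[_ _ /forallP/(_ C)] := kR; rewrite cC /= => /implyP h.
apply: leq_trans (h _) _; first by apply/set0Pn; exists e; rewrite inE eR.
by apply/subset_leq_card/setDS; exact: bigcap_inf kR.
Qed.

Lemma k_closureE k G S R :
  S \subset eset G -> minset (k_closed_over k G S) R = (R == k_closure k G S).
Proof.
move=> SG; have kK := k_closure_closed k SG.
apply/idP/eqP=> [/minsetP[kR minR] | ->].
  by apply/esym/minR=> //; exact: bigcap_inf kR.
apply/minsetP; split=> // R' kR' sub; apply/eqP.
by rewrite eqEsubset sub; exact: bigcap_inf kR'.
Qed.

Definition k_base (k : nat) G S : bool :=
  (S \subset eset G) && (k_closure k G S == eset G).

(* The partitions {T, B}, as sets of two blocks. *)
Definition tree_base_decompositions (k : nat) G : {set {set {set {set V}}}} :=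
  [set P | partition P (eset G) &&
     [exists T : {set {set V}}, exists B : {set {set V}},
        [&& P == [set T; B], T != B,
            spanning_tree_edges G T & k_base k G B]]].

End Graphs.

(* Main.v *)
Require Import Defs.
From mathcomp Require Import all_boot all_order all_algebra zify.
From mathcomp Require Import reals exp.
Set Implicit Arguments.
Unset Strict Implicit.
Unset Printing Implicit Defensive.
Import Order.TTheory GRing.Theory Num.Theory.

(* A set A whose edges lie in the closure is enlarged by ears: if P is a path
   with both ends adjacent to A and each vertex of P has its third neighbour
   outside A and P, putting the edges of P in B forces its two end edges into
   the closure, and these two end edges go to the tree. In a minimal set Y
   joined to the vertices outside A and Y by at most one edge, there is either a
   single vertex to add, or Y has exactly three outgoing edges and induction
   applies to it, or there are two different intersecting ears. In the last case
   the two families of sets B are disjoint, since an edge of one ear that leaves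
   the other one tells them apart; so the number of sets B doubles, at the cost
   of at most q - 2 vertices, because an ear whose complement is connected
   extends to a peripheral cycle. Ears with connected complement come from a
   maximality argument: a maximal connected set K whose complement still
   contains a path between prescribed vertices leaves nothing but that path.
   The starting set A is itself a path between two of the three vertices of
   X = V - r adjacent to r, chosen in two different ways. *)

(** * Connected vertex sets *)

(** Only intersecting ears double the number of sets, so counting vertices would charge too much for
    the other two cases. Progress is measured by 2|X \ A| - |E(X) \ E(A)| instead. A single vertex
    brings two edges and costs 0. An ear P costs at most |P| - 1 < q, since it has at least |P| - 1
    inner edges and two attaching ones. A set Y with three outgoing edges satisfies 2|E(Y)| + 3 =
    3|Y| and costs (|Y| - 1)/2, which its own sets B pay for. So one doubling per q units suffices.
    For X = V - r and a starting path of at most q vertices the measure is at least (n - 2q)/2,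
    which yields the exponent n/(2q) - 1; the two choices of starting path give the missing 1. The
    recursion into Y forces the induction to run over all sets with exactly three outgoing edges, V
    - r being the one whose three outer ends coincide. Acyclicity of the tree is carried along as an
    edge count, which adds up under gluing. *)

Section Connectivity.
Variables (V : finType) (e : rel V).
Implicit Types (X Y Z D K : {set V}) (x y z u v : V) (p : seq V).

Definition rin X : rel V := [rel x y | [&& x \in X, y \in X & e x y]].

(** The empty set is connected in this sense, unlike for [connected]; [two_linked_step] relies on
    this for a part that may vanish. *)
Definition conn X : bool := [forall x in X, forall y in X, connect (rin X) x y].

Definition comp X x : {set V} := [set y | connect (rin X) x y].

(** Pairs are ordered: between disjoint sets each edge counts once, but [cut X X] counts every edge
    inside X twice. *)
Definition cut D Z : {set V * V} :=
  [set p : V * V | [&& p.1 \in D, p.2 \in Z & e p.1 p.2]].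

Definition nb x : {set V} := [set y | e x y].

Lemma connP X :
  reflect {in X &, forall x y, connect (rin X) x y} (conn X).
Proof.
apply: (iffP forall_inP) => [h x y xX yX | h x xX].
  by have /forall_inP := h x xX; exact.
by apply/forall_inP => y yX; apply: h.
Qed.

Lemma rin_mono X Y x y : X \subset Y -> rin X x y -> rin Y x y.
Proof. by move=> /subsetP s /and3P[xX yX exy]; apply/and3P; split=> //; apply: s. Qed.

Lemma connect_rin_mono X Y x y :
  X \subset Y -> connect (rin X) x y -> connect (rin Y) x y.
Proof.
move=> s; apply: connect_sub => a b /(rin_mono s) /connect1; exact.
Qed.

Lemma connect_rin1 X x y :
  x \in X -> y \in X -> e x y -> connect (rin X) x y.
Proof. by move=> xX yX exy; apply: connect1; apply/and3P. Qed.

Lemma connect_rin_in X x y : connect (rin X) x y -> x != y -> (x \in X) && (y \in X).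
Proof.
case/connectP => p; case/lastP: p => [|p z] /=; first by move=> _ ->; rewrite eqxx.
rewrite last_rcons => hp -> _.
have zX : z \in X by move: hp; rewrite rcons_path => /andP[_ /and3P[]].
rewrite zX andbT.
by case: p hp => [|a p] /= /andP[/and3P[]].
Qed.

Lemma rin_closed X Z x y :
  (forall u v, u \in Z -> v \in X -> e u v -> v \in Z) ->
  connect (rin X) x y -> x \in Z -> y \in Z.
Proof.
move=> h /connectP[p hp ->]; elim: p x hp => //= a p IH x /andP[/and3P[_ aX exa] hp] xZ.
by apply: IH hp _; apply: h exa.
Qed.

Lemma conn_crossing X Z x y :
  conn X -> x \in X -> x \in Z -> y \in X -> y \notin Z ->
  exists u v, [/\ u \in X, u \in Z, v \in X, v \notin Z & e u v].
Proof.
move=> /connP h xX xZ yX yZ.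
have [/existsP[u /existsP[v /and5P[? ? ? ? ?]]]|no] :=
  boolP [exists u, exists v, [&& u \in X, u \in Z, v \in X, v \notin Z & e u v]].
  by exists u, v.
case/negP: yZ.
have: y \in X :&: Z; last by rewrite inE => /andP[].
apply: (rin_closed _ (h x y xX yX)); last by rewrite inE xX.
move=> u v; rewrite !inE => /andP[uX uZ] vX euv; rewrite vX /=.
apply: contraR no => vZ; apply/existsP; exists u; apply/existsP; exists v.
by rewrite uX uZ vX vZ.
Qed.

Lemma conn_cutP X :
  (forall Z, Z \subset X -> Z != set0 -> Z != X ->
     exists u v, [/\ u \in Z, v \in X, v \notin Z & e u v]) -> conn X.
Proof.
move=> h; apply/connP => x y xX yX.
have sub : comp X x \subset X.
  apply/subsetP => z; rewrite inE => hz.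
  by case: (eqVneq x z) => [<- //| /(connect_rin_in hz) /andP[]].
case: (eqVneq (comp X x) X) => [eqX | neX].
  by move: yX; rewrite -{1}eqX inE.
have ne0 : comp X x != set0 by apply/set0Pn; exists x; rewrite inE connect0.
have [u [v [uZ vX vZ euv]]] := h _ sub ne0 neX.
case/negP: vZ; move: (uZ); rewrite !inE => xu; apply: connect_trans xu _.
by apply: connect_rin1 => //; apply: (subsetP sub).
Qed.

Lemma conn1 x : conn [set x].
Proof. by apply/connP => u v /set1P-> /set1P->; apply: connect0. Qed.

Lemma conn0 : conn set0.
Proof. by apply/connP => u v; rewrite inE. Qed.

Lemma comp_sub X x : x \in X -> comp X x \subset X.
Proof.
move=> xX; apply/subsetP => z; rewrite inE => hz.
by case: (eqVneq x z) => [<- //| /(connect_rin_in hz) /andP[]].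
Qed.

Lemma mem_comp X x : x \in comp X x.
Proof. by rewrite inE connect0. Qed.

Lemma comp_step X x u v :
  x \in X -> u \in comp X x -> v \in X -> e u v -> v \in comp X x.
Proof.
move=> xX uC vX euv; move: (uC); rewrite !inE => xu; apply: connect_trans xu _.
by apply: connect_rin1 => //; apply: (subsetP (comp_sub xX)).
Qed.

Lemma path_rin X x p :
  path e x p -> {subset x :: p <= X} -> path (rin X) x p.
Proof.
elim: p x => //= a p IH x /andP[exa hp] s; apply/andP; split.
  by apply/and3P; split=> //; apply: s; rewrite !inE eqxx ?orbT.
by apply: IH hp _ => z zp; apply: s; rewrite inE zp orbT.
Qed.

Lemma conn_path X x y :
  conn X -> x \in X -> y \in X ->
  exists p, [/\ path e x p, uniq (x :: p), last x p = y & {subset x :: p <= X}].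
Proof.
move=> /connP h xX yX; have /connectP[p0 hp0 ->] := h x y xX yX.
case/shortenP: hp0 => p hp up _.
exists p; split=> //.
  by apply: sub_path hp => a b /and3P[].
move=> z; rewrite inE => /predU1P[-> //|zp].
move: hp; elim: p x {up xX h} zp => //= a p IH x; rewrite inE => /predU1P[->|zp] /andP[/and3P[]] //.
by move=> _ aX _; apply: IH.
Qed.

Lemma connect_path X x y :
  x \in X -> connect (rin X) x y ->
  exists p, [/\ path e x p, uniq (x :: p), last x p = y & {subset x :: p <= X}].
Proof.
move=> xX /connectP[p0 hp0 ->].
case/shortenP: hp0 => p hp up _.
exists p; split=> //.
  by apply: sub_path hp => a b /and3P[].
move=> z; rewrite inE => /predU1P[-> //|zp].
move: hp; elim: p x {up xX} zp => //= a p IH x; rewrite inE => /predU1P[->|zp] /andP[/and3P[]] //.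
by move=> _ aX _; apply: IH.
Qed.

Hypothesis esym : symmetric e.

Lemma rin_sym X : symmetric (rin X).
Proof. by move=> x y; rewrite /rin /= esym andbCA. Qed.

Lemma connect_rin_sym X x y : connect (rin X) x y = connect (rin X) y x.
Proof. by apply: sym_connect_sym; apply: rin_sym. Qed.

Lemma conn_comp X x : x \in X -> conn (comp X x).
Proof.
move=> xX; have sub := comp_sub xX.
suff h y : y \in comp X x -> connect (rin (comp X x)) x y.
  apply/connP => u v uC vC; apply: connect_trans (h _ vC).
  by rewrite connect_rin_sym; apply: h.
rewrite inE => /connectP[p hp ->].
elim/last_ind: p hp => [|p z IH]; first by rewrite connect0.
rewrite rcons_path last_rcons => /andP[hp /and3P[_ zX elz]].
apply: connect_trans (IH hp) _.
have lC : last x p \in comp X x by rewrite inE; apply/connectP; exists p.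
by apply: connect_rin1 => //; apply: comp_step elz.
Qed.

Lemma conn_center X x : (forall y, y \in X -> connect (rin X) x y) -> conn X.
Proof.
move=> h; apply/connP => u v uX vX; apply: connect_trans (h v vX).
by rewrite connect_rin_sym; apply: h.
Qed.

Lemma connU X Y x y :
  conn X -> conn Y -> x \in X -> y \in Y -> (x == y) || e x y -> conn (X :|: Y).
Proof.
move=> /connP hX /connP hY xX yY exy.
apply: (@conn_center _ x) => z; rewrite inE => /orP[zX|zY].
  by apply: connect_rin_mono (hX _ _ xX zX); apply: subsetUl.
apply: (@connect_trans _ _ y); last first.
  by apply: connect_rin_mono (hY _ _ yY zY); apply: subsetUr.
case/predU1P: exy => [->|exy]; first exact: connect0.
by apply: connect_rin1 => //; rewrite inE ?xX ?yY ?orbT.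
Qed.

Lemma connU1 X x y : conn X -> x \in X -> e x y -> conn (y |: X).
Proof. by move=> cX xX exy; rewrite setUC; apply: connU (conn1 y) xX (set11 y) _ => //; rewrite exy orbT. Qed.

Lemma path_conn x p : path e x p -> conn [set z in x :: p].
Proof.
move=> hp; apply: (@conn_center _ x) => y; rewrite inE => yp.
case/splitPl: yp hp => p1 p2 <-; rewrite cat_path => /andP[hp1 _].
apply/connectP; exists p1 => //; apply: path_rin hp1 _ => z.
by rewrite !inE mem_cat => /orP[->|->] //; rewrite orbT.
Qed.

Lemma cut_sym D Z : #|cut D Z| = #|cut Z D|.
Proof.
pose sw (p : V * V) := (p.2, p.1).
have inj : injective sw by move=> [a b] [c d] [-> ->].
rewrite -(card_imset _ inj); apply: eq_card => -[a b].
apply/imsetP/idP => [[[c d]]|h]; first by rewrite !inE /= => /and3P[? ? ?] [-> ->]; rewrite esym; apply/and3P.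
exists (b, a) => //; move: h; rewrite !inE /= => /and3P[? ? ?].
by rewrite esym; apply/and3P.
Qed.

Lemma cutU D Z1 Z2 : [disjoint Z1 & Z2] -> #|cut D (Z1 :|: Z2)| = #|cut D Z1| + #|cut D Z2|.
Proof.
move=> dis; have -> : cut D (Z1 :|: Z2) = cut D Z1 :|: cut D Z2.
  by apply/setP => p; rewrite !inE; case: (p.1 \in D); case: (e _ _); rewrite ?andbF ?andbT.
rewrite cardsU (_ : _ :&: _ = set0) ?cards0 ?subn0 //.
apply/setP => p; rewrite !inE; apply/negbTE/negP => /andP[/and3P[_ h1 _] /and3P[_ h2 _]].
by rewrite (disjointFr dis h1) in h2.
Qed.

Lemma cutUl D1 D2 Z : [disjoint D1 & D2] -> #|cut (D1 :|: D2) Z| = #|cut D1 Z| + #|cut D2 Z|.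
Proof. by move=> dis; rewrite cut_sym cutU // !(cut_sym Z). Qed.

Lemma cut_nb x Z : #|cut [set x] Z| = #|nb x :&: Z|.
Proof.
have inj : injective (fun y : V => (x, y)) by move=> a b [].
rewrite -(card_imset _ inj); apply: eq_card => -[a b].
apply/idP/imsetP => [|[y]]; rewrite !inE /=.
  by case/and3P => /eqP-> bZ exb; exists b; rewrite // !inE exb.
by case/andP=> exy yZ [-> ->]; rewrite eqxx yZ.
Qed.

Lemma subset_cut D D' Z Z' : D \subset D' -> Z \subset Z' -> #|cut D Z| <= #|cut D' Z'|.
Proof.
move=> /subsetP sD /subsetP sZ; apply: subset_leq_card; apply/subsetP => p.
by rewrite !inE => /and3P[/sD-> /sZ-> ->].
Qed.

Lemma cut_gt0 D Z u v : u \in D -> v \in Z -> e u v -> 0 < #|cut D Z|.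
Proof. by move=> uD vZ euv; apply/card_gt0P; exists (u, v); rewrite !inE uD vZ. Qed.

Lemma conn_cut_gt0 X Z : conn X -> Z \subset X -> Z != set0 -> Z != X -> 0 < #|cut Z (X :\: Z)|.
Proof.
move=> cX sZ /set0Pn[x xZ] neX.
have [y yX yZ] : exists2 y, y \in X & y \notin Z.
  by apply/subsetPn; apply: contra neX => s; rewrite eqEsubset sZ.
have [u [v [uX uZ vX vZ euv]]] := conn_crossing cX (subsetP sZ _ xZ) xZ yX yZ.
by apply: (cut_gt0 (u := u) (v := v)) => //; rewrite inE vZ.
Qed.

Lemma conn_cut X :
  (forall Z, Z \subset X -> Z != set0 -> Z != X -> 0 < #|cut Z (X :\: Z)|) -> conn X.
Proof.
move=> h; apply: conn_cutP => Z s n0 nX.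
have /card_gt0P[[u v]] := h Z s n0 nX; rewrite !inE /= => /and3P[uZ /andP[vZ vX] euv].
by exists u, v.
Qed.

Lemma comp_cut X x : x \in X -> #|cut (comp X x) (X :\: comp X x)| = 0.
Proof.
move=> xX; apply/eqP; rewrite cards_eq0; apply/eqP/setP => -[u v].
rewrite [in RHS]inE; apply/negbTE/negP; rewrite !inE /= -!andbA.
case/and4P => xu xv vX euv; case/negP: xv; apply: connect_trans (xu) _.
apply: connect_rin1 => //.
by apply: (subsetP (comp_sub xX)); rewrite inE.
Qed.

(** No edge joins two components of W \ K, so every other component keeps its link to K when one of
    them is removed. In terms of cuts: a set Z that splits K is crossed inside K; if Z contains K,
    the edge leaving Z together with the component cannot start in the component; if Z misses K, the
    edge leaving Z cannot end there. *)
Lemma conn_comp_absorb W K x :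
  conn W -> conn K -> K \subset W -> K != set0 -> x \in W :\: K ->
  conn (W :\: comp (W :\: K) x).
Proof.
move=> cW cK sK nK xWK; set C := comp _ _.
have /setDP[xW xK] := xWK.
have sC : C \subset W :\: K := comp_sub xWK.
apply: conn_cut => Z sZ nZ neZ.
have [/set0Pn[k] | ] := boolP (Z :&: K != set0).
  case/setIP => kZ kK.
  have [sKZ | /subsetPn[k' k'K k'Z]] := boolP (K \subset Z); last first.
    have [u [v [uK uZ vK vZ euv]]] := conn_crossing cK kK kZ k'K k'Z.
    apply: (cut_gt0 (u := u) (v := v)) => //; rewrite !inE vZ (subsetP sK) // andbT.
    by apply/negP => vC; have := subsetP sC v; rewrite 2!inE vK => /(_ vC).
  pose Z' := Z :|: C.
  have Z'W : Z' != W.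
    apply: contra neZ => /eqP <-; rewrite eqEsubset; apply/andP; split.
      by apply/subsetP => z zZ; move/(subsetP sZ): (zZ); rewrite !inE zZ => /andP[-> _].
    by apply/subsetP => z; rewrite !inE => /andP[/negbTE->]; rewrite orbF.
  have sZ' : Z' \subset W.
    rewrite subUset (subset_trans sZ) ?subsetDl //=.
    by apply: subset_trans sC _; apply: subsetDl.
  have : 0 < #|cut Z' (W :\: Z')|.
    by apply: conn_cut_gt0 => //; apply/set0Pn; exists k; rewrite inE kZ.
  rewrite cutUl; last first.
    by rewrite disjoint_sym disjoints_subset; apply/subsetP => z zC; rewrite inE; apply/negP=> /(subsetP sZ); rewrite inE zC.
  rewrite [X in _ + X](_ : _ = 0) ?addn0; last first.
    apply/eqP; rewrite -leqn0 -(comp_cut xWK); apply: subset_cut => //.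
    apply/subsetP => z; rewrite !inE negb_or => /andP[/andP[zZ ->] ->] /=.
    by rewrite andbT; apply: contra zZ => /(subsetP sKZ).
  move/leq_trans; apply; apply: subset_cut => //.
  by apply/subsetP => z; rewrite !inE negb_or => /andP[/andP[-> ->] ->].
rewrite negbK => /eqP ZK.
have : 0 < #|cut Z (W :\: Z)|.
  apply: conn_cut_gt0 => //; first exact: subset_trans sZ (subsetDl _ _).
  apply: contraL nK => /eqP ZW; rewrite negbK -ZK; apply/eqP.
  by rewrite ZW (setIidPr sK).
rewrite [W :\: Z](_ : _ = ((W :\: C) :\: Z) :|: C); last first.
  apply/setP => z; have := subsetP sZ z; have := subsetP sC z.
  rewrite !(in_setU, in_setD).
  case: (z \in C); case: (z \in Z); case: (z \in K); case: (z \in W) => //= h1 h2;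
    first [by have := h1 isT | by have := h2 isT].
rewrite cutU; last by rewrite disjoint_sym disjoints_subset; apply/subsetP => z zC; rewrite !(in_setC, in_setD) zC /= andbF.
rewrite [X in _ + X](_ : _ = 0) ?addn0 //.
apply/eqP; rewrite cut_sym -leqn0 -(comp_cut xWK); apply: subset_cut => //.
apply/subsetP => z zZ; move/(subsetP sZ): (zZ); rewrite !in_setD => /andP[-> ->].
rewrite andbT /=; apply/negP => zK.
by move/setP/(_ z): ZK; rewrite !inE zZ zK.
Qed.

End Connectivity.

(** * Nonseparating paths *)

Section NonseparatingPath.
Variables (V : finType) (e : rel V).
Hypothesis esym : symmetric e.
Implicit Types (X Y Z D K Q W Tg : {set V}) (x y z u v n : V) (p : seq V).

(** The two halves serve to complete a detour around n to a connection from s to the end of the path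
    inside Q without n. *)
Lemma path_split_conn Q s p n v :
  path e s p -> uniq (s :: p) -> {subset s :: p <= Q} ->
  n \in s :: p -> v \in s :: p ->
  (index v (s :: p) < index n (s :: p) -> connect (rin e (Q :\ n)) s v) /\
  (index n (s :: p) < index v (s :: p) -> connect (rin e (Q :\ n)) v (last s p)).
Proof.
move=> hp up sQ nP vP; split => lt.
  have vt : v \in take (index n (s :: p)) (s :: p) by rewrite in_take.
  case Ei: (index n (s :: p)) vt => [|i]; first by rewrite take0.
  rewrite /=.
  move=> vt.
  have hc : conn e [set z in s :: take i p] by apply: path_conn => //; apply: take_path.
  apply: connect_rin_mono (connP _ _ hc s v _ _); rewrite ?inE //; last by rewrite eqxx.
  apply/subsetP => z; rewrite inE => zt; rewrite !inE sQ; last first.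
    by rewrite -[s :: p](cat_take_drop i.+1) mem_cat /= zt.
  rewrite andbT; apply: contraL zt => /eqP->.
  have := in_take i.+1 nP; rewrite Ei ltnn /= => ->//.
have dE : drop (index n (s :: p)) (s :: p) = n :: drop (index n (s :: p)).+1 (s :: p).
  by rewrite (drop_nth s) ?index_mem // nth_index.
have lE : last s p = last n (drop (index n (s :: p)).+1 (s :: p)).
  have := congr1 (last s) (cat_take_drop (index n (s :: p)) (s :: p)).
  by rewrite dE last_cat /= => ->.
have hp2 : path e n (drop (index n (s :: p)).+1 (s :: p)).
  have h := drop_sorted (index n (s :: p)) (hp : sorted e (s :: p)).
  by rewrite dE in h.
have up2 : uniq (n :: drop (index n (s :: p)).+1 (s :: p)).
  by rewrite -dE drop_uniq.
have sub2 : {subset drop (index n (s :: p)).+1 (s :: p) <= s :: p} by move=> z /mem_drop.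
have vd : v \in drop (index n (s :: p)).+1 (s :: p).
  have : v \in drop (index n (s :: p)) (s :: p).
    rewrite -[X in v \in drop _ X]/(s :: p).
    have := vP; rewrite -{1}[s :: p](cat_take_drop (index n (s :: p))) mem_cat.
    by rewrite in_take // ltnNge (ltnW lt) /=.
  by rewrite dE inE => /predU1P[vn|//]; rewrite vn ltnn in lt.
move: hp2 up2 sub2 vd; rewrite lE; set d := drop _ _; case: d => //= a d /andP[_ hd] /andP[nd _] sub2 vd.
have hc : conn e [set z in a :: d] by apply: path_conn.
apply: connect_rin_mono (connP _ _ hc v (last a d) _ _); last 2 first.
- by rewrite inE.
- by rewrite inE mem_last.
apply/subsetP => z; rewrite inE => zt; rewrite !inE sQ ?sub2 // andbT.
by apply: contraNneq nd => <-.
Qed.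

Lemma path_interior_nbrs s p n :
  path e s p -> uniq (s :: p) -> n \in s :: p -> n != s -> n != last s p ->
  exists a b, [/\ a \in s :: p, b \in s :: p, e a n, e n b &
    index a (s :: p) < index n (s :: p) < index b (s :: p)].
Proof.
move=> hp up nP ns nl.
have : n \in p by move: nP; rewrite inE (negbTE ns).
case/splitPr Ep : {1 2}p / => [p1 p2].
case: p2 Ep nl => [|b p2] Ep; first by rewrite Ep last_cat /= eqxx.
move=> _; have [e1 e2] : e (last s p1) n /\ e n b.
  by move: hp; rewrite Ep cat_path /= => /and4P[].
rewrite Ep.
exists (last s p1), b; split=> //.
- by rewrite -cat_cons mem_cat mem_last.
- by rewrite -cat_cons mem_cat !inE eqxx !orbT.
move: up; rewrite Ep -!cat_cons cat_uniq => /and3P[u1 /hasPn h u2].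
have nn : n \notin s :: p1 by apply: h; rewrite inE eqxx.
have nb : b \notin s :: p1 by apply: h; rewrite !inE eqxx orbT.
rewrite !index_cat (negbTE nn) (negbTE nb) mem_last.
apply/andP; split; first by rewrite ltn_addr // index_mem mem_last.
rewrite /= eqxx addn0.
move: u2; rewrite /= inE negb_or => /andP[/andP[/negbTE-> _] _].
by rewrite eqxx addn1.
Qed.

(* K is a maximal connected superset of K0 whose complement still joins s to
   Tg. A vertex adjacent to K then separates s from Tg outside K, so a
   component D of the vertices not adjacent to K would be attached to at most
   two of them, by one edge each, against the hypotheses on cuts. *)
Lemma nonseparating_path W K0 Tg s t0 :
  conn e W -> conn e K0 -> K0 \subset W -> K0 != set0 -> s \in W :\: K0 ->
  t0 \in Tg -> connect (rin e (W :\: K0)) s t0 -> Tg \subset W -> s \notin Tg ->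
  (forall v, v \in W -> #|nb e v :&: W| <= 3) ->
  (forall v, v \in s |: Tg -> #|nb e v :&: W| <= 2) ->
  (forall D, D \subset W :\: K0 -> D != set0 -> (s \in D -> [disjoint D & Tg]) ->
     1 < #|cut e D (W :\: D)|) ->
  (forall D, D \subset W :\: K0 -> D != set0 -> s \notin D -> [disjoint D & Tg] ->
     2 < #|cut e D (W :\: D)|) ->
  exists p, [/\ path e s p, uniq (s :: p), last s p \in Tg,
    K0 \subset W :\: [set z in s :: p] & conn e (W :\: [set z in s :: p])] /\
    [/\ {subset s :: p <= W} &
    forall v, v \in s :: p -> exists2 k, k \in W :\: [set z in s :: p] & e v k].
Proof.
move=> cW cK0 sK0 nK0 /setDP[sW sNK0] t0T st0 sT sNT deg3 deg2 h1 h2.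
pose ok K := [&& conn e K, K0 \subset K, K \subset W, s \notin K &
  [exists t in Tg, connect (rin e (W :\: K)) s t]].
have ok0 : ok K0.
  by rewrite /ok cK0 subxx sK0 sNK0; apply/existsP; exists t0; rewrite t0T.
have [K /maxsetP[/and5P[cK sK0K sKW sNK /exists_inP[t tT st]] maxK] _] := maxset_exists ok0.
pose Q := W :\: K.
have sQ : s \in Q by rewrite inE sNK.
have nK : K != set0 by apply: contraNneq nK0 => K0E; rewrite -subset0 -K0E.
have QsW : Q \subset W := subsetDl W K.
(* Any component of Q other than that of s could be absorbed into K by [conn_comp_absorb], so
   maximality leaves only one. *)
have cQ : conn e Q.
  have sC := comp_sub e sQ; have cC := conn_comp esym sQ.
  have WWC : W :\: (W :\: comp e Q s) = comp e Q s.
    by rewrite setDDr setDv set0U (setIidPr _) // (subset_trans sC).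
  have sKC : K \subset W :\: comp e Q s.
    apply/subsetP => z zK; rewrite in_setD (subsetP sKW) // andbT.
    by apply/negP => /(subsetP sC); rewrite inE zK.
  have okC : ok (W :\: comp e Q s).
    rewrite /ok (conn_comp_absorb esym) //= (subset_trans sK0K sKC) subsetDl /=.
    rewrite in_setD mem_comp /=; apply/exists_inP; exists t => //.
    by rewrite WWC; apply: (connP _ _ cC); rewrite ?mem_comp // inE.
  by rewrite /Q -(maxK _ okC sKC) WWC.
have [p [hp up lp sp]] := connect_path sQ st.
pose N := [set n in Q | [exists k in K, e n k]].
have NQ : N \subset Q by apply/subsetP => n; rewrite inE => /andP[].
(* Otherwise [n |: K] would be a larger admissible set. *)
have sep n tau : n \in N -> n != s -> tau \in Tg -> ~ connect (rin e (Q :\ n)) s tau.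
  rewrite inE => /andP[nQ /exists_inP[k kK enk]] ns tauT con.
  have /setDP[nW nNK] := nQ.
  have : ok (n |: K).
    rewrite /ok (@connU1 _ _ esym K k n) // 1?esym //= (subset_trans sK0K) ?subsetUr //=.
    rewrite subUset sub1set nW sKW !inE negb_or eq_sym ns sNK /=.
    apply/exists_inP; exists tau => //.
    by rewrite -setDDl setDDl setUC -setDDl.
  by move=> /maxK/(_ (subsetUr _ _)) E; rewrite -E setU11 in nNK.
have Np n : n \in N -> n \in s :: p.
  move=> nN; apply/negPn/negP => nNp.
  have ns : n != s by apply: contraNneq nNp => ->; rewrite mem_head.
  apply: (sep n t) => //; rewrite -lp.
  apply: connect_rin_mono (connP _ _ (path_conn esym hp) s _ _ _).
  - apply/subsetP => z; rewrite inE => zp; rewrite in_setD1 sp // andbT.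
    by apply: contraNneq nNp => <-.
  - by rewrite inE mem_head.
  by rewrite inE mem_last.
pose ix n := index n (s :: p).
have pre n m : n \in s :: p -> m \in s :: p -> ix n < ix m -> connect (rin e (Q :\ m)) s n.
  by move=> nP mP; have [] := path_split_conn hp up sp mP nP.
have post n m : n \in s :: p -> m \in s :: p -> ix m < ix n -> connect (rin e (Q :\ m)) n t.
  by move=> nP mP; rewrite -lp; have [] := path_split_conn hp up sp mP nP.
have ix0 n m : ix n < ix m -> m != s by apply: contraTneq => ->; rewrite /ix /= eqxx.
have QN : Q \subset N.
  apply/subsetPn => -[u uQ uN].
  have uQN : u \in Q :\: N by rewrite inE uN.
  pose D := comp e (Q :\: N) u.
  have sD : D \subset Q :\: N := comp_sub e uQN.
  have cD : conn e D := conn_comp esym uQN.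
  have uD : u \in D := mem_comp _ _ _.
  have nD : D != set0 by apply/set0Pn; exists u.
  have DWK0 : D \subset W :\: K0.
    apply: (subset_trans sD); apply: (subset_trans (subsetDl _ _)).
    exact: setDS.
  have Dcon m a b : m \in N -> a \in D -> b \in D -> connect (rin e (Q :\ m)) a b.
    move=> mN aD bD; apply: connect_rin_mono (connP _ _ cD _ _ aD bD).
    apply: (subset_trans sD); apply: setDS; by rewrite sub1set.
  have ctP a b : (a, b) \in cut e D (W :\: D) -> [/\ a \in D, b \in N & e a b].
    rewrite inE /= => /and3P[aD /setDP[bW bD] eab]; split=> //.
    have /setDP[aQ aN] := subsetP sD _ aD.
    have bQ : b \in Q.
      rewrite inE bW andbT; apply: contra aN => bK; rewrite inE aQ.
      by apply/exists_inP; exists b.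
    by apply: contraNT bD => bN; apply: (comp_step uQN aD) => //; rewrite inE bN.
  (* Two neighbours in D and one in K exhaust the degree of n, so n is neither s nor a target and
     its two neighbours on the path lie in D. The path can then be rerouted through D around n,
     against [sep]. *)
  have one n a b : n \in N -> a \in D -> b \in D -> e a n -> e b n -> a = b.
    move=> nN aD bD ean ebn; apply/eqP/negPn/negP => ab.
    have := nN; rewrite inE => /andP[nQ /exists_inP[k kK enk]].
    have nW := subsetP QsW _ nQ.
    have DQ z : z \in D -> z \in Q by move/(subsetP sD)/setDP => [].
    have QK z : z \in Q -> z != k by apply: contraTneq => ->; rewrite inE kK.
    have sub : [set a; b; k] \subset nb e n :&: W.
      apply/subsetP => z; rewrite !inE -orbA => /or3P[]/eqP->.
      - by rewrite esym ean (subsetP QsW) ?DQ.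
      - by rewrite esym ebn (subsetP QsW) ?DQ.
      by rewrite enk (subsetP sKW).
    have c3 : #|[set a; b; k]| = 3.
      by rewrite setUC cardsU1 cards2 in_set2 negb_or ab ![k == _]eq_sym !QK ?DQ.
    have : n \notin s |: Tg.
      by apply/negP => /deg2 le2; have := leq_trans (subset_leq_card sub) le2; rewrite c3.
    rewrite !inE negb_or => /andP[ns nT].
    have nl : n != last s p by rewrite lp; apply: contraNneq nT => ->.
    have [x [y [xp yp exn eny /andP[ixn iny]]]] := path_interior_nbrs hp up (Np _ nN) ns nl.
    have eqs : [set a; b; k] = nb e n :&: W.
      by apply/eqP; rewrite eqEcard sub c3 deg3.
    have inD z : z \in s :: p -> e n z -> z \in D.
      move=> zp enz; have zQ := sp _ zp.
      have : z \in nb e n :&: W by rewrite !inE enz (subsetP QsW).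
      rewrite -eqs in_setU in_set2 in_set1 (negbTE (QK _ zQ)) orbF.
      by case/orP => /eqP->.
    have xD : x \in D by apply: inD => //; rewrite esym.
    have yD : y \in D by apply: inD.
    apply: (sep n t) => //.
    apply: connect_trans (pre x n xp (Np _ nN) ixn) _.
    exact: connect_trans (Dcon n x y nN xD yD) (post y n yp (Np _ nN) iny).
  have bound k : k < #|cut e D (W :\: D)| -> k < #|[set q.2 | q in cut e D (W :\: D)]|.
    rewrite card_in_imset // => -[a b] [a' b'] /ctP[aD bN eab] /ctP[a'D _ ea'b'] /= E.
    by rewrite -E in ea'b' *; rewrite (one _ _ _ bN aD a'D eab ea'b').
  have imP b : b \in [set q.2 | q in cut e D (W :\: D)] -> [/\ b \in N, b \in s :: p & exists2 a, a \in D & e a b].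
    case/imsetP => -[a b'] /ctP[aD bN eab] /= ->; split=> //; first exact: Np.
    by exists a.
  have ixI b b' : b \in s :: p -> b != b' -> ix b != ix b'.
    by move=> bp; apply: contraNneq => E; rewrite -(nth_index s bp) -/(ix b) E nth_index // -index_mem -/(ix b') -E index_mem.
  (* A detour through D from a to c would bypass b; hence of three attachment vertices the middle
     one on the path gives a contradiction. *)
  have btw a b c : a \in [set q.2 | q in cut e D (W :\: D)] -> b \in N ->
      c \in [set q.2 | q in cut e D (W :\: D)] -> ix a < ix b -> ix b < ix c -> False.
    move=> /imP[aN ap [a' a'D ea]] bN /imP[cN cp [c' c'D ec]] ab bc.
    have bp := Np _ bN.
    have aQ : a \in Q :\ b.
      by rewrite in_setD1 (subsetP NQ) // andbT; apply: contraTneq ab => ->; rewrite ltnn.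
    have cQb : c \in Q :\ b.
      by rewrite in_setD1 (subsetP NQ) // andbT; apply: contraTneq bc => ->; rewrite ltnn.
    have DQb z : z \in D -> z \in Q :\ b.
      move/(subsetP sD)/setDP => [zQ zN]; rewrite in_setD1 zQ andbT.
      by apply: contraNneq zN => ->.
    apply: (sep b t) => //; first exact: ix0 ab.
    apply: connect_trans (pre a b ap bp ab) _.
    apply: (@connect_trans _ _ a'); first by apply: connect_rin1 => //; [exact: DQb | rewrite esym].
    apply: (@connect_trans _ _ c'); first exact: Dcon.
    apply: (@connect_trans _ _ c); first by apply: connect_rin1 => //; exact: DQb.
    exact: post.
  have two : #|cut e D (W :\: D)| <= 2.
    rewrite leqNgt; apply/negP => /bound/card_gt2P[a [b [c [[ai bi ci] [ab bc ca]]]]].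
    have [[[aN ap _] [bN bp _]] [cN cp _]] := (imP _ ai, imP _ bi, imP _ ci).
    have := ixI _ _ ap ab; have := ixI _ _ bp bc; have := ixI _ _ cp ca.
    case: (ltngtP (ix c) (ix a)) => // l1 _; case: (ltngtP (ix b) (ix c)) => // l2 _;
    case: (ltngtP (ix a) (ix b)) => // l3 _.
    - by have := ltn_trans (ltn_trans l1 l3) l2; rewrite ltnn.
    - exact: (btw b c a).
    - exact: (btw c a b).
    - exact: (btw c b a).
    - exact: (btw a b c).
    - exact: (btw b a c).
    - exact: (btw a c b).
    by have := ltn_trans (ltn_trans l1 l2) l3; rewrite ltnn.
  (* With s in D the first of two attachment vertices could be bypassed, and with a target in D the
     second one could. *)
  have onei i : i \in D -> (i = s \/ i \in Tg) -> #|cut e D (W :\: D)| <= 1.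
    move=> iD iE; rewrite leqNgt; apply/negP => /bound/card_gt1P[a [b [ai bi ab]]].
    wlog lt : a b ai bi ab / ix a < ix b.
      move=> h; have [aN ap _] := imP _ ai.
      have := ixI _ _ ap ab; case: (ltngtP (ix a) (ix b)) => // l _.
        exact: (h a b).
      by apply: (h b a) => //; rewrite eq_sym.
    have [[aN ap [a' a'D ea]] [bN bp [b' b'D eb]]] := (imP _ ai, imP _ bi).
    have /setDP[iQ iN] := subsetP sD _ iD.
    case: iE => iE.
      apply: (sep a t) => //; first by apply: contraNneq iN => aS; rewrite iE -aS.
      rewrite -iE; apply: (@connect_trans _ _ b'); first exact: Dcon.
      apply: connect_trans (post b a bp ap lt).
      apply: connect_rin1 => //.
        have /setDP[bQ' bN'] := subsetP sD _ b'D.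
        by rewrite in_setD1 bQ' andbT; apply: contraNneq bN' => ->.
      by rewrite in_setD1 (subsetP NQ) // andbT eq_sym.
    apply: (sep b i) => //; first exact: ix0 lt.
    apply: connect_trans (pre a b ap bp lt) _.
    apply: (@connect_trans _ _ a'); last exact: Dcon.
    apply: connect_rin1; last by rewrite esym.
      by rewrite in_setD1 (subsetP NQ) // andbT.
    have /setDP[bQ' bN'] := subsetP sD _ a'D.
    by rewrite in_setD1 bQ' andbT; apply: contraNneq bN' => ->.
  (* When s is in D, no target can be there: s would reach it inside D, which avoids N, while N
     contains a vertex because W is connected, and that vertex should separate them. *)
  have [sD1|sD1] := boolP (s \in D).
    have := onei s sD1 (or_introl erefl); rewrite leqNgt h1 // => _.
    apply/pred0Pn => -[z /andP[zD zT]].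
    have /set0Pn[k0 k0K] := nK.
    have k0Q : k0 \notin Q by rewrite inE k0K.
    have [n [k [nW nQ kW kQ enk]]] := conn_crossing cW sW sQ (subsetP sKW _ k0K) k0Q.
    have nN : n \in N.
      rewrite inE nQ; apply/exists_inP; exists k => //.
      by move: kQ; rewrite inE kW andbT negbK.
    apply: (sep n z) => //; last exact: Dcon.
    have /setDP[_ sN] := subsetP sD _ sD1.
    by apply: contraNneq sN => <-.
  have [dT|/pred0Pn[z /andP[zD zT]]] := boolP [disjoint D & Tg].
    by have := h2 D DWK0 nD sD1 dT; rewrite ltnNge two.
  have := onei z zD (or_intror zT); rewrite leqNgt h1 //.
  by rewrite (negbTE sD1).
have QE : Q = [set z in s :: p].
  apply/eqP; rewrite eqEsubset; apply/andP; split; apply/subsetP => z.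
    by move/(subsetP QN)/Np; rewrite inE.
  by rewrite inE => /sp.
have KE : W :\: [set z in s :: p] = K.
  by rewrite -QE /Q setDDr setDv set0U; apply/setIidPr.
exists p; rewrite KE; split; split=> //; first by rewrite lp.
  by move=> z /sp /(subsetP QsW).
by move=> v /sp /(subsetP QN); rewrite inE => /andP[_ /exists_inP[k kK evk]]; exists k.
Qed.
End NonseparatingPath.

(** * Disjoint linkages *)

Lemma disjoint_setU1 (V : finType) (x : V) (A B : {set V}) :
  [disjoint x |: A & B] = (x \notin B) && [disjoint A & B].
Proof. by rewrite -!setI_eq0 setIUl setU_eq0 setI_eq0 disjoints1. Qed.

Section TwoLinked.
Variables (V : finType) (e : rel V).
Hypothesis esym : symmetric e.
Implicit Types (X Y Z C : {set V}) (x y z u v a t : V).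

(* The endpoint x is moved to x' along an edge; when x' is already used by the
   set that leads to t, the part of that set on the far side of x' is replaced
   by a component of what remains of Y, which is joined to one of the two
   sets because x' is not a cut vertex. *)
Lemma two_linked_step Y (a a' x x' t : V) C1 C2 :
  conn e (Y :\ x') -> conn e C1 -> conn e C2 -> C1 \subset Y -> C2 \subset Y ->
  [disjoint C1 & C2] -> a' \in C1 -> x \in C1 -> a \in C2 -> t \in C2 ->
  e x x' -> x' \in Y -> x' != t ->
  exists D1 D2, [/\ conn e D1, conn e D2, D1 \subset Y, D2 \subset Y & [disjoint D1 & D2]] /\
   [/\ x' \in D1, t \in D2 & (a' \in D1 /\ a \in D2) \/ (a \in D1 /\ a' \in D2)].
Proof.
move=> cY c1 c2 s1 s2 dis a'1 x1 a2 t2 exx' x'Y x't.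
have cx'1 : conn e (x' |: C1) := connU1 esym c1 x1 exx'.
have sx'1 : x' |: C1 \subset Y by rewrite subUset sub1set x'Y.
have [x'C2|x'C2] := boolP (x' \in C2); last first.
  exists (x' |: C1), C2; split; split=> //; rewrite ?setU11 //.
    by rewrite disjoint_setU1 x'C2.
  by left; rewrite inE a'1 orbT.
pose U2 := if a == x' then set0 else comp e (C2 :\ x') a.
have sU2 : U2 \subset C2 :\ x'.
  rewrite /U2; case: eqP => [_|/eqP ax]; first exact: sub0set.
  by apply: comp_sub; rewrite in_setD1 ax.
have sU2C : U2 \subset C2 := subset_trans sU2 (subD1set _ _).
have x'U2 : x' \notin U2 by apply/negP => /(subsetP sU2); rewrite !inE eqxx.
have cU2 : conn e U2.
  rewrite /U2; case: eqP => [_|/eqP ax]; first exact: conn0.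
  by apply: conn_comp => //; rewrite in_setD1 ax.
have aU2 : a != x' -> a \in U2.
  by rewrite /U2 => /negbTE->; apply: mem_comp.
have cx'U2 : conn e (x' |: U2).
  have [ax|ax] := eqVneq a x'; first by rewrite /U2 ax eqxx setU0; apply: conn1.
  have [u [v [_ uU v2 vU euv]]] := conn_crossing c2 a2 (aU2 ax) x'C2 x'U2.
  apply: (connU1 esym cU2 uU); suff -> : x' = v by [].
  apply/eqP/negPn/negP => vx; case/negP: vU.
  move: uU; rewrite /U2 (negbTE ax) => uU; apply: comp_step uU _ euv.
    by rewrite in_setD1 ax.
  by rewrite in_setD1 eq_sym vx.
have ax'U2 : a \in x' |: U2.
  by have [->|ax] := eqVneq a x'; rewrite ?setU11 // inE aU2 ?orbT.
have sx'U2 : x' |: U2 \subset Y.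
  by rewrite subUset sub1set x'Y (subset_trans sU2C).
have dx' z : z \in C1 -> z != x'.
  by move=> z1; apply: contraTneq z1 => ->; rewrite (disjointFl dis x'C2).
have [tU2|tU2] := boolP (t \in U2).
  exists (x' |: C1), U2; split; split=> //; rewrite ?setU11 //.
  - exact: subset_trans sU2C s2.
  - by rewrite disjoint_setU1 x'U2 /=; apply: disjointWr dis.
  left; rewrite inE a'1 orbT; split=> //; apply: aU2.
  by apply: contraTneq tU2 => ax; rewrite /U2 ax eqxx inE.
have tR : t \in Y :\ x' :\: (C1 :|: U2).
  rewrite !in_setD in_setU negb_or tU2 (disjointFl dis t2) in_set1 eq_sym x't /=.
  exact: (subsetP s2).
pose Z := comp e (Y :\ x' :\: (C1 :|: U2)) t.
have sZ := comp_sub e tR; have cZ : conn e Z := conn_comp esym tR.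
have tZ : t \in Z := mem_comp _ _ _.
have Zout z : z \in Z -> [/\ z \in Y, z != x', z \notin C1 & z \notin U2].
  by move=> /(subsetP sZ); rewrite !in_setD in_setU negb_or in_set1 => /andP[/andP[-> ->] /andP[-> ->]].
have sZY : Z \subset Y by apply/subsetP => z /Zout[].
have tY' : t \in Y :\ x' by rewrite in_setD1 eq_sym x't (subsetP s2).
have xY' : x \in Y :\ x' by rewrite in_setD1 dx' // (subsetP s1).
have xZ : x \notin Z by apply/negP => /Zout[_ _]; rewrite x1.
have [u [v [_ uZ vY' vZ euv]]] := conn_crossing cY tY' tZ xY' xZ.
have : v \in C1 :|: U2.
  apply: contraR vZ => vn; apply: (comp_step tR uZ) euv.
  by rewrite in_setD vn.
rewrite in_setU => /orP[v1|vU].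
  exists (x' |: U2), (C1 :|: Z); split; split=> //; rewrite ?setU11 // ?in_setU ?tZ ?orbT //.
  - by apply: (connU esym c1 cZ v1 uZ); rewrite esym euv orbT.
  - by rewrite subUset s1.
  - rewrite disjoint_setU1 in_setU negb_or -andbA; apply/and3P; split.
    + by apply/negP => /dx'; rewrite eqxx.
    + by apply/negP => /Zout[_]; rewrite eqxx.
    rewrite disjoint_sym disjoint_subset; apply/subsetP => z; rewrite in_setU => /orP[z1|/Zout[]//].
    apply/negP => zU; by have := disjointFr dis z1; rewrite (subsetP sU2C).
  by right; rewrite a'1 -in_setU.
exists (x' |: C1), (U2 :|: Z); split; split=> //; rewrite ?setU11 // ?in_setU ?tZ ?orbT //.
- by apply: (connU esym cU2 cZ vU uZ); rewrite esym euv orbT.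
- by rewrite subUset (subset_trans sU2C).
- rewrite disjoint_setU1 in_setU negb_or x'U2 /=; apply/andP; split.
    by apply/negP => /Zout[_]; rewrite eqxx.
  rewrite disjoint_sym disjoint_subset; apply/subsetP => z; rewrite in_setU => /orP[zU|/Zout[]//].
  by apply/negP => z1; have := disjointFr dis z1; rewrite (subsetP sU2C).
left; rewrite ?in_setU a'1 orbT aU2 //; apply: contraTneq vU => ax.
by rewrite /U2 ax eqxx inE.
Qed.

(** This is Menger's theorem for two disjoint paths, with connected sets in place of paths and the
    matching of the ends left open. An evident linkage that ends at some z0 instead of x is carried
    to x along a walk avoiding t. *)
Lemma two_linked Y (a1 a2 x t : V) :
  (forall v, v \in Y -> conn e (Y :\ v)) ->
  a1 \in Y -> a2 \in Y -> a1 != a2 -> x \in Y -> t \in Y -> x != t ->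
  exists C1 C2, [/\ conn e C1, conn e C2, C1 \subset Y, C2 \subset Y & [disjoint C1 & C2]] /\
   [/\ x \in C1, t \in C2 & (a1 \in C1 /\ a2 \in C2) \/ (a2 \in C1 /\ a1 \in C2)].
Proof.
move=> cut a1Y a2Y a12 xY tY xt.
pose L z := exists C1 C2, [/\ conn e C1, conn e C2, C1 \subset Y, C2 \subset Y & [disjoint C1 & C2]] /\
   [/\ z \in C1, t \in C2 & (a1 \in C1 /\ a2 \in C2) \/ (a2 \in C1 /\ a1 \in C2)].
(* If t is a1, the singletons of a2 and a1 link; otherwise z0 is a1, with the connected set Y minus
   a1 on the other side. *)
have [z0 z0Y L0] : exists2 z, z \in Y :\ t & L z.
  have [ta|ta] := eqVneq t a1.
    exists a2; first by rewrite in_setD1 ta eq_sym a12.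
    exists [set a2], [set a1]; rewrite !conn1 !sub1set ta !set11 disjoints1 inE eq_sym a12.
    by split=> //; split=> //; right.
  exists a1; first by rewrite in_setD1 eq_sym ta.
  exists [set a1], (Y :\ a1); rewrite conn1 cut // sub1set a1Y subD1set disjoints1.
  rewrite !inE eqxx ta tY; split=> //; split=> //; left.
  by rewrite eq_sym a12.
have xY' : x \in Y :\ t by rewrite in_setD1 xt.
have /connP/(_ z0 x z0Y xY')/connectP[p hp ->] := cut t tY.
elim: p z0 {z0Y} L0 hp => //= y p IH z Lz /andP[/and3P[_ yY' ezy] hp].
apply: IH hp; move: yY'; rewrite in_setD1 => /andP[yt yY].
have [C1 [C2 [[c1 c2 s1 s2 dis] [zC tC [[h1 h2]|[h1 h2]]]]]] := Lz.
  exact: (two_linked_step (cut y yY) c1 c2 s1 s2 dis h1 zC h2 tC ezy).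
have [D1 [D2 [h [? ? h']]]] := two_linked_step (cut y yY) c1 c2 s1 s2 dis h1 zC h2 tC ezy yY yt.
by exists D1, D2; split=> //; split=> //; case: h'; [right|left].
Qed.
End TwoLinked.

(** * Edge sets *)

Lemma set2_eq (V : finType) (x y u v : V) :
  [set x; y] = [set u; v] -> (x = u /\ y = v) \/ (x = v /\ y = u).
Proof.
move=> E.
have : x \in [set u; v] by rewrite -E set21.
have : y \in [set u; v] by rewrite -E set22.
have : u \in [set x; y] by rewrite E set21.
have : v \in [set x; y] by rewrite E set22.
rewrite !in_set2 => /orP[]/eqP h1 /orP[]/eqP h2 /orP[]/eqP h3 /orP[]/eqP h4;
  subst; auto.
Qed.

Definition erel (V : finType) (T : {set {set V}}) : rel V :=
  [rel x y | [set x; y] \in T].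

Lemma erel_sym (V : finType) (T : {set {set V}}) : symmetric (erel T).
Proof. by move=> x y; rewrite /erel /= setUC. Qed.

Section Edges.
Variables (V : finType) (e : rel V).
Hypotheses (esym : symmetric e) (eirr : irreflexive e).
Implicit Types (X Y Z W : {set V}) (S T B : {set {set V}}) (x y z u v : V).

Definition edges X : {set {set V}} :=
  [set [set p.1; p.2] | p in cut e X X].

Lemma edgesP X (f : {set V}) :
  reflect (exists x y, [/\ x \in X, y \in X, e x y & f = [set x; y]]) (f \in edges X).
Proof.
apply: (iffP imsetP) => [[[x y]]|[x [y [xX yX exy ->]]]].
  by rewrite inE /= => /and3P[xX yX exy] ->; exists x, y.
by exists (x, y) => //; rewrite inE /= xX yX.
Qed.

Lemma mem_edges X x y : ([set x; y] \in edges X) = [&& x \in X, y \in X & e x y].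
Proof.
apply/edgesP/and3P => [[u [v [uX vX euv]]]|[xX yX exy]]; last by exists x, y.
by case/set2_eq => -[-> ->] //; rewrite esym.
Qed.

Lemma edges_mono X Y : X \subset Y -> edges X \subset edges Y.
Proof.
move=> /subsetP s; apply/subsetP => f /edgesP[x [y [xX yX exy ->]]].
by rewrite mem_edges !s.
Qed.

Lemma edges_disjoint X Y : [disjoint X & Y] -> [disjoint edges X & edges Y].
Proof.
move=> dis; rewrite disjoint_subset; apply/subsetP => f /edgesP[x [y [xX yX exy ->]]].
by rewrite !inE mem_edges (disjointFr dis xX).
Qed.

Lemma card_cut_edges X : #|cut e X X| = 2 * #|edges X|.
Proof.
pose h (p : V * V) := [set p.1; p.2].
rewrite -sum1_card (partition_big_imset h) /= -/(edges X).
rewrite (eq_bigr (fun _ => 2)); first by rewrite sum_nat_const mulnC.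
move=> f /edgesP[x [y [xX yX exy ->]]].
have xy : x != y by apply: contraTneq exy => ->; rewrite eirr.
rewrite sum1_card (_ : #|_| = #|[set (x, y); (y, x)]|); last first.
  apply: eq_card.
  move=> [u v]; rewrite !inE /= /in_mem /= /h /=.
  apply/andP/orP => [[_ /eqP/set2_eq]|].
    by case=> -[-> ->]; [left|right].
  change (((u, v) == (x, y)) \/ ((u, v) == (y, x)) ->
    ((u, v) \in cut e X X) /\ [set u; v] == [set x; y]).
  rewrite inE /=; case=> /eqP[-> ->]; first by rewrite xX yX exy.
  by rewrite xX yX esym exy setUC.
by rewrite cards2 xpair_eqE negb_and xy.
Qed.

Lemma card_cut_sum X Z : #|cut e X Z| = \sum_(x in X) #|nb e x :&: Z|.
Proof.
rewrite -sum1_card (partition_big fst (mem X)) /=; last by move=> p; rewrite inE => /andP[].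
apply: eq_bigr => x xX; rewrite sum1dep_card.
have inj : injective (fun y : V => (x, y)) by move=> a b [].
rewrite -(card_imset _ inj); apply: eq_card => -[a b].
apply/idP/imsetP => [|[y]]; rewrite !inE /=.
  by case/andP => /and3P[_ bZ eab] /eqP <-; exists b; rewrite // !inE eab.
by case/andP=> exy yZ [-> ->]; rewrite xX eqxx yZ exy.
Qed.

(** A maximal K inside W that contains x and spans at least |K| - 1 edges is all of W, since an edge
    crossing out of K would enlarge it. *)
Lemma card_conn_edges T W :
  conn (erel T) W -> #|W| <= #|[set f in T | f \subset W]|.+1.
Proof.
move=> cW; have [->|[x xW]] := set_0Vmem W; first by rewrite cards0.
pose ok (K : {set V}) := [&& K \subset W, x \in K & #|K| <= #|[set f in T | f \subset K]|.+1].
have ok1 : ok [set x] by rewrite /ok sub1set xW set11 cards1.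
have [K /maxsetP[/and3P[sK xK cK] maxK] _] := maxset_exists ok1.
have [<- //|neK] := eqVneq K W.
have [y yW yK] : exists2 y, y \in W & y \notin K.
  by apply/subsetPn; apply: contra neK => s; rewrite eqEsubset sK.
have [u [v [uW uK vW vK euv]]] := conn_crossing cW xW xK yW yK.
have : ok (v |: K).
  rewrite /ok subUset sub1set vW sK setU1r //= cardsU1 vK add1n ltnS.
  apply: leq_trans cK _; apply: proper_card; apply/properP; split.
    apply/subsetP => f; rewrite !inE => /andP[-> s]; apply: subset_trans s (subsetUr _ _).
  exists [set u; v]; rewrite inE; first by rewrite [_ \in T]euv subUset !sub1set setU11 setU1r.
  by rewrite negb_and subUset !sub1set (negbTE vK) andbF orbT.
by move=> /maxK/(_ (subsetUr _ _)) E; rewrite -E setU11 in vK.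
Qed.

End Edges.

(** * Cubic 3-connected graphs and peripheral cycles *)

Record cubic_3conn (V : finType) (e : rel V) (Vs : {set V}) : Prop := Cubic3Conn {
  c3_sym : symmetric e;
  c3_irr : irreflexive e;
  c3_in : forall x y, e x y -> x \in Vs;
  c3_deg : forall x, x \in Vs -> #|nb e x| = 3;
  c3_conn : forall X : {set V}, X \subset Vs -> #|X| < 3 -> conn e (Vs :\: X) }.

(* The cycle s is peripheral: every vertex of s has an edge to the complement,
   which is connected. *)
Definition peripheral_bound (V : finType) (e : rel V) (Vs : {set V}) (q : nat) : Prop :=
  forall s : seq V, uniq s -> 2 < size s -> cycle e s -> {subset s <= Vs} ->
    conn e (Vs :\: [set z in s]) ->
    (forall v, v \in s -> exists2 k, k \in Vs :\: [set z in s] & e v k) ->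
    size s <= q.

Section Cubic.
Variables (V : finType) (e : rel V) (Vs : {set V}).
Hypothesis G : cubic_3conn e Vs.
Implicit Types (X Y Z D K A P W : {set V}) (x y z u v w : V) (p s : seq V).

Let esym := c3_sym G.
Let eirr := c3_irr G.

Lemma c3_inr x y : e x y -> y \in Vs.
Proof. by rewrite esym; apply: (c3_in G). Qed.

Lemma nb_sub x : nb e x \subset Vs.
Proof. by apply/subsetP => y; rewrite inE => /c3_inr. Qed.

Lemma nbI_le3 x Z : x \in Vs -> #|nb e x :&: Z| <= 3.
Proof. by move=> xV; rewrite -(c3_deg G xV) subset_leq_card // subsetIl. Qed.

Lemma nbrs_le3 x s : x \in Vs -> uniq s -> all (e x) s -> size s <= 3.
Proof.
move=> xV us /allP h; rewrite -(c3_deg G xV) -(card_uniqP us).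
by apply: subset_leq_card; apply/subsetP => y /h; rewrite inE.
Qed.

Lemma nbrs_eq3 x y a b c : x \in Vs -> uniq [:: a; b; c] -> e x a -> e x b -> e x c ->
  e x y -> y \in [:: a; b; c].
Proof.
move=> xV us xa xb xc xy; apply: contraT => yn.
by have := @nbrs_le3 x [:: y; a; b; c] xV; rewrite cons_uniq yn us /= xa xb xc xy => /(_ isT isT).
Qed.

Lemma nbI_other x Z y : x \in Vs -> e x y -> y \notin Z -> #|nb e x :&: Z| <= 2.
Proof.
move=> xV exy yZ; rewrite -ltnS -(c3_deg G xV); apply: proper_card.
by apply/properP; split; [exact: subsetIl | exists y; rewrite !inE ?exy ?(negbTE yZ)].
Qed.

Lemma card_nbI_in x Z a b : e x a -> e x b -> a != b -> a \in Z -> b \in Z -> 1 < #|nb e x :&: Z|.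
Proof. by move=> xa xb ab aZ bZ; apply/card_gt1P; exists a, b; rewrite !inE xa xb aZ bZ. Qed.

Lemma nbI_others x Z a b : x \in Vs -> e x a -> e x b -> a != b ->
  a \notin Z -> b \notin Z -> #|nb e x :&: Z| <= 1.
Proof.
move=> xV xa xb ab aZ bZ; rewrite leqNgt; apply/negP => /card_gt1P[c [d []]].
rewrite !inE => /andP[xc cZ] /andP[xd dZ] cd.
have := @nbrs_le3 x [:: a; b; c; d] xV; rewrite /= !inE xa xb xc xd !negb_or ab cd.
have ne z t : z \notin Z -> t \in Z -> z != t by move=> zZ; apply: contraTneq => <-.
by rewrite !ne // => /(_ isT isT).
Qed.

(** With at most two outgoing edges, their ends S in Z number at most two. If Z has another vertex,
    deleting S disconnects the graph. If not, |Z| is 1 or 2, and the degree sum 3|Z| exceeds |Z|(|Z|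
    - 1) + 2. *)
Lemma cut3 Z : Z \subset Vs -> Z != set0 -> Z != Vs -> 2 < #|cut e Z (Vs :\: Z)|.
Proof.
move=> sZ nZ ZV; rewrite ltnNge; apply/negP => le2.
pose S := [set p.1 | p in cut e Z (Vs :\: Z)].
have cS : #|S| <= 2 := leq_trans (leq_imset_card _ _) le2.
have SZ : S \subset Z.
  by apply/subsetP => x /imsetP[[u v]]; rewrite inE /= => /and3P[uZ _ _] ->.
have [ZS | /subsetPn[z zZ zS]] := boolP (Z \subset S).
  have cZ : #|Z| <= 2 by rewrite (leq_trans (subset_leq_card ZS)).
  have tot : #|cut e Z Vs| = #|Z| * 3.
    rewrite card_cut_sum -sum_nat_const; apply: eq_bigr => x xZ.
    by rewrite (setIidPl (nb_sub x)) (c3_deg G) // (subsetP sZ).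
  have ins : #|cut e Z Z| <= #|Z| * #|Z|.-1.
    rewrite card_cut_sum -sum_nat_const; apply: leq_sum => x xZ.
    rewrite (cardsD1 x Z) xZ add1n /=; apply: subset_leq_card.
    apply/subsetP => y; rewrite !inE => /andP[exy ->]; rewrite andbT.
    by apply: contraTneq exy => ->; rewrite eirr.
  have E : #|cut e Z Vs| = #|cut e Z Z| + #|cut e Z (Vs :\: Z)|.
    rewrite -cutU; last by rewrite disjoint_sym disjoints_subset setDE subsetIr.
    by rewrite -{1}(setID Vs Z) (setIidPr sZ).
  move: nZ cZ tot ins; rewrite -card_gt0 E.
  case: #|Z| => [|[|[|n]]] // _ _ h1 h2.
    by have := leq_add h2 le2; rewrite h1.
  by have := leq_add h2 le2; rewrite h1.
have cV : conn e (Vs :\: S) by apply: (c3_conn G) => //; apply: subset_trans SZ sZ.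
have [y yV yZ] : exists2 y, y \in Vs & y \notin Z.
  by apply/subsetPn; apply: contra ZV => s; rewrite eqEsubset sZ.
have zV' : z \in Vs :\: S by rewrite inE zS (subsetP sZ).
have yV' : y \in Vs :\: S by rewrite inE yV andbT; apply: contra yZ; apply: (subsetP SZ).
have [u [v [uV uZ vV vZ euv]]] := conn_crossing cV zV' zZ yV' yZ.
have : u \in S by apply/imsetP; exists (u, v); rewrite // !inE /= uZ vZ euv (c3_inr euv).
by move: uV; rewrite inE => /andP[/negP].
Qed.

Lemma cut_eq0 D Z : (forall u v, u \in D -> v \in Z -> ~~ e u v) -> #|cut e D Z| = 0.
Proof.
move=> h; apply/eqP; rewrite cards_eq0; apply/eqP/setP => -[u v]; rewrite !inE /=.
by apply/negbTE/negP => /and3P[uD vZ]; apply/negP/h.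
Qed.

Lemma cut_le1 D Z x y : (forall u v, u \in D -> v \in Z -> e u v -> u = x /\ v = y) -> #|cut e D Z| <= 1.
Proof.
move=> h; rewrite -(cards1 (x, y)); apply: subset_leq_card; apply/subsetP => -[u v].
by rewrite !inE /= => /and3P[uD vZ /(h _ _ uD vZ)[-> ->]].
Qed.

(** The ear is closed up by a path from y to x inside A, chosen by [nonseparating_path] so that the
    rest of A together with K0 stays connected; the resulting cycle is peripheral. *)
Lemma ear_bound q (A K0 : {set V}) w p x y :
  peripheral_bound e Vs q ->
  path e w p -> uniq (w :: p) ->
  Vs = [set z in w :: p] :|: (A :|: K0) ->
  [disjoint [set z in w :: p] & A :|: K0] -> [disjoint A & K0] ->
  conn e A -> conn e K0 -> (exists a k, [/\ a \in A, k \in K0 & e a k]) ->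
  (forall v, v \in w :: p -> exists2 k, k \in K0 & e v k) ->
  x \in A -> y \in A -> x != y -> e w x -> e (last w p) y ->
  (forall a v, a \in A -> v \in w :: p -> e a v -> (a = x /\ v = w) \/ (a = y /\ v = last w p)) ->
  size p + 3 <= q.
Proof.
move=> bq hp up VE dP dAK cA cK0 [a0 [k0 [a0A k0K ea0]]] hK xA yA xy ewx ely hAP.
set P := [set z in w :: p] in VE dP.
have AV : A \subset Vs by rewrite VE setUCA subsetUl.
have KV : K0 \subset Vs by rewrite VE setUA subsetUr.
have PV : P \subset Vs by rewrite VE subsetUl.
have WE : Vs :\: P = A :|: K0.
  rewrite VE setDUl setDv set0U; apply/setDidPl.
  by rewrite disjoint_sym.
have AW : (A :|: K0) :\: K0 = A.
  by rewrite setDUl setDv setU0; apply/setDidPl.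
have cW : conn e (A :|: K0) by apply: (connU esym cA cK0 a0A k0K); rewrite ea0 orbT.
have inP z : (z \in P) = (z \in w :: p) by rewrite inE.
have wP : w \in P by rewrite inP mem_head.
have lP : last w p \in P by rewrite inP mem_last.
have nWP z : z \in A :|: K0 -> z \notin P by move=> zW; rewrite (disjointFl dP zW).
(* Only x and y have an edge to P, so omitting P costs D at most one edge for each of them that it
   contains; this gives both cut hypotheses. *)
have cutD D : D \subset A -> D != set0 -> 2 < #|cut e D ((A :|: K0) :\: D)| + #|cut e D P|.
  move=> sD nD; rewrite -cutU; last first.
    by rewrite disjoint_sym; apply: disjointWr dP; apply: subsetDl.
  have -> : ((A :|: K0) :\: D) :|: P = Vs :\: D.
    rewrite VE [in RHS]setDUl setUC; congr (_ :|: _); symmetry; apply/setDidPl.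
    by apply: disjointWr dP; apply: subset_trans sD (subsetUl _ _).
  apply: cut3 => //; first exact: subset_trans sD AV.
  apply: contraTneq k0K => DV; apply/negP => k0K.
  have : k0 \in A by apply: (subsetP sD); rewrite DV (subsetP KV).
  by move=> k0A; rewrite (disjointFr dAK k0A) in k0K.
have h1 D : D \subset (A :|: K0) :\: K0 -> D != set0 -> (y \in D -> [disjoint D & [set x]]) ->
    1 < #|cut e D ((A :|: K0) :\: D)|.
  rewrite AW => sD nD yx; have := cutD D sD nD.
  have : #|cut e D P| <= 1.
    have [yD|yD] := boolP (y \in D).
      apply: (@cut_le1 _ _ y (last w p)) => u v uD vP euv.
      rewrite inP in vP; case: (hAP u v (subsetP sD _ uD) vP euv) => -[ux vw] //.
      by have := disjointFr (yx yD) uD; rewrite ux set11.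
    apply: (@cut_le1 _ _ x w) => u v uD vP euv.
    rewrite inP in vP; case: (hAP u v (subsetP sD _ uD) vP euv) => -[ux vw] //.
    by rewrite -ux uD in yD.
  by move=> h1 h2; have := leq_trans h2 (leq_add (leqnn _) h1); rewrite addn1.
have h2 D : D \subset (A :|: K0) :\: K0 -> D != set0 -> y \notin D -> [disjoint D & [set x]] ->
    2 < #|cut e D ((A :|: K0) :\: D)|.
  rewrite AW => sD nD yD xD; have := cutD D sD nD.
  rewrite [X in _ + X]cut_eq0 ?addn0 // => u v uD vP; apply/negP => euv.
  rewrite inP in vP; case: (hAP u v (subsetP sD _ uD) vP euv) => -[ux vw].
    by have := disjointFr xD uD; rewrite ux set11.
  by rewrite -ux uD in yD.
have deg3 v : v \in A :|: K0 -> #|nb e v :&: (A :|: K0)| <= 3.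
  by rewrite -WE => /setDP[vV _]; apply: nbI_le3.
have deg2 v : v \in y |: [set x] -> #|nb e v :&: (A :|: K0)| <= 2.
  rewrite !inE => /orP[]/eqP->.
    apply: (@nbI_other _ _ (last w p)); rewrite 1?esym //; first exact: (subsetP AV).
    by rewrite (disjointFr dP).
  apply: (@nbI_other _ _ w); rewrite 1?esym //; first exact: (subsetP AV).
  by rewrite (disjointFr dP).
have nK0 : K0 != set0 by apply/set0Pn; exists k0.
have ysW : y \in (A :|: K0) :\: K0 by rewrite AW.
have con : connect (rin e ((A :|: K0) :\: K0)) y x by rewrite AW; apply: (connP _ _ cA).
have sxW : [set x] \subset A :|: K0 by rewrite sub1set inE xA.
have ynx : y \notin [set x] by rewrite inE eq_sym.
have [b [[hb ub lb sK0 cK] [sb hbK]]] := nonseparating_path esym cW cK0 (subsetUr _ _) nK0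
  ysW (set11 x) con sxW ynx deg3 deg2 h1 h2.
have lbx : last y b = x by apply/set1P.
pose s := (w :: p) ++ (y :: b).
have us : uniq s.
  rewrite /s cat_uniq up ub andbT; apply/hasPn => z zb.
  by have := nWP z (sb z zb); rewrite inP.
have cs : cycle e s.
  rewrite /s /= rcons_cat cat_path hp /= ely rcons_path hb lbx /=.
  by rewrite esym.
have sE : [set z in s] = P :|: [set z in y :: b].
  by apply/setP => z; rewrite in_setU inP !in_set mem_cat.
have KE : Vs :\: [set z in s] = (A :|: K0) :\: [set z in y :: b].
  by rewrite sE -setDDl WE.
have sb0 : 0 < size b.
  by case: (b) lbx => //= E; rewrite E eqxx in xy.
(* The ear has [size p + 1] vertices, and the return path at least the two vertices x and y. *)
have ss : size p + 3 <= size s by rewrite /s size_cat /= addSnnS leq_add2l !ltnS.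
apply: (leq_trans ss); apply: bq => //.
- exact: leq_trans (leq_addl _ _) ss.
- move=> z; rewrite /s mem_cat => /orP[|/sb].
    by rewrite -inP => /(subsetP PV).
  by rewrite -WE => /setDP[].
- by rewrite KE.
move=> v; rewrite KE /s mem_cat => /orP[/hK[k kK evk]|/hbK//].
by exists k => //; apply: (subsetP sK0).
Qed.

End Cubic.

(** * Ears *)

Section Stages.
Variables (V : finType) (e : rel V) (Vs : {set V}).
Hypothesis G : cubic_3conn e Vs.
Implicit Types (X Y Z D K A P W : {set V}) (x y z u v w c d : V) (p s : seq V).

Let esym' := c3_sym G.
Let eirr := c3_irr G.

(* A stage of the construction: the closure already contains the edges of A,
   and cc' is the only edge from the rest of X to the outside of X. *)
Record stage X A c c' : Prop := Stage {
  st_XV : X \subset Vs;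
  st_AX : A \subset X;
  st_cA : conn e A;
  st_cV : conn e (Vs :\: A);
  st_cX : c \in X;
  st_c'X : c' \in Vs :\: X;
  st_cc' : e c c';
  st_up : forall u v, u \in X :\: A -> v \in Vs :\: X -> e u v -> u = c /\ v = c';
  st_link : exists a a', [/\ a \in A, a' \in Vs :\: X & e a a'];
  st_deg : forall v, v \in A -> #|nb e v :&: (X :\: A)| <= 1 }.

(* P may be added to A: once the closure contains the edges of A and of P, it
   contains the only two edges xw and yw' between A and P. *)
Record attach X A P x y w w' : Prop := Attach {
  at_P : P \subset X :\: A;
  at_cP : conn e P;
  at_x : x \in A;
  at_y : y \in A;
  at_xy : x != y;
  at_w : w \in P;
  at_w' : w' \in P;
  at_wx : e w x;
  at_w'y : e w' y;
  at_edges : forall u v, u \in A -> v \in P -> e u v -> (u = x /\ v = w) \/ (u = y /\ v = w');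
  at_cV : conn e (Vs :\: (A :|: P));
  at_deg : forall v, v \in P -> #|nb e v :&: (X :\: (A :|: P))| <= 1 }.

(* The set X is joined to the rest by the three edges aa', bb' and cc'; the last
   clause is what lets a path of X be closed to a cycle through the outside. *)
Record piece X a b c a' b' c' : Prop := Piece {
  pc_XV : X \subset Vs;
  pc_cV : conn e (Vs :\: X);
  pc_in : [/\ a \in X, b \in X & c \in X];
  pc_uniq : uniq [:: a; b; c];
  pc_out : [/\ a' \in Vs :\: X, b' \in Vs :\: X & c' \in Vs :\: X];
  pc_edges : [/\ e a a', e b b' & e c c'];
  pc_only : forall u v, u \in X -> v \in Vs :\: X -> e u v ->
    [\/ u = a /\ v = a', u = b /\ v = b' | u = c /\ v = c'];
  pc_dist : Vs :\: X = [set a'] \/ uniq [:: a'; b'; c'] }.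

Lemma stage_attach X A c c' P x y w w' :
  stage X A c c' -> attach X A P x y w w' -> stage X (A :|: P) c c'.
Proof.
move=> S T; have [XV AX cA cV cX c'X cc' up [a [a' [aA a'X eaa']]] deg] := S.
have PX : P \subset X := subset_trans (at_P T) (subsetDl _ _).
split=> //.
- by rewrite subUset AX.
- by apply: (connU esym' cA (at_cP T) (at_x T) (at_w T)); rewrite esym' (at_wx T) orbT.
- exact: at_cV T.
- move=> u v uX; apply: up; move: uX; rewrite !inE negb_or -andbA.
  by case/and3P => -> _ ->.
- by exists a, a'; rewrite inE aA.
move=> v; rewrite in_setU => /orP[vA|/(at_deg T)//].
apply: leq_trans (deg v vA); apply: subset_leq_card; apply: setIS.
by apply: setDS; apply: subsetUl.
Qed.

(** The path itself is not recorded: what matters later is that every vertex of P lies on the next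
    frontier, so that all edges of P may go to B. Single vertices are covered too. *)
Definition ear A P := forall v, v \in P -> exists2 k, k \in Vs :\: (A :|: P) & e v k.

(* Y is a minimal nonempty part of the rest that sends at most one edge to
   the remaining vertices outside A. *)
Record extremal X A Y d d' : Prop := Extremal {
  ex_Y : Y \subset X :\: A;
  ex_d : d \in Y;
  ex_d' : d' \in Vs :\: (A :|: Y);
  ex_dd' : e d d';
  ex_up : forall u v, u \in Y -> v \in Vs :\: (A :|: Y) -> e u v -> u = d /\ v = d';
  ex_min : forall Z, Z \subset Y -> Z != set0 -> Z != Y -> 1 < #|cut e Z (Vs :\: (A :|: Z))| }.

(** The edge cc' makes X \ A itself a candidate, so a minimal one exists; as the complement of A is
    connected, exactly one edge dd' leaves it upwards. *)
Lemma exists_extremal X A c c' : stage X A c c' -> X :\: A != set0 ->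
  exists Y d d', extremal X A Y d d'.
Proof.
move=> S nX; have [XV AX cA cV cX c'X cc' up lk deg] := S.
pose ok Z := [&& Z != set0, Z \subset X :\: A & #|cut e Z (Vs :\: (A :|: Z))| <= 1].
have sub0 : X :\: A \subset Vs by apply: subset_trans (subsetDl _ _) XV.
have okX : ok (X :\: A).
  rewrite /ok nX subxx /=; apply: (@cut_le1 _ _ _ _ c c') => u v uX vX; apply: up => //.
  by move: vX; rewrite !(in_setD, in_setU); case: (v \in A); case: (v \in X).
have [Y /minsetP[/and3P[nY sY cY] minY] _] := minset_exists okX.
have YVA : Y \subset Vs :\: A.
  by apply: subset_trans sY _; apply: setSD.
have UE Z : Vs :\: (A :|: Z) = Vs :\: A :\: Z by rewrite setDDl.
have : 0 < #|cut e Y (Vs :\: (A :|: Y))|.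
  rewrite UE; apply: conn_cut_gt0 => //.
  apply: contraTneq c'X => E; rewrite inE; apply/negP => /andP[c'X c'V].
  have : c' \in Y by rewrite E inE c'V andbT; apply: contra c'X; apply: (subsetP AX).
  by move/(subsetP sY); rewrite inE (negbTE c'X) andbF.
case/card_gt0P => -[d d']; rewrite inE /= => /and3P[dY d'Y edd'].
exists Y, d, d'; split=> //.
  move=> u v uY vY euv.
  have m : (u, v) \in cut e Y (Vs :\: (A :|: Y)) by rewrite inE /= uY vY euv.
  have m' : (d, d') \in cut e Y (Vs :\: (A :|: Y)) by rewrite inE /= dY d'Y edd'.
  by move/card_le1_eqP: cY => /(_ _ _ m m') [-> ->].
move=> Z sZ nZ neZ; rewrite ltnNge; apply: contra neZ => cZ; apply/eqP/minY => //.
by rewrite /ok nZ cZ (subset_trans sZ).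
Qed.

(** * Minimal sets with one upward edge *)

Section Extremal.
Variables (X A Y : {set V}) (c c' d d' : V).
Hypotheses (S : stage X A c c') (E : extremal X A Y d d').

Let U := Vs :\: (A :|: Y).

Let YX : Y \subset X.
Proof. exact: subset_trans (ex_Y E) (subsetDl _ _). Qed.
Let YV : Y \subset Vs.
Proof. exact: subset_trans YX (st_XV S). Qed.
Let AV : A \subset Vs.
Proof. exact: subset_trans (st_AX S) (st_XV S). Qed.
Let YA u : u \in Y -> u \notin A.
Proof. by move/(subsetP (ex_Y E))/setDP => []. Qed.
Let UP u : u \in U -> [/\ u \in Vs, u \notin A & u \notin Y].
Proof. by rewrite inE in_setU negb_or => /andP[/andP[-> ->] ->]. Qed.
Let inU u : u \in Vs -> u \notin A -> u \notin Y -> u \in U.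
Proof. by move=> h1 h2 h3; rewrite inE in_setU negb_or h1 h2 h3. Qed.

Let splitD D : D \subset Y -> Vs :\: (A :|: D) = (Y :\: D) :|: U.
Proof.
move=> sD; apply/setP => u; rewrite /U !(in_setU, in_setD).
have := @YA u; have := subsetP YV u; have := subsetP sD u.
by case: (u \in Y); case: (u \in D); case: (u \in A); case: (u \in Vs) => //= h1 h2 h3;
  first [by have := h1 isT | by have := h2 isT | by have := h3 isT].
Qed.

Let disYU D : [disjoint Y :\: D & U].
Proof.
rewrite disjoint_subset; apply/subsetP => u /setDP[uY _]; rewrite inE.
by apply/negP => /UP[_ _]; rewrite uY.
Qed.

Let cutDU D : D \subset Y -> d \notin D -> #|cut e D U| = 0.
Proof.
move=> sD dD; apply: cut_eq0 => u v uD vU; apply/negP => euv.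
by have [ud _] := ex_up E (subsetP sD _ uD) vU euv; rewrite -ud uD in dD.
Qed.

Let cutDU1 D : D \subset Y -> #|cut e D U| <= 1.
Proof. by move=> sD; apply: (@cut_le1 _ _ _ _ d d') => u v /(subsetP sD) uY; apply: (ex_up E). Qed.

Lemma extremal_cut D : D \subset Y -> D != set0 -> D != Y ->
  1 < #|cut e D (Y :\: D)| + #|cut e D U|.
Proof. by move=> sD nD neD; rewrite -cutU // -splitD //; apply: (ex_min E). Qed.

Lemma extremal_conn : conn e Y.
Proof.
apply: conn_cut => Z sZ nZ neZ; have := extremal_cut sZ nZ neZ.
case: #|cut e Z _| => //; rewrite add0n => h.
by have := leq_trans h (cutDU1 sZ).
Qed.

(** Outside A, the set Y hangs on U by the single edge dd', so removing Y from the connected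
    complement of A cannot disconnect it. *)
Lemma extremal_upper_conn : conn e U.
Proof.
have UE : U = Vs :\: A :\: Y by rewrite setDDl.
have YVA : Y \subset Vs :\: A.
  by apply/subsetP => u uY; rewrite inE YA // (subsetP YV).
apply: conn_cut => Z sZ nZ neZ.
have ZV : Z \subset Vs :\: A by apply: subset_trans sZ _; rewrite UE subsetDl.
have ZY z : z \in Z -> z \notin Y by move/(subsetP sZ)/UP=> [].
have [dZ|dZ] := boolP (d' \in Z).
  have eq : Vs :\: A :\: (Z :|: Y) = U :\: Z.
    by rewrite UE setUC !setDDl setUA.
  have : 0 < #|cut e (Z :|: Y) (Vs :\: A :\: (Z :|: Y))|.
    apply: conn_cut_gt0 (st_cV S) _ _ _.
    - by rewrite subUset ZV.
    - by apply/set0Pn; exists d'; rewrite inE dZ.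
    apply: contra neZ => /eqP E'; rewrite eqEsubset sZ /=; apply/subsetP => u uU.
    have [uV uA uY] := UP uU.
    have : u \in Z :|: Y by rewrite E' inE uA.
    by rewrite in_setU (negbTE uY) orbF.
  rewrite eq (cutUl esym'); last first.
    by rewrite disjoint_subset; apply/subsetP => z /ZY; rewrite inE.
  rewrite [T in _ + T](_ : _ = 0) ?addn0 //; apply: cut_eq0 => u v uY /setDP[vU vZ].
  by apply/negP => euv; have [_ vd] := ex_up E uY vU euv; rewrite vd dZ in vZ.
have eq : Vs :\: A :\: Z = (U :\: Z) :|: Y.
  apply/setP => u; rewrite UE !(in_setU, in_setD).
  have := @YA u; have := subsetP YV u; have := ZY u.
  by case: (u \in Y); case: (u \in Z); case: (u \in A); case: (u \in Vs) => //= h1 h2 h3;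
    first [by have := h1 isT | by have := h2 isT | by have := h3 isT].
have : 0 < #|cut e Z (Vs :\: A :\: Z)|.
  apply: conn_cut_gt0 (st_cV S) ZV nZ _.
  apply: contraTneq (ex_d E) => Z'; apply/negP => dY.
  have : d \in Z by rewrite Z' inE YA // (subsetP YV).
  by move/ZY; rewrite dY.
rewrite eq cutU; last first.
  rewrite disjoint_subset; apply/subsetP => z /setDP[/UP[_ _ zY] _].
  by rewrite inE.
rewrite [T in _ + T](_ : _ = 0) ?addn0 //; apply: cut_eq0 => u v uZ vY.
apply/negP; rewrite esym' => evu.
by have [_ ud] := ex_up E vY (subsetP sZ _ uZ) evu; rewrite -ud uZ in dZ.
Qed.

Lemma extremal_upper_link K : K \subset Y -> d \in K -> conn e K -> conn e (K :|: U).
Proof.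
move=> sK dK cK.
by apply: (connU esym' cK extremal_upper_conn dK (ex_d' E)); rewrite (ex_dd' E) orbT.
Qed.

Lemma extremal_single x y : Y = [set d] -> x \in A -> y \in A -> x != y -> e d x -> e d y ->
  attach X A Y x y d d.
Proof.
move=> Y1 xA yA xy edx edy.
have dV : d \in Vs by apply: (subsetP YV); rewrite (ex_d E).
have [_ d'A _] := UP (ex_d' E).
have ne z : z \in A -> z != d' by move=> zA; apply: contraNneq d'A => <-.
split=> //; rewrite ?(ex_d E) ?(ex_Y E) //.
- exact: extremal_conn.
- move=> u v uA; rewrite Y1 => /set1P -> eud.
  have /(_ u) := @nbrs_eq3 _ _ _ G d _ x y d' dV _ edx edy (ex_dd' E).
  rewrite /= !inE negb_or xy !ne // esym' => /(_ isT eud).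
  by rewrite (negbTE (ne u uA)) orbF => /orP[]/eqP->; [left|right].
- exact: extremal_upper_conn.
move=> v; rewrite {1}Y1 => /set1P->.
apply: (@nbI_others _ _ _ G _ _ x y) => //; rewrite in_setD in_setU ?xA ?yA //.
Qed.

Hypothesis Y2 : Y != [set d].

(** A vertex with two neighbours in A has at most one further edge, so its singleton would be a
    smaller candidate than Y. *)
Lemma extremal_down1 u x y : u \in Y -> x \in A -> y \in A -> e u x -> e u y -> x = y.
Proof.
move=> uY xA yA eux euy; apply/eqP/negPn/negP => xy.
have neY : [set u] != Y.
  apply: contra Y2 => /eqP E'; have := ex_d E; rewrite -E' => /set1P->.
  by rewrite eqxx.
have n0 : [set u] != set0 by apply/set0Pn; exists u; rewrite set11.
have sY : [set u] \subset Y by rewrite sub1set.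
have := ex_min E sY n0 neY; rewrite cut_nb ltnNge => /negP; apply.
apply: (@nbI_others _ _ _ G _ _ x y) => //; rewrite ?(subsetP YV) //.
  by rewrite in_setD in_setU xA.
by rewrite in_setD in_setU yA.
Qed.

(** With x and d' as neighbours, d would send at most one edge into the rest of Y. That rest has no
    edge to U and would be a smaller candidate. *)
Lemma extremal_top_down x : x \in A -> ~~ e d x.
Proof.
move=> xA; apply/negP => edx.
have n0 : Y :\ d != set0.
  apply: contra Y2 => /eqP E'; rewrite eqEsubset sub1set (ex_d E) andbT.
  by rewrite -(setD1K (ex_d E)) E' setU0 subxx.
have neY : Y :\ d != Y.
  by apply: contraTneq (ex_d E) => <-; rewrite in_setD1 eqxx.
have := extremal_cut (subD1set Y d) n0 neY.
rewrite [T in _ + T]cutDU ?subD1set ?in_setD1 ?eqxx // addn0.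
rewrite setDDr setDv set0U (setIidPr _) ?sub1set ?(ex_d E) //.
rewrite (cut_sym esym') cut_nb ltnNge => /negP; apply.
have [d'V d'A d'Y] := UP (ex_d' E).
apply: (@nbI_others _ _ _ G _ _ x d') => //; rewrite ?(subsetP YV) ?(ex_d E) ?(ex_dd' E) //.
- by apply: contraNneq d'A => <-.
- by rewrite in_setD1; apply/negP => /andP[_ /YA]; rewrite xA.
by rewrite in_setD1 (negbTE d'Y) andbF.
Qed.

Definition down := [set u in Y | [exists x in A, e u x]].

Lemma down_nb u : u \in down -> u \in Y /\ exists2 x, x \in A & e u x.
Proof. by rewrite inE => /andP[uY /exists_inP[x xA eux]]; split=> //; exists x. Qed.

Lemma mem_down u x : u \in Y -> x \in A -> e u x -> u \in down.
Proof. by move=> uY xA eux; rewrite inE uY; apply/exists_inP; exists x. Qed.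

Lemma top_notin_down : d \notin down.
Proof. by apply/negP => /down_nb[_ [x /extremal_top_down/negP]]. Qed.

Let YsplitV D : D \subset Y -> Vs :\: D = (Y :\: D) :|: (U :|: A).
Proof.
move=> sD; apply/setP => u; rewrite /U !(in_setU, in_setD).
have := @YA u; have := subsetP YV u; have := subsetP sD u; have := subsetP AV u.
by case: (u \in Y); case: (u \in D); case: (u \in A); case: (u \in Vs) => //= h1 h2 h3 h4;
  first [by have := h1 isT | by have := h2 isT | by have := h3 isT | by have := h4 isT].
Qed.

Let disUA : [disjoint U & A].
Proof. by rewrite disjoint_subset; apply/subsetP => u /UP[_]; rewrite inE. Qed.

Let disYUA D : [disjoint Y :\: D & U :|: A].
Proof.
rewrite disjoint_subset; apply/subsetP => u /setDP[uY _]; rewrite inE in_setU negb_or YA // andbT.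
by apply/negP => /UP[_ _]; rewrite uY.
Qed.

Let upper_link : exists a u, [/\ a \in A, u \in U & e a u].
Proof.
have [a [a' [aA a'X eaa']]] := st_link S; exists a, a'; split=> //.
move: a'X; rewrite inE => /andP[a'X a'V]; apply: inU => //.
  by apply: contra a'X; apply: (subsetP (st_AX S)).
by apply: contra a'X; apply: (subsetP YX).
Qed.

Let neYV D : D \subset Y -> D != Vs.
Proof.
move=> sD; have [_ [u [_ /UP[uV _ uY] _]]] := upper_link.
by apply: contraNneq uY => E'; apply: (subsetP sD); rewrite E'.
Qed.

(** By [cut3] at least three edges leave Y; only dd' avoids A, and the others start at distinct
    vertices. *)
Lemma card_down : 1 < #|down|.
Proof.
have nY : Y != set0 by apply/set0Pn; exists d; apply: (ex_d E).
have := cut3 G YV nY (neYV (subxx Y)).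
rewrite YsplitV // setDv set0U cutU // => h.
have h2 : 1 < #|cut e Y A|.
  by have := leq_trans h (leq_add (cutDU1 (subxx Y)) (leqnn _)); rewrite add1n.
apply: (leq_trans h2).
have inj : {in cut e Y A &, injective (fun p : V * V => p.1)}.
  move=> [a b] [a' b']; rewrite !inE /= => /and3P[aY bA eab] /and3P[_ b'A eab'] aa'.
  by rewrite -aa' in eab' *; rewrite (extremal_down1 aY bA b'A eab eab').
rewrite -(card_in_imset inj); apply: subset_leq_card; apply/subsetP => u /imsetP[[a b]].
by rewrite inE /= => /and3P[aY bA eab] ->; apply: (mem_down aY bA).
Qed.

Let down_neq u v x y : u \in Y -> v \in Y -> u != v -> x \in A -> y \in A ->
  e u x -> e v y -> x != y.
Proof.
move=> uY vY uv xA yA eux evy; apply/eqP => xy.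
have := st_deg S xA; rewrite leqNgt => /negP; apply.
by apply: (card_nbI_in (a := u) (b := v)); rewrite 1?esym' ?(subsetP (ex_Y E)) // xy.
Qed.

(** The outgoing edges of Y are then wx, w'y and dd'; x and y differ because a vertex of A has at
    most one neighbour in X \ A. *)
Lemma extremal_piece w w' : down = [set w; w'] -> w != w' ->
  exists x y, attach X A Y x y w w' /\ piece Y w w' d x y d'.
Proof.
move=> DE ww'.
have wD : w \in down by rewrite DE set21.
have w'D : w' \in down by rewrite DE set22.
have [wY [x xA ewx]] := down_nb wD; have [w'Y [y yA ewy]] := down_nb w'D.
have xy := down_neq wY w'Y ww' xA yA ewx ewy.
have only u v : u \in A -> v \in Y -> e u v -> u = x /\ v = w \/ u = y /\ v = w'.
  move=> uA vY euv; have : v \in down by apply: (mem_down vY uA); rewrite esym'.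
  rewrite DE => /set2P[]vE; [left|right]; split=> //.
    by apply: (extremal_down1 wY uA xA) => //; rewrite esym' -vE.
  by apply: (extremal_down1 w'Y uA yA) => //; rewrite esym' -vE.
have [d'V d'A d'Y] := UP (ex_d' E).
have neA z : z \in A -> z != d' by move=> zA; apply: contraNneq d'A => <-.
exists x, y; split.
  split=> //; [exact: ex_Y E | exact: extremal_conn | exact: extremal_upper_conn |].
  move=> v vY; apply: leq_trans (_ : #|[set d']| <= 1); last by rewrite cards1.
  apply: subset_leq_card; apply/subsetP => k /setIP[ek /setDP[kX kAY]].
  have evk : e v k by move: ek; rewrite inE.
  have kU : k \in U by rewrite /U in_setD kAY (subsetP (st_XV S)).
  by rewrite inE; have [_ ->] := ex_up E vY kU evk.
have outA z : z \in A -> z \in Vs :\: Y.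
  by move=> zA; rewrite inE (subsetP AV) // andbT; apply/negP => /YA; rewrite zA.
have VY : Vs :\: Y = A :|: U by rewrite YsplitV // setDv set0U setUC.
split=> //.
- rewrite VY; have [a [u [aA uU eau]]] := upper_link.
  by apply: (connU esym' (st_cA S) extremal_upper_conn aA uU); rewrite eau orbT.
- by split=> //; apply: (ex_d E).
- rewrite /= !inE negb_or ww' /= andbT; apply/andP; split.
    by apply: contraTneq wD => ->; apply: top_notin_down.
  by apply: contraTneq w'D => ->; apply: top_notin_down.
- by split; [exact: outA | exact: outA | rewrite in_setD d'Y d'V].
- by split=> //; apply: (ex_dd' E).
- move=> u v uY; rewrite VY in_setU => /orP[vA|vU] euv.
    by case: (only v u vA uY); rewrite 1?esym' // => -[-> ->]; [constructor 1|constructor 2].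
  by have [-> ->] := ex_up E uY vU euv; constructor 3.
by right; rewrite /= !inE negb_or xy !neA.
Qed.

(** If Y minus v fell apart into two parts, v, having degree 3, would send at most one edge to one
    part T. Whichever of T and Y \ T misses d then has at most one outgoing edge that avoids A,
    against minimality of Y. *)
Lemma extremal_noncut v : v \in Y -> conn e (Y :\ v).
Proof.
move=> vY; apply: conn_cut => Z sZ nZ neZ; rewrite lt0n; apply/negP => /eqP c0.
have vV := subsetP YV _ vY.
pose Z2 := Y :\ v :\: Z.
have nZ2 : Z2 != set0.
  by rewrite /Z2 setD_eq0; apply: contra neZ => s; rewrite eqEsubset sZ.
have c0' : #|cut e Z2 (Y :\ v :\: Z2)| = 0.
  by rewrite /Z2 setDDr setDv set0U (setIidPr sZ) (cut_sym esym') c0.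
have sZ2 : Z2 \subset Y :\ v by apply: subsetDl.
have neZ2 : Z2 != Y :\ v.
  apply: contra nZ => /eqP E'; rewrite -subset0; apply/subsetP => z zZ.
  by have := subsetP sZ z zZ; rewrite -E' inE zZ.
have le3 : #|nb e v :&: Z| + #|nb e v :&: Z2| <= 3.
  rewrite -!cut_nb -cutU; last by rewrite disjoint_sym disjoints_subset /Z2 setDE subsetIr.
  by rewrite cut_nb (nbI_le3 G).
have absurd (T : {set V}) : T \subset Y :\ v -> T != set0 -> T != Y :\ v ->
    #|cut e T (Y :\ v :\: T)| = 0 -> #|nb e v :&: T| <= 1 -> False.
  move=> sT nT neT cT leT.
  have TY : T \subset Y := subset_trans sT (subD1set _ _).
  have vT : v \notin T by apply/negP => /(subsetP sT); rewrite !inE eqxx.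
  have [dT|dT] := boolP (d \in T); last first.
    have nTY : T != Y by apply: contraTneq vY => <-.
    have := extremal_cut TY nT nTY; rewrite cutDU // addn0.
    rewrite (_ : Y :\: T = (Y :\ v :\: T) :|: [set v]); last first.
      by apply/setP => z; rewrite !(in_setU, in_setD, in_set1); case: (eqVneq z v) => [->|]; rewrite ?vT ?vY ?orbF.
    rewrite cutU; last first.
      by rewrite disjoint_sym disjoints1 !(in_setU, in_setD, in_set1) eqxx /= andbF.
    by rewrite cT (cut_sym esym') cut_nb ltnNge leT.
  pose T' := Y :\: T.
  have T'E : T' = (Y :\ v :\: T) :|: [set v].
    by apply/setP => z; rewrite !(in_setU, in_setD, in_set1); case: (eqVneq z v) => [->|]; rewrite ?vT ?vY ?orbF.
  have vT' : v \in T' by rewrite inE vT vY.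
  have nT' : T' != set0 by apply/set0Pn; exists v.
  have neT' : T' != Y.
    by apply: contraTneq (ex_d E) => <-; rewrite inE dT.
  have := extremal_cut (subsetDl _ _) nT' neT'; rewrite [T in _ + T]cutDU ?subsetDl // ?inE ?dT // addn0.
  rewrite /T' setDDr setDv set0U (setIidPr TY) -/T' T'E (cutUl esym'); last first.
    by rewrite disjoint_sym disjoints1 !(in_setU, in_setD, in_set1) eqxx /= andbF.
  by rewrite (cut_sym esym') cT cut_nb ltnNge leT.
have [le1|gt1] := leqP #|nb e v :&: Z| 1; first exact: (absurd Z).
apply: (absurd Z2) => //; rewrite leqNgt; apply/negP => gt1'.
by have := leq_trans (leq_add gt1 gt1') le3.
Qed.

(** An application of [nonseparating_path] in Y with the other vertices of [down] as targets.
    Putting d into K0 keeps sets outside K0 from having edges to U. The prescribed start s and the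
    avoided K0 are the handles for choosing a second ear. *)
Lemma extremal_ear q (K0 : {set V}) (s t0 : V) :
  peripheral_bound e Vs q -> conn e K0 -> K0 \subset Y -> d \in K0 ->
  s \in down -> s \notin K0 -> t0 \in down -> t0 != s -> connect (rin e (Y :\: K0)) s t0 ->
  exists P x y w w',
    [/\ attach X A P x y w w', ear A P, #|P| + 2 <= q, P \subset Y :\: K0 & s \in P] /\
    exists t, [/\ t \in P, t \in down, t != s, conn e (Y :\: P) &
      forall v, v \in P -> v \in down -> v = s \/ v = t].
Proof.
move=> bq cK0 sK0 dK0 sD sK t0D t0s con.
have DY : down \subset Y by apply/subsetP => u /down_nb[].
have sY := subsetP DY _ sD.
have nK0 : K0 != set0 by apply/set0Pn; exists d.
have sYK : s \in Y :\: K0 by rewrite inE sK.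
have t0T : t0 \in down :\ s by rewrite in_setD1 t0s.
have TY : down :\ s \subset Y := subset_trans (subD1set _ _) DY.
have sT : s \notin down :\ s by rewrite in_setD1 eqxx.
have deg3 v : v \in Y -> #|nb e v :&: Y| <= 3.
  by move=> /(subsetP YV) vV; apply: (nbI_le3 G).
have deg2 v : v \in s |: down :\ s -> #|nb e v :&: Y| <= 2.
  rewrite setD1K // => /down_nb[vY [x xA evx]].
  apply: (@nbI_other _ _ _ G _ _ x) => //; first exact: (subsetP YV).
  by apply/negP => /YA; rewrite xA.
have KD D : D \subset Y :\: K0 -> D \subset Y /\ d \notin D.
  move=> sD'; split; first exact: subset_trans sD' (subsetDl _ _).
  by apply/negP => /(subsetP sD'); rewrite inE dK0.
have h1 D : D \subset Y :\: K0 -> D != set0 -> (s \in D -> [disjoint D & down :\ s]) ->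
    1 < #|cut e D (Y :\: D)|.
  move=> /KD[DY' dD] nD _.
  have neD : D != Y by apply: contraTneq (ex_d E) => <-.
  by have := extremal_cut DY' nD neD; rewrite cutDU // addn0.
(* Such a D has neither edges to U nor edges to A, so all three edges given by [cut3] stay in Y. *)
have h2 D : D \subset Y :\: K0 -> D != set0 -> s \notin D -> [disjoint D & down :\ s] ->
    2 < #|cut e D (Y :\: D)|.
  move=> /KD[DY' dD] nD sD' disD.
  have := cut3 G (subset_trans DY' YV) nD (neYV DY').
  rewrite YsplitV // cutU // (cutU e D disUA) cutDU // add0n.
  rewrite [T in _ + T]cut_eq0 ?addn0 // => u v uD vA; apply/negP => euv.
  have uO := mem_down (subsetP DY' _ uD) vA euv.
  have us : u != s by apply: contraNneq sD' => <-.
  by have := disjointFr disD uD; rewrite in_setD1 us uO.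
have [p [[hp up lp sK0' cK] [sp hK]]] := nonseparating_path esym' extremal_conn cK0 sK0 nK0
  sYK t0T con TY sT deg3 deg2 h1 h2.
set P := [set z in s :: p] in sK0' cK hK.
have inP z : (z \in P) = (z \in s :: p) by rewrite inE.
pose t := last s p.
have tD : t \in down by move: lp; rewrite in_setD1 => /andP[].
have ts : t != s by move: lp; rewrite in_setD1 => /andP[].
have tP : t \in P by rewrite inP mem_last.
have sP : s \in P by rewrite inP mem_head.
have PY : P \subset Y by apply/subsetP => z; rewrite inP => /sp.
have [_ [x xA esx]] := down_nb sD; have [tY [y yA ety]] := down_nb tD.
have st : s != t by rewrite eq_sym.
have xy := down_neq sY tY st xA yA esx ety.
have cP : conn e P := path_conn esym' hp.
have inner v : v \in P -> v != s -> v != t ->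
    exists a b, [/\ a \in P, b \in P, e v a, e v b & a != b].
  rewrite inP => vP vs vt.
  have [a [b [aP bP eav evb /andP[l1 l2]]]] := path_interior_nbrs hp up vP vs vt.
  exists a, b; rewrite !inP esym'; split=> //.
  by apply: contraTneq (ltn_trans l1 l2) => ->; rewrite ltnn.
have PA z : z \in P -> z \notin A by move/(subsetP PY)/YA.
(* An inner vertex of the path has two neighbours in P and one in Y \ P, which leaves none for A. *)
have onlyD v : v \in P -> v \in down -> v = s \/ v = t.
  move=> vP /down_nb[vY [a aA eva]].
  have [->|vs] := eqVneq v s; first by left.
  have [->|vt] := eqVneq v t; first by right.
  have [b [b' [bP b'P evb evb' bb']]] := inner v vP vs vt.
  have [k kK evk] : exists2 k, k \in Y :\: P & e v k by apply: hK; rewrite -inP.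
  have /setDP[kY kP] := kK.
  have neP z : z \in P -> z != k by move=> zP; apply: contraNneq kP => <-.
  have := @nbrs_eq3 _ _ _ G v a b b' k (subsetP YV _ vY).
  rewrite /= !inE negb_or bb' !neP //= => /(_ isT evb evb' evk eva).
  by case/or3P => /eqP aE; [have := PA _ bP | have := PA _ b'P | have := YA kY]; rewrite -aE aA.
have KV : Vs :\: (A :|: P) = (Y :\: P) :|: U by rewrite splitD.
have cV' : conn e (Vs :\: (A :|: P)).
  rewrite KV; apply: extremal_upper_link; rewrite ?subsetDl //.
  exact: (subsetP sK0').
have earP : ear A P.
  move=> v vP; have [k kK evk] : exists2 k, k \in Y :\: P & e v k by apply: hK; rewrite -inP.
  by exists k; rewrite // KV inE kK.
have edgesP' a v : a \in A -> v \in P -> e a v -> a = x /\ v = s \/ a = y /\ v = t.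
  move=> aA vP eav; have vY := subsetP PY _ vP.
  have vD : v \in down by apply: (mem_down vY aA); rewrite esym'.
  case: (onlyD v vP vD) => vE; [left|right]; split=> //.
    by apply: (extremal_down1 sY aA xA) => //; rewrite esym' -vE.
  by apply: (extremal_down1 tY aA yA) => //; rewrite esym' -vE.
have end_nb u : u \in P -> exists2 b, b \in P & e u b.
  move=> uP; have [z zP zu] : exists2 z, z \in P & z \notin [set u].
    by have [->|us] := eqVneq u s; [exists t | exists s]; rewrite // inE // eq_sym.
  have [a [b [_ /set1P-> bP _ eab]]] := conn_crossing cP uP (set11 u) zP zu.
  by exists b.
have notR z : z \in A :|: P -> z \notin X :\: (A :|: P) by move=> zAP; rewrite in_setD zAP.
have degP v : v \in P -> #|nb e v :&: (X :\: (A :|: P))| <= 1.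
  move=> vP; have vV : v \in Vs by rewrite (subsetP YV) // (subsetP PY).
  have viaA z : z \in A -> e v z -> #|nb e v :&: (X :\: (A :|: P))| <= 1.
    move=> zA evz; have [b bP evb] := end_nb v vP.
    apply: (@nbI_others _ _ _ G _ _ z b) => //; rewrite ?notR // ?in_setU ?zA ?bP ?orbT //.
    by apply: contraTneq zA => ->; apply: PA.
  have [vE|vs] := eqVneq v s; first by apply: (viaA x) => //; rewrite vE.
  have [vE|vt] := eqVneq v t; first by apply: (viaA y) => //; rewrite vE.
  have [b [b' [bP b'P evb evb' bb']]] := inner v vP vs vt.
  by apply: (@nbI_others _ _ _ G _ _ b b') => //; rewrite notR // in_setU ?bP ?b'P orbT.
have PYK0 : P \subset Y :\: K0.
  apply/subsetP => z zP; rewrite inE (subsetP PY) // andbT.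
  by apply/negP => /(subsetP sK0'); rewrite inE zP.
exists P, x, y, s, t; split; last by exists t; split.
split=> //.
  by split=> //; apply: subset_trans PY (ex_Y E).
have -> : #|P| = size p + 1.
  by rewrite addn1 -[RHS]/(size (s :: p)) -(card_uniqP up); apply: eq_card => z; rewrite inP.
rewrite -addnA; apply: (ear_bound G bq hp up (A := A) (K0 := Vs :\: (A :|: P)) (x := x) (y := y)) => //.
- rewrite -/P; apply/setP => z; rewrite !(in_setU, in_setD).
  have := subsetP PY z; have := subsetP YV z; have := subsetP AV z.
  by case: (z \in P); case: (z \in A); case: (z \in Vs); case: (z \in Y) => //= h h' h'';
    first [by have := h isT | by have := h' isT | by have := h'' isT].
- rewrite -/P disjoint_subset; apply/subsetP => z zP.
  by rewrite inE !(in_setU, in_setD) zP orbT (negbTE (PA z zP)).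
- by rewrite disjoint_subset; apply/subsetP => z zA; rewrite inE !(in_setU, in_setD) zA.
- exact: st_cA S.
- have [a [u [aA uU eau]]] := upper_link; exists a, u; split=> //.
  by rewrite KV inE uU orbT.
- by move=> v; rewrite -inP => /earP.
by move=> a v aA; rewrite -inP; apply: edgesP'.
Qed.

(** The first ear P1 has just its two ends in [down], so some u in [down] is off P1. [two_linked]
    joins d and u disjointly to the two ends, in some order. The second ear starts at the end linked
    to u and avoids the set C that links d to the other end b: it meets P1 in its start and misses
    b. *)
Lemma extremal_two_ears q : peripheral_bound e Vs q -> 2 < #|down| ->
  exists P1 P2 x1 y1 w1 w1' x2 y2 w2 w2',
    [/\ attach X A P1 x1 y1 w1 w1', ear A P1 & #|P1| + 2 <= q] /\
    [/\ attach X A P2 x2 y2 w2 w2', ear A P2, #|P2| + 2 <= q, P1 != P2 & ~~ [disjoint P1 & P2]].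
Proof.
move=> bq c3.
have DY : down \subset Y by apply/subsetP => u /down_nb[].
have [s0 [s1 [s2 [[s0D s1D s2D] [s01 s12 s20]]]]] := card_gt2P c3.
have dY := ex_d E.
have neD u : u \in down -> u != d by apply: contraTneq => ->; apply: top_notin_down.
have cYd := extremal_noncut dY.
have con : connect (rin e (Y :\ d)) s0 s1.
  by apply: (connP _ _ cYd); rewrite in_setD1 neD // (subsetP DY).
have s0d : s0 \notin [set d] by rewrite inE neD.
have s10 : s1 != s0 by rewrite eq_sym.
have dY1 : [set d] \subset Y by rewrite sub1set.
have [P1 [x1 [y1 [w1 [w1' [[at1 e1 c1 sP1 sP] [t [tP tD ts cK1 only]]]]]]]] :=
  extremal_ear bq (conn1 _ d) dY1 (set11 d) s0D s0d s1D s10 con.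
have [u uD uP1] : exists2 u, u \in down & u \notin P1.
  have [s1P|s1P] := boolP (s1 \in P1); last by exists s1.
  have [s2P|s2P] := boolP (s2 \in P1); last by exists s2.
  case: (only s1 s1P s1D) => E1; first by rewrite E1 eqxx in s10.
  case: (only s2 s2P s2D) => E2; first by rewrite E2 eqxx in s20.
  by rewrite E1 E2 eqxx in s12.
have ud : d != u by rewrite eq_sym neD.
have st : s0 != t by rewrite eq_sym.
have inY z : z \in down -> z \in Y by move/(subsetP DY).
have [C1 [C2 [[cC1 cC2 sC1 sC2 dis] [s0C tC alt]]]] :=
  two_linked esym' extremal_noncut dY (inY _ uD) ud (inY _ s0D) (inY _ tD) st.
have conC (C C' : {set V}) a b : [disjoint C & C'] -> conn e C' -> C' \subset Y -> a \in C' -> b \in C' ->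
    connect (rin e (Y :\: C)) a b.
  move=> dC cC' sC' aC bC; apply: connect_rin_mono (connP _ _ cC' a b aC bC).
  by rewrite subsetD sC' disjoint_sym.
have finish (C C' : {set V}) a b : [disjoint C & C'] -> conn e C -> conn e C' ->
    C \subset Y -> C' \subset Y -> d \in C -> a \in C' -> u \in C' -> b \in C -> a \in P1 -> b \in P1 -> a \in down ->
  exists P1 P2 x1 y1 w1 w1' x2 y2 w2 w2',
    [/\ attach X A P1 x1 y1 w1 w1', ear A P1 & #|P1| + 2 <= q] /\
    [/\ attach X A P2 x2 y2 w2 w2', ear A P2, #|P2| + 2 <= q, P1 != P2 & ~~ [disjoint P1 & P2]].
  move=> dC cC cC' sC sC' dCC aC' uC' bC aP bP aD.
  have ua : u != a by apply: contraNneq uP1 => ->.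
  have aC : a \notin C by rewrite (disjointFl dC aC').
  have [P2 [x2 [y2 [w2 [w2' [[at2 e2 c2 sP2 aP2] _]]]]]] :=
    extremal_ear bq cC sC dCC aD aC uD ua (conC _ _ _ _ dC cC' sC' aC' uC').
  exists P1, P2, x1, y1, w1, w1', x2, y2, w2, w2'; split=> //; split=> //.
    apply: contraTneq bP => ->; apply/negP => /(subsetP sP2).
    by rewrite inE bC.
  by apply/pred0Pn; exists a; rewrite /= aP aP2.
case: alt => -[h1 h2].
  exact: (finish C1 C2 t s0).
by apply: (finish C2 C1 s0 t) => //; rewrite disjoint_sym.
Qed.

End Extremal.

Lemma stage_progress q X A c c' : peripheral_bound e Vs q -> stage X A c c' -> X :\: A != set0 ->
  [\/ exists P x y w w', [/\ attach X A P x y w w', ear A P & #|P| = 1],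
      exists Y x y w w' d d', [/\ attach X A Y x y w w', piece Y w w' d x y d' &
        forall u v, u \in Y -> v \in Vs :\: (A :|: Y) -> e u v -> u = d /\ v = d'] |
      exists P1 P2 x1 y1 w1 w1' x2 y2 w2 w2',
        [/\ attach X A P1 x1 y1 w1 w1', ear A P1 & #|P1| + 2 <= q] /\
        [/\ attach X A P2 x2 y2 w2 w2', ear A P2, #|P2| + 2 <= q, P1 != P2 & ~~ [disjoint P1 & P2]]].
Proof.
move=> bq S nX; have [Y [d [d' E]]] := exists_extremal S nX.
have [Y1|Y2] := eqVneq Y [set d].
  constructor 1.
  have dV : d \in Vs.
    by have /setDP[dX _] := subsetP (ex_Y E) _ (ex_d E); apply: (subsetP (st_XV S)).
  have d'U := ex_d' E; have /setDP[d'V] := d'U.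
  rewrite in_setU negb_or => /andP[d'A d'Y].
  have : 1 < #|nb e d :\ d'|.
    by have := cardsD1 d' (nb e d); rewrite (c3_deg G dV) inE (ex_dd' E) add1n => -[<-].
  case/card_gt1P => x [y []]; rewrite !in_setD1 !inE => /andP[xd' edx] /andP[yd' edy] xy.
  have inA z : e d z -> z != d' -> z \in A.
    move=> edz zd'; apply: contraNT zd' => zA; apply/eqP.
    have zU : z \in Vs :\: (A :|: Y).
      rewrite in_setD in_setU negb_or zA (c3_inr G edz) andbT Y1 inE /=.
      by apply: contraTneq edz => ->; rewrite eirr.
    by have [] := ex_up E (ex_d E) zU edz.
  exists Y, x, y, d, d; split.
  - by apply: (extremal_single S E) => //; apply: inA.
  - by move=> v; rewrite Y1 => /set1P->; exists d'; rewrite -?Y1 // (ex_dd' E).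
  by rewrite Y1 cards1.
have := card_down S E Y2; rewrite leq_eqVlt => /orP[/eqP/esym/eqP/cards2P[w [w' [ww' DE]]]|c3].
  constructor 2; have [x [y [h1 h2]]] := extremal_piece S E Y2 DE ww'.
  by exists Y, x, y, w, w', d, d'; split=> //; apply: ex_up E.
by constructor 3; have := extremal_two_ears S E Y2 bq c3.
Qed.

End Stages.

(** * Closed edge sets *)

Definition cycle_edges (V : finType) (s : seq V) : {set {set V}} :=
  [set [set x; next s x] | x in s].

Lemma next_adjacent (V : eqType) (s1 s2 : seq V) a b :
  uniq (s1 ++ a :: b :: s2) -> next (s1 ++ a :: b :: s2) a = b.
Proof.
move=> us; rewrite -(next_rot (size s1) us) rot_size_cat /= eqxx //.
Qed.

Lemma next_last_head (V : eqType) (s : seq V) a b :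
  uniq (b :: rcons s a) -> next (b :: rcons s a) a = b.
Proof.
move=> us; rewrite -(next_rot (size (b :: s)) us) -rcons_cons -cats1 rot_size_cat /= eqxx //.
Qed.

Section Closed.
Variables (V : finType) (e : rel V).
Hypothesis esym : symmetric e.
Implicit Types (X Y A P W : {set V}) (S T B : {set {set V}}) (x y z u v : V).

(* S is 2-closed in the subgraph induced by X; S may have edges elsewhere. *)
Definition closed_in X S : Prop :=
  forall s : seq V, uniq s -> 2 < size s -> cycle e s -> {subset s <= X} ->
    #|cycle_edges s :\: S| <= 2 -> cycle_edges s \subset S.

Lemma closed_in_mono X Y S : Y \subset X -> closed_in X S -> closed_in Y S.
Proof. by move=> /subsetP sub h s us ss cs sY; apply: h => // z /sY /sub. Qed.

(* Some cycle of A and P uses both edges between them, and no other edge of it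
   is outside S. *)
Lemma closed_in_bridge A P X S x y w w' :
  closed_in X S -> A \subset X -> P \subset X -> [disjoint A & P] -> conn e A -> conn e P ->
  edges e A \subset S -> edges e P \subset S ->
  x \in A -> y \in A -> x != y -> w \in P -> w' \in P -> e w x -> e w' y ->
  (forall u v, u \in A -> v \in P -> e u v -> (u = x /\ v = w) \/ (u = y /\ v = w')) ->
  [set x; w] \in S /\ [set y; w'] \in S.
Proof.
move=> cS AX PX dis cA cP EA EP xA yA xy wP w'P ewx ewy only.
have [p [hp up lp sp]] := conn_path cP wP w'P.
have [b [hb ub lb sb]] := conn_path cA yA xA.
pose s := (w :: p) ++ (y :: b).
have us : uniq s.
  rewrite /s cat_uniq up ub andbT; apply/hasPn => z /sb zA.
  by apply/negP => /sp zP; rewrite (disjointFr dis zA) in zP.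
have cs : cycle e s.
  by rewrite /s /= rcons_cat cat_path hp /= lp ewy rcons_path hb lb /= esym.
have sb0 : 0 < size b by case: (b) lb => //= E; rewrite E eqxx in xy.
have ss : 2 < size s.
  by rewrite /s size_cat /= addSn addnS !ltnS (leq_trans sb0) // leq_addl.
have sAP z : z \in s -> (z \in A) || (z \in P).
  by rewrite /s mem_cat => /orP[/sp->|/sb->]; rewrite ?orbT.
have sX : {subset s <= X}.
  by move=> z /sAP/orP[]; [apply: (subsetP AX) | apply: (subsetP PX)].
have sub : cycle_edges s :\: S \subset [set [set x; w]; [set y; w']].
  apply/subsetP => f /setDP[/imsetP[z zs ->] nS].
  have ezn := next_cycle cs zs; have ns : next s z \in s by rewrite mem_next.
  move: nS ezn; case/orP: (sAP _ zs) => zC; case/orP: (sAP _ ns) => nC nS ezn.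
  - by rewrite (subsetP EA) // mem_edges // zC nC in nS.
  - by case: (only _ _ zC nC ezn) => -[-> ->]; rewrite ?set21 ?set22.
  - rewrite esym in ezn.
    by case: (only _ _ nC zC ezn) => -[-> ->]; [rewrite (setUC [set w]) | rewrite (setUC [set w'])]; rewrite ?set21 ?set22.
  by rewrite (subsetP EP) // mem_edges // zC nC in nS.
have le2 : #|cycle_edges s :\: S| <= 2.
  by apply: leq_trans (subset_leq_card sub) _; rewrite cards2; case: (_ != _).
have /subsetP cS' := cS s us ss cs sX le2.
split; apply: cS'; apply/imsetP.
  exists x; first by rewrite /s mem_cat -lb mem_last orbT.
  congr [set _; _]; symmetry.
  have sE : s = w :: rcons (p ++ belast y b) x by rewrite /s [y :: b]lastI lb -rcons_cat.
  by rewrite sE; apply: next_last_head; rewrite -sE.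
exists w'; first by rewrite /s mem_cat -lp mem_last.
rewrite setUC; congr [set _; _]; symmetry.
have sE : s = belast w p ++ w' :: y :: b by rewrite /s [w :: p]lastI lp cat_rcons.
by rewrite sE; apply: next_adjacent; rewrite -sE.
Qed.

Lemma connect_erel_mono T T' X Y x y : T \subset T' -> X \subset Y ->
  connect (rin (erel T) X) x y -> connect (rin (erel T') Y) x y.
Proof.
move=> /subsetP sT /subsetP sX; apply: connect_sub => a b /and3P[aX bX ab].
by apply: connect1; apply/and3P; split; [exact: sX | exact: sX | exact: sT].
Qed.

End Closed.

(** * Trees and generating sets *)

Section Good.
Variables (V : finType) (e : rel V) (Vs : {set V}).
Hypothesis G : cubic_3conn e Vs.
Implicit Types (X Y A P W U : {set V}) (S T B : {set {set V}}) (x y z u v w c : V).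

Let esym' := c3_sym G.

(* The vertices to be spanned by the tree edges chosen after A. Vertices of A
   without a neighbour in the rest of X are spanned earlier, and c stands for
   the outside of X. *)
Definition frontier X A c : {set V} :=
  c |: [set v in X | (v \notin A) || [exists u in X :\: A, e v u]].

(* B serves to extend the closure from the edges of A to those of X. *)
Record good X A c B : Prop := Good {
  gd_sub : B \subset edges e (X :\: A);
  gd_gen : forall S, closed_in e X S -> edges e A \subset S -> B \subset S -> edges e X \subset S;
  gd_conn : conn (erel ((edges e X :\: edges e A) :\: B)) (frontier X A c);
  gd_card : #|(edges e X :\: edges e A) :\: B| + 1 = #|frontier X A c| }.

(* The edges of P outside B form a forest with one vertex of U in each tree. *)
Record fill P U B : Prop := Fill {
  fl_sub : B \subset edges e P;
  fl_gen : forall S, closed_in e P S -> B \subset S -> edges e P \subset S;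
  fl_conn : forall v, v \in P -> exists2 u, u \in U & connect (rin (erel (edges e P :\: B)) P) v u;
  fl_card : #|edges e P :\: B| + #|U| = #|P| }.

(** The complement of A is connected and contains c', so an edge leads from X \ A out of X; that
    edge is cc'. *)
Lemma stage_top_notin X A c c' : stage e Vs X A c c' -> X :\: A != set0 -> c \notin A.
Proof.
move=> S /set0Pn[z zXA]; have /setDP[zX zA] := zXA.
have /setDP[c'V c'X] := st_c'X S.
have c'A : c' \notin A by apply: contra c'X; apply: (subsetP (st_AX S)).
have zVA : z \in Vs :\: A by rewrite inE zA (subsetP (st_XV S)).
have c'VA : c' \in Vs :\: A by rewrite inE c'A.
have c'XA : c' \notin X :\: A by rewrite inE (negbTE c'X) andbF.
have [u [v [_ uXA /setDP[vV vA] vXA euv]]] := conn_crossing (st_cV S) zVA zXA c'VA c'XA.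
have vX : v \in Vs :\: X by move: vXA; rewrite !inE vA vV andbT.
have [uc _] := st_up S uXA vX euv.
by move: uXA; rewrite uc inE => /andP[].
Qed.

Lemma edges_attach X A P x y w w' : attach e Vs X A P x y w w' ->
  edges e (A :|: P) = (edges e A :|: edges e P) :|: [set [set x; w]; [set y; w']].
Proof.
move=> T; apply/setP => f; apply/idP/idP.
  case/edgesP => u [v [uAP vAP euv ->]]; rewrite !in_setU !mem_edges // euv !andbT.
  move: uAP vAP; rewrite !in_setU.
  have [uA|uA] /= := boolP (u \in A); have [vA|vA] //= := boolP (v \in A); rewrite ?orbT //.
  - move=> _ vP; apply/orP; right.
    by case: (at_edges T uA vP euv) => -[-> ->]; rewrite !inE eqxx ?orbT.
  - move=> uP _; apply/orP; right; rewrite esym' in euv.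
    case: (at_edges T vA uP euv) => -[-> ->].
      by rewrite (setUC [set w]) inE eqxx.
    by rewrite (setUC [set w']) !inE eqxx ?orbT.
  by move=> -> ->; rewrite ?orbT.
rewrite !in_setU => /orP[/orP[]|].
- by apply: (subsetP (edges_mono esym' (subsetUl _ _))).
- by apply: (subsetP (edges_mono esym' (subsetUr _ _))).
rewrite !inE => /orP[]/eqP->; rewrite mem_edges // !in_setU.
  by rewrite (at_x T) (at_w T) orbT esym' (at_wx T).
by rewrite (at_y T) (at_w' T) orbT esym' (at_w'y T).
Qed.

(** Closure: BP yields the edges of P, [closed_in_bridge] then the two attaching edges, and B the
    rest. Tree: each component of the forest on P hangs on the later tree at one frontier vertex,
    and x and y are added as leaves by the attaching edges. *)
Lemma good_attach X A c c' P x y w w' BP B :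
  stage e Vs X A c c' -> attach e Vs X A P x y w w' ->
  fill P (P :&: frontier X (A :|: P) c) BP -> good X (A :|: P) c B ->
  good X A c (BP :|: B).
Proof.
move=> S T FP GB; have E := edges_attach T.
have PXA := at_P T.
have PX : P \subset X := subset_trans PXA (subsetDl _ _).
have PA u : u \in P -> u \notin A by move/(subsetP PXA)/setDP=> [].
have AX := st_AX S.
have dAP : [disjoint A & P].
  by rewrite disjoint_sym disjoint_subset; apply/subsetP => u /PA; rewrite inE.
have APX : A :|: P \subset X by rewrite subUset AX PX.
have nXA : X :\: A != set0.
  by apply/set0Pn; exists w; apply: (subsetP PXA); rewrite (at_w T).
have cA := stage_top_notin S nXA.
have XAP : X :\: (A :|: P) \subset X :\: A by apply: setDS; apply: subsetUl.
pose f1 := [set x; w]; pose f2 := [set y; w'].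
have wx_in : w \in X :\: A by apply: (subsetP PXA); rewrite (at_w T).
have wy_in : w' \in X :\: A by apply: (subsetP PXA); rewrite (at_w' T).
(* By [st_deg] the neighbour in P is the only one in X \ A, so x and y drop out of the frontier once
   P is attached; this makes them new leaves. *)
have oneX z t : z \in A -> t \in P -> e z t -> ~~ [exists u in X :\: (A :|: P), e z u].
  move=> zA tP ezt; apply/negP => /exists_inP[u uX ezu].
  have := st_deg S zA; rewrite leqNgt => /negP; apply.
  apply: (card_nbI_in (a := t) (b := u)) => //; first last.
  - exact: (subsetP XAP).
  - exact: (subsetP PXA).
  by apply: contraTneq uX => <-; rewrite in_setD in_setU tP orbT.
have exw : e x w by rewrite esym' (at_wx T).
have eyw' : e y w' by rewrite esym' (at_w'y T).
have xF' : x \notin frontier X (A :|: P) c.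
  rewrite in_setU1 negb_or in_set in_setU (at_x T) /= (negbTE (oneX _ _ (at_x T) (at_w T) exw)) andbF andbT.
  by apply: contraNneq cA => <-; rewrite (at_x T).
have yF' : y \notin frontier X (A :|: P) c.
  rewrite in_setU1 negb_or in_set in_setU (at_y T) /= (negbTE (oneX _ _ (at_y T) (at_w' T) eyw')) andbF andbT.
  by apply: contraNneq cA => <-; rewrite (at_y T).
have FE : frontier X A c = (frontier X (A :|: P) c :|: P) :|: [set x; y].
  apply/setP => v; rewrite /frontier 3!in_setU in_set2 !in_set1 !in_set in_set1.
  have [->|vc] //= := eqVneq v c.
  apply/idP/idP.
    case/andP => vX; rewrite vX negb_or /=; have [vA|vA] /= := boolP (v \in A).
      case/exists_inP => u /setDP[uX uA] evu; have [uP|uP] := boolP (u \in P).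
        by case: (at_edges T vA uP evu) => -[-> _]; rewrite eqxx ?orbT.
      rewrite (_ : [exists u0 in _, _] = true) //; apply/exists_inP; exists u => //.
      by rewrite in_setD in_setU negb_or uA uP.
    by move=> _; case: (v \in P); rewrite ?orbT.
  case/orP => [/orP[/andP[->]|vP]|].
  - rewrite negb_or => /orP[/andP[-> _]//|/exists_inP[u uX evu]] /=.
    by apply/orP; right; apply/exists_inP; exists u => //; apply: (subsetP XAP).
  - by rewrite (subsetP PX) // PA.
  case/orP => /eqP->.
    by rewrite (subsetP AX) ?(at_x T) //=; apply/exists_inP; exists w.
  by rewrite (subsetP AX) ?(at_y T) //=; apply/exists_inP; exists w'.
have E1 : f1 \in edges e (A :|: P) by rewrite E in_setU in_set2 eqxx orbT.
have E2 : f2 \in edges e (A :|: P) by rewrite E in_setU in_set2 eqxx !orbT.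
have f1A : f1 \notin edges e A by rewrite mem_edges // (negbTE (PA w (at_w T))) andbF.
have f2A : f2 \notin edges e A by rewrite mem_edges // (negbTE (PA w' (at_w' T))) andbF.
have f1P : f1 \notin edges e P by rewrite mem_edges // (disjointFr dAP (at_x T)).
have f2P : f2 \notin edges e P by rewrite mem_edges // (disjointFr dAP (at_y T)).
have f12 : f1 != f2.
  apply/eqP => /set2_eq[[xy _]|[xw _]]; first by have := at_xy T; rewrite xy eqxx.
  by have := PA w' (at_w' T); rewrite -xw (at_x T).
have Bout f : f \in B -> f \notin edges e (A :|: P).
  move/(subsetP (gd_sub GB)) => /edgesP[u [v [/setDP[_ uAP] _ _ ->]]].
  by rewrite mem_edges // (negbTE uAP).
have BPP f : f \in BP -> f \in edges e P by apply: (subsetP (fl_sub FP)).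
have PAP f : f \in edges e P -> f \in edges e (A :|: P).
  by apply: (subsetP (edges_mono esym' (subsetUr _ _))).
have AAP f : f \in edges e A -> f \in edges e (A :|: P).
  by apply: (subsetP (edges_mono esym' (subsetUl _ _))).
have APXe f : f \in edges e (A :|: P) -> f \in edges e X.
  by apply: (subsetP (edges_mono esym' APX)).
have AdP f : f \in edges e P -> f \notin edges e A.
  by move=> fP; rewrite (disjointFl (edges_disjoint esym' dAP) fP).
pose T' := edges e X :\: edges e (A :|: P) :\: B.
pose TP := edges e P :\: BP.
have TE : (edges e X :\: edges e A) :\: (BP :|: B) = (T' :|: TP) :|: [set f1; f2].
  apply/setP => f; rewrite /T' /TP !(in_setU, in_setD, in_set1).
  have := @Bout f; have := @BPP f; have := @PAP f; have := @AAP f; have := @APXe f; have := @AdP f.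
  have ef : f \in edges e (A :|: P) -> [|| f \in edges e A, f \in edges e P, f == f1 | f == f2].
    by rewrite E !in_setU !in_set1 -/f1 -/f2 !orbA.
  have [->|n1] := eqVneq f f1.
    move: f1P f1A E1 => /negbTE-> /negbTE-> -> /=.
    by case: (f1 \in BP); case: (f1 \in B) => // _ hX _ _ h1 h2;
      first [by have := h1 isT | by have := h2 isT | by rewrite hX].
  have [->|n2] := eqVneq f f2.
    move: f2P f2A E2 => /negbTE-> /negbTE-> -> /=.
    by case: (f2 \in BP); case: (f2 \in B) => // _ hX _ _ h1 h2;
      first [by have := h1 isT | by have := h2 isT | by rewrite hX].
  move: ef; rewrite (negbTE n1) (negbTE n2) !orbF.
  case: (f \in edges e X); case: (f \in edges e A); case: (f \in edges e P);
  case: (f \in edges e (A :|: P)); case: (f \in BP); case: (f \in B) => //= h0 h1 h2 h3 h4 h5 h6;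
   first [by have := h0 isT | by have := h1 isT | by have := h2 isT | by have := h3 isT |
          by have := h4 isT | by have := h5 isT | by have := h6 isT].
have sT' : T' \subset (T' :|: TP) :|: [set f1; f2] by rewrite -setUA subsetUl.
have sTP : TP \subset (T' :|: TP) :|: [set f1; f2] by rewrite setUAC subsetUr.
split.
- rewrite subUset; apply/andP; split.
    apply: (subset_trans (fl_sub FP)); exact: edges_mono.
  apply: (subset_trans (gd_sub GB)); exact: edges_mono.
- move=> S0 cS EA; rewrite subUset => /andP[sBP sB].
  have EP : edges e P \subset S0 by apply: (fl_gen FP) => //; apply: closed_in_mono cS.
  have [h1 h2] := closed_in_bridge esym' cS AX PX dAP (st_cA S) (at_cP T) EA EP
    (at_x T) (at_y T) (at_xy T) (at_w T) (at_w' T) (at_wx T) (at_w'y T) (at_edges T).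
  apply: (gd_gen GB) => //; rewrite E subUset subUset EA EP /=.
  by apply/subsetP => f; rewrite in_set2 => /orP[]/eqP->.
- rewrite TE FE; set TT := _ :|: [set f1; f2]; set WW := _ :|: [set x; y].
  have cW : c \in frontier X (A :|: P) c by rewrite setU11.
  have s1 : frontier X (A :|: P) c \subset WW by rewrite /WW -setUA subsetUl.
  have s2 : P \subset WW by rewrite /WW setUAC subsetUr.
  have fromF v : v \in frontier X (A :|: P) c -> connect (rin (erel TT) WW) c v.
    by move=> vF; apply: connect_erel_mono sT' s1 _; apply: (connP _ _ (gd_conn GB)).
  have fromP v : v \in P -> connect (rin (erel TT) WW) c v.
    move=> /(fl_conn FP)[u /setIP[uP uF] con].
    apply: connect_trans (fromF u uF) _.
    by rewrite connect_rin_sym; [apply: connect_erel_mono sTP s2 con | apply: erel_sym].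
  apply: (@conn_center _ _ (@erel_sym _ _) _ c) => v.
  rewrite {1}/WW in_setU in_set2 in_setU => /orP[/orP[/fromF|/fromP]//|/orP[]/eqP->].
    apply: connect_trans (fromP w (at_w T)) _; apply: connect_rin1.
    - by rewrite (subsetP s2) ?(at_w T).
    - by rewrite /WW in_setU in_set2 eqxx orbT.
    by rewrite /erel /= setUC /TT in_setU in_set2 eqxx orbT.
  apply: connect_trans (fromP w' (at_w' T)) _; apply: connect_rin1.
  - by rewrite (subsetP s2) ?(at_w' T).
  - by rewrite /WW in_setU in_set2 eqxx !orbT.
  by rewrite /erel /= setUC /TT in_setU in_set2 eqxx !orbT.
have TTP : T' :&: TP = set0.
  apply/setP => f; rewrite in_setI in_set0; apply/negbTE/negP => /andP[].
  by move=> /setDP[/setDP[_ /negP nAP] _] /setDP[/PAP].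
have T12 : (T' :|: TP) :&: [set f1; f2] = set0.
  apply/setP => f; rewrite in_setI in_set2 in_set0; apply/negbTE/negP => /andP[].
  rewrite in_setU => /orP[/setDP[/setDP[_ nAP] _]|/setDP[fP _]] /orP[]/eqP fE.
  - by rewrite fE E1 in nAP.
  - by rewrite fE E2 in nAP.
  - by rewrite fE (negbTE f1P) in fP.
  by rewrite fE (negbTE f2P) in fP.
have cardT : #|(edges e X :\: edges e A) :\: (BP :|: B)| = #|T'| + #|TP| + 2.
  by rewrite TE cardsU T12 cards0 subn0 cards2 f12 cardsU TTP cards0 subn0.
have F12 : (frontier X (A :|: P) c :|: P) :&: [set x; y] = set0.
  apply/setP => z; rewrite in_setI in_set2 in_set0; apply/negbTE/negP => /andP[].
  rewrite in_setU => /orP[zF|zP] /orP[]/eqP zE.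
  - by rewrite zE (negbTE xF') in zF.
  - by rewrite zE (negbTE yF') in zF.
  - by rewrite zE (disjointFr dAP (at_x T)) in zP.
  by rewrite zE (disjointFr dAP (at_y T)) in zP.
(* The final 2 counts x and y and matches the two attaching edges in [cardT]; the overlap with P is
   the U of [fill]. *)
have cardW : #|frontier X A c| + #|P :&: frontier X (A :|: P) c| = #|frontier X (A :|: P) c| + #|P| + 2.
  rewrite FE cardsU F12 cards0 subn0 cards2 (at_xy T) addnAC; congr (_ + _).
  by rewrite setIC cardsUI.
have := fl_card FP; have := gd_card GB; rewrite -/T' -/TP cardT.
by clear -cardW; lia.
Qed.

End Good.

(** * Counting *)

(** With the hypothesis read as a - b <= log N, this is the passage to a smaller difference a' - b',
    free of truncated subtraction. *)
Lemma pow2_shift a b a' b' N : 2 ^ a <= 2 ^ b * N -> a' + b <= a + b' -> 2 ^ a' <= 2 ^ b' * N.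
Proof.
move=> h le; rewrite -(leq_pmul2l (_ : 0 < 2 ^ b)) ?expn_gt0 //.
rewrite mulnCA -expnD addnC; apply: (@leq_trans (2 ^ (b' + a))).
  by rewrite leq_exp2l //; move: le; clear; lia.
by rewrite expnD leq_mul2l h orbT.
Qed.

Section Families.
Variables (V : finType) (e : rel V) (Vs : {set V}) (q : nat).
Hypothesis G : cubic_3conn e Vs.
Hypothesis bq : peripheral_bound e Vs q.
Implicit Types (X Y A P W U : {set V}) (S T B : {set {set V}}) (x y z u v w c : V).

Let esym' := c3_sym G.
Let eirr := c3_irr G.

Lemma conn_edges P : conn e P -> conn (erel (edges e P)) P.
Proof.
move=> /connP cP; apply/connP => u v uP vP.
apply: connect_sub (cP u v uP vP) => a b /and3P[aP bP eab].
by apply: connect1; apply/and3P; split=> //; rewrite /erel /= mem_edges // aP bP.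
Qed.

Lemma card_edges_conn P : conn e P -> #|P| <= #|edges e P|.+1.
Proof.
move=> /conn_edges/card_conn_edges/leq_trans; apply.
by rewrite ltnS; apply: subset_leq_card; apply/subsetP => f; rewrite inE => /andP[].
Qed.

Lemma card_edges_attach X A P c c' x y w w' : stage e Vs X A c c' -> attach e Vs X A P x y w w' ->
  #|edges e X :\: edges e A| = #|edges e X :\: edges e (A :|: P)| + #|edges e P| + 2.
Proof.
move=> S T; have E := edges_attach G T.
have PX : P \subset X := subset_trans (at_P T) (subsetDl _ _).
have PA u : u \in P -> u \notin A by move/(subsetP (at_P T))/setDP=> [].
have dAP : [disjoint A & P].
  by rewrite disjoint_sym disjoint_subset; apply/subsetP => u /PA; rewrite inE.
have xP : x \notin P by rewrite (disjointFr dAP (at_x T)).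
have yP : y \notin P by rewrite (disjointFr dAP (at_y T)).
have wA := PA w (at_w T); have w'A := PA w' (at_w' T).
have f12 : [set x; w] != [set y; w'].
  apply/eqP => /set2_eq[[xy _]|[xw _]]; first by have := at_xy T; rewrite xy eqxx.
  by move: w'A; rewrite -xw (at_x T).
have cAP : #|edges e (A :|: P)| = #|edges e A| + #|edges e P| + 2.
  rewrite E cardsU cards2 f12 [#|_ :&: _|](_ : _ = 0) ?subn0.
    by rewrite cardsU (disjoint_setI0 (edges_disjoint esym' dAP)) cards0 subn0.
  apply/eqP; rewrite cards_eq0; apply/eqP/setP => f.
  rewrite !(in_setI, in_setU, in_set1, in_set0); apply/negbTE/negP => /andP[h /orP[]/eqP fE]; move: h; rewrite fE !mem_edges //.
    by rewrite (negbTE xP) (negbTE wA) andbF.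
  by rewrite (negbTE yP) (negbTE w'A) andbF.
have s1 : edges e A \subset edges e X := edges_mono esym' (st_AX S).
have s2 : edges e (A :|: P) \subset edges e X.
  by apply: edges_mono => //; rewrite subUset (st_AX S).
have := subset_leq_card s2; rewrite !cardsDS // cAP; clear; lia.
Qed.

Lemma card_attach X A P x y w w' : attach e Vs X A P x y w w' ->
  #|X :\: A| = #|X :\: (A :|: P)| + #|P|.
Proof.
move=> T; rewrite -setDDl -(cardsID P (X :\: A)) addnC; congr (_ + _).
by rewrite (setIidPr (at_P T)).
Qed.

Lemma good_full X c : c \in X -> good e X X c set0.
Proof.
move=> cX.
have FE : frontier e X X c = [set c].
  apply/setP => v; rewrite /frontier in_setU1 inE in_set1 setDv.
  case: (v == c) => //=; case: (v \in X) => //=.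
  by apply/negbTE/negP => /exists_inP[u]; rewrite inE.
split; rewrite ?setDv ?sub0set //.
  by rewrite FE; apply: conn1.
by rewrite FE ?setD0 ?setDv cards0 cards1.
Qed.

(** Every vertex of an ear is on the next frontier, so the forest on P may be empty and all edges of
    P go to B. *)
Lemma ear_fill X A P c c' x y w w' : stage e Vs X A c c' -> attach e Vs X A P x y w w' ->
  ear e Vs A P -> fill e P (P :&: frontier e X (A :|: P) c) (edges e P).
Proof.
move=> S T EP.
have PF : P :&: frontier e X (A :|: P) c = P.
  apply/setIidPl/subsetP => v vP; have [k kV evk] := EP v vP.
  have /setDP[vX vA] := subsetP (at_P T) _ vP.
  rewrite /frontier in_setU1 inE vX.
  have [kX|kX] := boolP (k \in X).
    apply/orP; right; apply/orP; right; apply/exists_inP; exists k => //.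
    by move: kV; rewrite !in_setD kX => /andP[-> _].
  have kVX : k \in Vs :\: X by rewrite inE kX (c3_inr G evk).
  by have [-> _] := st_up S (subsetP (at_P T) _ vP) kVX evk; rewrite eqxx.
rewrite PF; split=> //; first by move=> v vP; exists v.
by rewrite setDv cards0.
Qed.

(** B is a 2-base of the graph induced on X whose complement is a spanning tree; the edge count
    stands for acyclicity, as [tree_no_cycle] shows. *)
Definition base X B : Prop :=
  [/\ B \subset edges e X,
      forall S, closed_in e X S -> B \subset S -> edges e X \subset S,
      conn (erel (edges e X :\: B)) X & #|edges e X :\: B| + 1 = #|X| ].

(** Opposite extreme to an ear: d alone is on the next frontier, so the forest on Y is a spanning
    tree of Y. *)
Lemma piece_fill X A Y c c' x y w w' d d' B : stage e Vs X A c c' -> attach e Vs X A Y x y w w' ->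
  d \in Y -> d' \in Vs :\: (A :|: Y) -> e d d' ->
  (forall u v, u \in Y -> v \in Vs :\: (A :|: Y) -> e u v -> u = d /\ v = d') ->
  base Y B -> fill e Y (Y :&: frontier e X (A :|: Y) c) B.
Proof.
move=> S T dY d'U edd' up [sB gB cB nB].
have /setDP[c'V c'X] := st_c'X S.
have AYX : A :|: Y \subset X.
  by rewrite subUset (st_AX S) (subset_trans (at_P T) (subsetDl _ _)).
have YF : Y :&: frontier e X (A :|: Y) c = [set d].
  apply/setP => v; rewrite in_setI in_set1 /frontier in_setU1 in_set.
  apply/andP/eqP => [[vY]|->].
    case/orP => [/eqP vc|/andP[vX]].
      have c'U : c' \in Vs :\: (A :|: Y) by rewrite inE c'V andbT; apply: contra c'X; apply: (subsetP AYX).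
      by have [] := up v c' vY c'U (_ : e v c'); rewrite // vc (st_cc' S).
    rewrite in_setU vY orbT /= => /exists_inP[u /setDP[uX uAY] evu].
    have uU : u \in Vs :\: (A :|: Y) by rewrite in_setD uAY (subsetP (st_XV S)).
    by have [] := up v u vY uU evu.
  split=> //; have /setDP[dX dA] := subsetP (at_P T) _ dY.
  have [d'X|d'X] := boolP (d' \in X).
    rewrite dX; apply/orP; right; apply/orP; right; apply/exists_inP; exists d' => //.
    by move: d'U; rewrite !in_setD d'X => /andP[-> _].
  have d'VX : d' \in Vs :\: X by rewrite inE d'X (c3_inr G edd').
  by have [-> _] := st_up S (subsetP (at_P T) _ dY) d'VX edd'; rewrite eqxx.
rewrite YF; split=> //; last by rewrite cards1.
move=> v vY; exists d; first by rewrite set11.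
exact: (connP _ _ cB).
Qed.

(** The two parts of a union lie in the disjoint edge sets of P and of X \ (A u P) and can be
    recovered from it, so the sizes multiply. *)
Lemma attach_family X A P c c' x y w w' (FP F' : {set {set {set V}}}) :
  stage e Vs X A c c' -> attach e Vs X A P x y w w' ->
  (forall B, B \in FP -> fill e P (P :&: frontier e X (A :|: P) c) B) ->
  (forall B, B \in F' -> good e X (A :|: P) c B) ->
  exists F : {set {set {set V}}}, [/\ forall B, B \in F -> good e X A c B, #|F| = #|FP| * #|F'| &
    forall B, B \in F -> exists BP B' : {set {set V}}, [/\ BP \in FP, B' \subset edges e (X :\: (A :|: P)) & B = BP :|: B']].
Proof.
move=> S T hP h'.
have dis : [disjoint edges e P & edges e (X :\: (A :|: P))].
  apply: edges_disjoint => //; rewrite disjoint_subset; apply/subsetP => u uP.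
  by rewrite inE in_setD in_setU uP orbT.
exists [set p.1 :|: p.2 | p in setX FP F']; split.
- move=> B /imsetP[[BP B']]; rewrite inE /= => /andP[h1 h2] ->.
  by apply: (good_attach G S T); [apply: hP | apply: h'].
- rewrite card_in_imset ?cardsX // => -[B1 B1'] [B2 B2']; rewrite !inE /=.
  case/andP => /hP/fl_sub s1 /h'/gd_sub s1' /andP[/hP/fl_sub s2 /h'/gd_sub s2'] Eq.
  have pick (C C' : {set {set V}}) : C \subset edges e P -> C' \subset edges e (X :\: (A :|: P)) ->
      (C :|: C') :&: edges e P = C /\ (C :|: C') :\: edges e P = C'.
    move=> sC sC'.
    have dC : [disjoint C' & edges e P] by rewrite disjoint_sym; apply: disjointWr dis.
    split; first by rewrite setIUl (setIidPl sC) (disjoint_setI0 dC) setU0.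
    by rewrite setDUl (setDidPl dC); move: sC; rewrite -setD_eq0 => /eqP->; rewrite set0U.
  have [i1 d1] := pick _ _ s1 s1'; have [i2 d2] := pick _ _ s2 s2'.
  by congr (_, _); [rewrite -[LHS]i1 Eq i2 | rewrite -[LHS]d1 Eq d2].
move=> B /imsetP[[BP B']]; rewrite inE /= => /andP[h1 h2] ->; exists BP, B'; split=> //.
exact: gd_sub (h' _ h2).
Qed.

(* An edge of P1 crossing the boundary of P2 lies on one side only. *)
Lemma edges_ear_neq P1 P2 (Z : {set V}) B1 B2 :
  conn e P1 -> ~~ [disjoint P1 & P2] -> ~~ (P1 \subset P2) -> [disjoint P2 & Z] ->
  B2 \subset edges e Z -> edges e P1 :|: B1 != edges e P2 :|: B2.
Proof.
move=> c1 /pred0Pn[a /andP[a1 a2]] /subsetPn[b b1 b2] dis s2.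
have [u [v [u1 u2 v1 v2 euv]]] := conn_crossing c1 a1 a2 b1 b2.
apply/eqP => Eq.
have : [set u; v] \in edges e P2 :|: B2 by rewrite -Eq in_setU mem_edges // u1 v1 euv.
rewrite in_setU mem_edges // (negbTE v2) andbF /= => /(subsetP s2).
by rewrite mem_edges // (disjointFr dis u2).
Qed.

(** Subtraction-free form of 2|X \ A| - |E(X) \ E(A)| <= q log |F|, with logarithm to base 2. *)
Definition many_good X A c : Prop :=
  exists F : {set {set {set V}}}, (forall B, B \in F -> good e X A c B) /\
    2 ^ (2 * #|X :\: A|) <= 2 ^ #|edges e X :\: edges e A| * #|F| ^ q.

(** For X = V - r the exponent [#|X| + 1] is n. *)
Definition many_bases X : Prop :=
  exists F : {set {set {set V}}}, (forall B, B \in F -> base X B) /\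
    2 ^ (#|X| + 1) <= #|F| ^ (2 * q).

Lemma card_piece_cut X a b c a' b' c' : piece e Vs X a b c a' b' c' -> #|cut e X (Vs :\: X)| = 3.
Proof.
move=> [XV cV [aX bX cX] un [a'V b'V c'V] [ea eb ec] only _].
rewrite (_ : cut e X (Vs :\: X) = [set x in [:: (a, a'); (b, b'); (c, c')]]).
  rewrite cardsE; apply: (@card_uniqP _ [:: _; _; _]).
  move: un; rewrite /= !inE !negb_or !andbT => /andP[/andP[ab ac] bc].
  by rewrite !xpair_eqE !negb_and ab ac bc.
apply/setP => -[u v]; apply/idP/idP.
  rewrite [in X in X -> _]inE /= => /and3P[uX vX euv].
  by case: (only u v uX vX euv) => -[-> ->]; rewrite !inE eqxx ?orbT.
rewrite in_set !in_cons in_nil orbF => /or3P[]/eqP[-> ->];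
  by rewrite in_set /= ?aX ?bX ?cX ?a'V ?b'V ?c'V.
Qed.

Lemma card_piece X a b c a' b' c' : piece e Vs X a b c a' b' c' -> 2 * #|edges e X| + 3 = 3 * #|X|.
Proof.
move=> P; rewrite -(card_cut_edges esym' eirr) -[T in _ + T](card_piece_cut P).
have XV := pc_XV P.
rewrite -cutU; last by rewrite disjoint_sym disjoints_subset setDE subsetIr.
have -> : X :|: (Vs :\: X) = Vs by rewrite -[RHS](setID Vs X) (setIidPr XV).
rewrite card_cut_sum mulnC -sum_nat_const; apply: eq_bigr => x xX.
by rewrite (setIidPl (nb_sub G x)) (c3_deg G (subsetP XV _ xX)).
Qed.

Lemma stage_many_good X A c c' :
  (forall Y a b d a' b' d', piece e Vs Y a b d a' b' d' -> #|Y| < #|X| -> many_bases Y) ->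
  stage e Vs X A c c' -> many_good X A c.
Proof.
move=> IHD; have [n le] := ubnP #|X :\: A|; elim: n A le => // n IH A le S.
have [XA0|nX] := eqVneq (X :\: A) set0.
  have -> : A = X by apply/eqP; rewrite eqEsubset (st_AX S) -setD_eq0 XA0 eqxx.
  exists [set set0]; split; last by rewrite !setDv !cards0 cards1 exp1n.
  by move=> B /set1P->; apply: good_full; apply: st_cX S.
have next P x y w w' : attach e Vs X A P x y w w' -> many_good X (A :|: P) c.
  move=> T; apply: IH; last exact: stage_attach S T.
  have := card_attach T; have : 0 < #|P| by apply/card_gt0P; exists w; apply: at_w T.
  by move: le; clear; lia.
(* The loss [#|P|.-1] bounds 2|P| - (|E(P)| + 2), as a connected P has at least |P| - 1 edges. *)
have step P x y w w' : attach e Vs X A P x y w w' -> ear e Vs A P ->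
  exists F : {set {set {set V}}}, [/\ forall B, B \in F -> good e X A c B,
    2 ^ (2 * #|X :\: A|) <= 2 ^ (#|edges e X :\: edges e A| + #|P|.-1) * #|F| ^ q &
    forall B, B \in F -> exists2 B' : {set {set V}}, B' \subset edges e (X :\: (A :|: P)) & B = edges e P :|: B'].
  move=> T EP; have [F' [h' le']] := next P x y w w' T.
  have hP B : B \in [set edges e P] -> fill e P (P :&: frontier e X (A :|: P) c) B.
    by move=> /set1P->; apply: (ear_fill S T).
  have [F [hF cF fF]] := attach_family S T hP h'.
  exists F; split=> //; last first.
    by move=> B /fF[BP [B' [/set1P-> sB ->]]]; exists B'.
  rewrite cF cards1 mul1n; apply: pow2_shift le' _.
  rewrite (card_edges_attach S T) (card_attach T).
  have := card_edges_conn (at_cP T).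
  by have : 0 < #|P|; [apply/card_gt0P; exists w; apply: at_w T | clear; lia].
case: (stage_progress G bq S nX).
- move=> [P [x [y [w [w' [T EP P1]]]]]].
  by have [F [hF leF _]] := step P x y w w' T EP; exists F; move: leF; rewrite P1 addn0.
- move=> [Y [x [y [w [w' [d [d' [T pY up]]]]]]]].
  have [F' [h' le']] := next Y x y w w' T.
  have YX : #|Y| < #|X|.
    have := card_attach T; have := cardsID A X; rewrite (setIidPr (st_AX S)).
    have : 0 < #|A| by apply/card_gt0P; exists x; apply: at_x T.
    by clear; lia.
  have [FY [hY leY]] := IHD Y w w' d x y d' pY YX.
  have [_ _ dY] := pc_in pY; have [_ _ edd'] := pc_edges pY; have [_ _ d'Y] := pc_out pY.
  (* Were d' in A, dd' would be one of the two attaching edges and d would coincide with w or w'. *)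
  have d'U : d' \in Vs :\: (A :|: Y).
    have /setDP[d'V d'Y'] := d'Y; rewrite inE d'V andbT in_setU negb_or d'Y' andbT.
    apply/negP => d'A; have ed'd : e d' d by rewrite esym'.
    by case: (at_edges T d'A dY ed'd) => -[_ dw]; have := pc_uniq pY;
      rewrite /= !inE dw eqxx ?orbT ?andbF.
  have hP B : B \in FY -> fill e Y (Y :&: frontier e X (A :|: Y) c) B.
    by move=> /hY; apply: (piece_fill S T dY d'U edd' up).
  have [F [hF cF _]] := attach_family S T hP h'.
  exists F; split=> //.
  (* Squaring clears the half in 2|Y| - |E(Y)| - 2 = (|Y| - 1)/2, which the exponent (|Y| + 1)/2
     from [many_bases] exceeds. *)
  have key : 2 ^ (2 * #|Y|) <= 2 ^ (#|edges e Y| + 2) * #|FY| ^ q.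
    rewrite -leq_sqr expnMn -!expnM [q * 2]mulnC.
    apply: (@pow2_shift _ 0); first by rewrite expn0 mul1n; apply: leY.
    by have := card_piece pY; clear; lia.
  rewrite cF (card_edges_attach S T) (card_attach T) mulnDr expnD -addnA expnD expnMn [_ ^ q * _]mulnC mulnACA.
  by apply: leq_mul.
move=> [P1 [P2 [x1 [y1 [w1 [w1' [x2 [y2 [w2 [w2' [[T1 EP1 l1] [T2 EP2 l2 P12 meet]]]]]]]]]]]].
have [F1 [h1 le1 f1]] := step _ _ _ _ _ T1 EP1.
have [F2 [h2 le2 f2]] := step _ _ _ _ _ T2 EP2.
have disP P : [disjoint P & X :\: (A :|: P)].
  by rewrite disjoint_subset; apply/subsetP => z zP; rewrite inE in_setD in_setU zP orbT.
have dF : F1 :&: F2 = set0.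
  apply/setP => B; rewrite in_setI in_set0; apply/negbTE/negP.
  case/andP => /f1[B1 s1 E1] /f2[B2 s2 E2].
  have [P1P2|P1P2] := boolP (P1 \subset P2).
    have P2P1 : ~~ (P2 \subset P1) by apply: contra P12 => P2P1; rewrite eqEsubset P1P2.
    have := edges_ear_neq B2 (at_cP T2) _ P2P1 (disP P1) s1.
    by rewrite disjoint_sym => /(_ meet)/eqP; apply; rewrite -E1 -E2.
  by have /eqP := edges_ear_neq B1 (at_cP T1) meet P1P2 (disP P2) s2; apply; rewrite -E1 -E2.
exists (F1 :|: F2); split.
  by move=> B; rewrite in_setU => /orP[/h1|/h2].
rewrite cardsU dF cards0 subn0.
(* The factor 2 to the power q gained by doubling F covers the loss |P| - 1 of the ear. The ears may
   differ in size, so the estimate is used for the ear with the smaller family. *)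
have half F P : 2 ^ (2 * #|X :\: A|) <= 2 ^ (#|edges e X :\: edges e A| + #|P|.-1) * F ^ q ->
    #|P| + 2 <= q -> 2 * F <= #|F1| + #|F2| ->
    2 ^ (2 * #|X :\: A|) <= 2 ^ #|edges e X :\: edges e A| * (#|F1| + #|F2|) ^ q.
  move=> h lq l; apply: leq_trans (_ : 2 ^ #|edges e X :\: edges e A| * (2 * F) ^ q <= _); last first.
    by rewrite leq_mul2l leq_exp2r ?l ?orbT //; move: lq; clear; lia.
  rewrite expnMn mulnA -expnD; apply: pow2_shift h _.
  by move: lq; clear; lia.
have [l12|l21] := leqP #|F1| #|F2|.
  by apply: (half #|F1| P1) => //; move: l12; clear; lia.
by apply: (half #|F2| P2) => //; move: l21; clear; lia.
Qed.

End Families.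

(** * Starting paths and bases of sets with three outgoing edges *)

Section Bases.
Variables (V : finType) (e : rel V) (Vs : {set V}) (q : nat).
Hypothesis G : cubic_3conn e Vs.
Hypothesis bq : peripheral_bound e Vs q.
Implicit Types (X Y Z A P D : {set V}) (S T B : {set {set V}}) (x y z u v w a b c : V).

Let esym' := c3_sym G.

Lemma piece_swap X a b c a' b' c' : piece e Vs X a b c a' b' c' -> piece e Vs X a c b a' c' b'.
Proof.
move=> [XV cV [aX bX cX] un [a'V b'V c'V] [ea eb ec] only dist].
have swap (x y z : V) : uniq [:: x; y; z] -> uniq [:: x; z; y].
  by rewrite -(perm_uniq (_ : perm_eq [:: x; z; y] _)) // perm_cons (perm_catC [:: z] [:: y]).
split=> //; [exact: swap | | by case: dist; [left | right; apply: swap]].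
move=> u v uX vX euv.
by case: (only u v uX vX euv) => h; [constructor 1 | constructor 3 | constructor 2].
Qed.

Section Piece.
Variables (X : {set V}) (a b c a' b' c' : V).
Hypothesis pX : piece e Vs X a b c a' b' c'.

Let XV : X \subset Vs := pc_XV pX.

Let splitX Z : Z \subset X -> Vs :\: Z = (X :\: Z) :|: (Vs :\: X).
Proof.
move=> sZ; apply/setP => u; rewrite !(in_setU, in_setD).
have := subsetP XV u; have := subsetP sZ u.
by case: (u \in X); case: (u \in Z); case: (u \in Vs) => //= h1 h2;
  first [by have := h1 isT | by have := h2 isT].
Qed.

Let disX Z : [disjoint X :\: Z & Vs :\: X].
Proof.
by rewrite disjoint_subset; apply/subsetP => u /setDP[uX _]; rewrite inE in_setD uX.
Qed.

Let cutX Z : Z \subset X -> Z != set0 -> 2 < #|cut e Z (X :\: Z)| + #|cut e Z (Vs :\: X)|.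
Proof.
move=> sZ nZ; rewrite -cutU // -splitX //; apply: (cut3 G) => //.
  exact: subset_trans sZ XV.
have [/setDP[a'V a'X] _ _] := pc_out pX.
by apply: contraNneq a'X => E; apply: (subsetP sZ); rewrite E.
Qed.

Lemma piece_conn : conn e X.
Proof.
apply: conn_cut => Z sZ nZ neZ; rewrite lt0n; apply/negP => /eqP c0.
have n2 : X :\: Z != set0.
  by rewrite setD_eq0; apply: contra neZ => s; rewrite eqEsubset sZ.
have := cutX sZ nZ; have := cutX (subsetDl X Z) n2.
rewrite c0 setDDr setDv set0U (setIidPr sZ) (cut_sym esym') c0.
have := card_piece_cut pX; rewrite -{1}(setID X Z) (setIidPr sZ) (cutUl esym').
  by clear; lia.
by rewrite disjoint_sym disjoints_subset setDE subsetIr.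
Qed.

(** If X minus c split into two parts without edges between them, at least six edges would leave the
    parts; but at most two go to c, whose third edge is cc', and at most two leave X. *)
Lemma piece_del_conn : conn e (X :\ c).
Proof.
have [_ _ cX] := pc_in pX; have [_ _ c'V] := pc_out pX; have [_ _ ecc'] := pc_edges pX.
have /setDP[_ c'X] := c'V.
apply: conn_cut => Z sZ nZ neZ; rewrite lt0n; apply/negP => /eqP c0.
pose Z2 := X :\ c :\: Z.
have n2 : Z2 != set0.
  by rewrite setD_eq0; apply: contra neZ => s; rewrite eqEsubset sZ.
have cZ : c \notin Z by apply/negP => /(subsetP sZ); rewrite !inE eqxx.
have cZ2 : c \notin Z2 by rewrite /Z2 !(in_setD, in_set1) eqxx andbF.
have sZX : Z \subset X := subset_trans sZ (subD1set _ _).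
have sZ2X : Z2 \subset X := subset_trans (subsetDl _ _) (subD1set _ _).
have d12 : [disjoint Z & Z2] by rewrite disjoint_sym disjoints_subset /Z2 setDE subsetIr.
have E1 : X :\: Z = Z2 :|: [set c].
  apply/setP => z; rewrite /Z2 !(in_setU, in_setD, in_set1).
  by case: (eqVneq z c) => [->|]; rewrite ?cZ ?cX ?orbF.
have E2 : X :\: Z2 = Z :|: [set c].
  apply/setP => z; rewrite /Z2 !(in_setU, in_setD, in_set1).
  have := subsetP sZX z; case: (eqVneq z c) => [->|_]; first by rewrite cX orbT andbF.
  by case: (z \in Z); case: (z \in X) => //= h; have := h isT.
have EX : X = (Z :|: Z2) :|: [set c].
  by rewrite -setUA -E1 -{1}(setID X Z) (setIidPr sZX).
have := cutX sZX nZ; have := cutX sZ2X n2.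
rewrite E1 E2 !cutU ?disjoints1 ?cZ ?cZ2 //; first last.
- by rewrite disjoint_sym disjoints1.
- by rewrite disjoint_sym disjoints1.
rewrite [#|cut e Z2 Z|](cut_sym esym') c0 !add0n.
have cc : #|cut e Z [set c]| + #|cut e Z2 [set c]| <= 2.
  rewrite -(cutUl esym') // (cut_sym esym') cut_nb.
  apply: (@nbI_other _ _ _ G _ _ c') => //; first exact: (subsetP XV).
  by apply: contra c'X; rewrite in_setU => /orP[/(subsetP sZX)|/(subsetP sZ2X)].
have c1 : 0 < #|cut e [set c] (Vs :\: X)| by apply: (cut_gt0 (u := c) (v := c')); rewrite ?set11.
have := card_piece_cut pX; rewrite {1}EX (cutUl esym'); last first.
  by rewrite disjoint_sym disjoints1 in_setU negb_or cZ.
rewrite (cutUl esym') //; move: cc c1; clear; lia.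
Qed.

(** R is a path from a to b found by [nonseparating_path] with c on the other side, so that X \ R
    keeps its link to the outside through cc'. *)
Lemma piece_start : exists R : {set V},
  [/\ stage e Vs X R c c', a \in R, b \in R, c \notin R & #|R| <= q] /\
  forall v, v \in R -> exists2 k, k \in X :\: R & e v k.
Proof.
have [aX bX cX] := pc_in pX; have [a'V b'V c'V] := pc_out pX.
have [ea eb ec] := pc_edges pX; have only := pc_only pX.
have [/setDP[a'Vs a'X] /setDP[b'Vs b'X] /setDP[c'Vs c'X]] := pc_out pX.
have [ab ac bc] : [/\ a != b, a != c & b != c].
  by have := pc_uniq pX; rewrite /= !inE negb_or andbT => /andP[/andP[-> ->] ->].
have aT : a \notin [set b] by rewrite inE.
have aXc : a \in X :\: [set c] by rewrite in_setD1 ac.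
have bXc : b \in X :\: [set c] by rewrite in_setD1 bc.
have con : connect (rin e (X :\: [set c])) a b by apply: (connP _ _ piece_del_conn).
have cX1 : [set c] \subset X by rewrite sub1set.
have bX1 : [set b] \subset X by rewrite sub1set.
have nc : [set c] != set0 by apply/set0Pn; exists c; rewrite set11.
have deg3 v : v \in X -> #|nb e v :&: X| <= 3.
  by move=> /(subsetP XV) vV; apply: (nbI_le3 G).
have deg2 v : v \in a |: [set b] -> #|nb e v :&: X| <= 2.
  rewrite in_set2 => /orP[]/eqP->.
    by apply: (@nbI_other _ _ _ G _ _ a') => //; apply: (subsetP XV).
  by apply: (@nbI_other _ _ _ G _ _ b') => //; apply: (subsetP XV).
have DX D : D \subset X :\: [set c] -> D \subset X /\ forall u v, u \in D -> v \in Vs :\: X -> e u v ->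
    (u = a /\ v = a') \/ (u = b /\ v = b').
  move=> sD; split=> [|u v uD vX euv]; first exact: subset_trans sD (subsetDl _ _).
  have := subsetP sD u uD; rewrite in_setD1 => /andP[uc uX].
  case: (only u v uX vX euv) => -[uE vE]; [by left | by right |].
  by rewrite uE eqxx in uc.
have h1 D : D \subset X :\: [set c] -> D != set0 -> (a \in D -> [disjoint D & [set b]]) ->
    1 < #|cut e D (X :\: D)|.
  move=> sD nD dD; have [sDX DE] := DX D sD; have := cutX sDX nD.
  have : #|cut e D (Vs :\: X)| <= 1.
    have [aD|aD] := boolP (a \in D).
      apply: (@cut_le1 _ _ _ _ a a') => u v uD vX euv; case: (DE u v uD vX euv) => -[uE vE] //.
      by have := disjointFr (dD aD) uD; rewrite uE set11.
    apply: (@cut_le1 _ _ _ _ b b') => u v uD vX euv; case: (DE u v uD vX euv) => -[uE vE] //.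
    by rewrite -uE uD in aD.
  by clear; lia.
have h2 D : D \subset X :\: [set c] -> D != set0 -> a \notin D -> [disjoint D & [set b]] ->
    2 < #|cut e D (X :\: D)|.
  move=> sD nD aD bD; have [sDX DE] := DX D sD; have := cutX sDX nD.
  rewrite [T in _ + T]cut_eq0 ?addn0 // => u v uD vX; apply/negP => euv.
  case: (DE u v uD vX euv) => -[uE vE]; first by rewrite -uE uD in aD.
  by have := disjointFr bD uD; rewrite uE set11.
have [p [[hp up /set1P lp sK0 cK] [sp hK]]] := nonseparating_path esym' piece_conn (conn1 e c) cX1 nc
  aXc (set11 b) con bX1 aT deg3 deg2 h1 h2.
set R := [set z in a :: p] in sK0 cK hK.
have inR z : (z \in R) = (z \in a :: p) by rewrite inE.
have aR : a \in R by rewrite inR mem_head.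
have bR : b \in R by rewrite inR -lp mem_last.
have cK' : c \in X :\: R by rewrite (subsetP sK0) ?set11.
have cR : c \notin R by have /setDP[] := cK'.
have RX : R \subset X by apply/subsetP => z; rewrite inR => /sp.
have cRR : conn e R := path_conn esym' hp.
have hK' v : v \in R -> exists2 k, k \in X :\: R & e v k by rewrite inR => /hK.
have VR : Vs :\: R = (X :\: R) :|: (Vs :\: X) by apply: splitX.
have R2 u : u \in R -> exists2 z, z \in R & e u z.
  move=> uR; have [z zR zu] : exists2 z, z \in R & z \notin [set u].
    by have [->|us] := eqVneq u a; [exists b | exists a]; rewrite // inE eq_sym.
  have [x [y [_ /set1P-> yR _ exy]]] := conn_crossing cRR uR (set11 u) zR zu.
  by exists y.
have notK z : z \in R -> z \notin X :\: R by move=> zR; rewrite in_setD zR.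
have viaOut v z : v \in R -> z \notin X -> e v z -> #|nb e v :&: (X :\: R)| <= 1.
  move=> vR zX evz; have [y yR evy] := R2 v vR.
  apply: (@nbI_others _ _ _ G _ _ z y) => //.
  - by rewrite (subsetP XV) // (subsetP RX).
  - by apply: contraNneq zX => ->; apply: (subsetP RX).
  - by rewrite in_setD (negbTE zX) andbF.
  exact: notK.
exists R; split=> //; split=> //.
  split=> //.
  - rewrite VR; apply: (connU esym' cK (pc_cV pX) cK' c'V); by rewrite ec orbT.
  - move=> u v /setDP[uX uR] vX euv; case: (only u v uX vX euv) => -[uE vE] //.
      by rewrite uE aR in uR.
    by rewrite uE bR in uR.
  - by exists a, a'.
  move=> v vR; have [vE|va] := eqVneq v a; first by apply: (viaOut v a') => //; rewrite vE.
  have [vE|vb] := eqVneq v b; first by apply: (viaOut v b') => //; rewrite vE.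
  have vp : v \in a :: p by rewrite -inR.
  have vl : v != last a p by rewrite lp.
  have [x [y [xR yR exv evy /andP[l1 l2]]]] := path_interior_nbrs hp up vp va vl.
  apply: (@nbI_others _ _ _ G _ _ x y) => //.
  - by rewrite (subsetP XV) // (subsetP RX).
  - by rewrite esym'.
  - by apply: contraTneq (ltn_trans l1 l2) => ->; rewrite ltnn.
  - by apply: notK; rewrite inR.
  by apply: notK; rewrite inR.
have cR' : #|R| = size p + 1.
  by rewrite addn1 -[RHS]/(size (a :: p)) -(card_uniqP up); apply: eq_card => z; rewrite inR.
have dR : [disjoint R & Vs :\: X].
  by rewrite disjoint_subset; apply/subsetP => z /(subsetP RX) zX; rewrite inE in_setD zX.
(* A one-vertex outside closes R to a peripheral cycle directly, the edge from c showing that a' has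
   a neighbour off the cycle. Otherwise a' and b' differ and the outside plays the part of A in
   [ear_bound]. *)
rewrite cR'; case: (pc_dist pX) => [V1|un].
  have b'a' : b' = a' by have := b'V; rewrite V1 => /set1P.
  have c'a' : c' = a' by have := c'V; rewrite V1 => /set1P.
  pose s := rcons (a :: p) a'.
  have sE : Vs :\: [set z in s] = X :\: R.
    have -> : [set z in s] = R :|: [set a'].
      by apply/setP => z; rewrite in_setU inR in_set1 in_set mem_rcons in_cons orbC.
    rewrite -setDDl VR setDUl V1 setDv setU0; apply/setDidPl.
    by rewrite disjoint_sym disjoints1 in_setD (negbTE a'X) andbF.
  have ss : size s = size p + 2 by rewrite size_rcons addn2.
  apply: (@leq_trans (size s)); first by rewrite ss leq_add2l.
  apply: bq.
  - by rewrite rcons_uniq up andbT; apply: contra a'X => /sp.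
  - by rewrite ss; case: (p) lp => [/= E|? ? _]; [rewrite E eqxx in ab | rewrite addn2].
  - by rewrite /s rcons_cons /= rcons_path rcons_path hp lp last_rcons -b'a' eb b'a' esym' ea.
  - move=> z; rewrite /s mem_rcons in_cons => /orP[/eqP->//|/sp]; exact: (subsetP XV).
  - by rewrite sE.
  move=> v; rewrite sE /s mem_rcons in_cons => /orP[/eqP->|]; last by rewrite -inR => /hK'.
  by exists c; rewrite // esym' -c'a'.
have a'b' : a' != b' by move: un; rewrite /= !inE negb_or => /andP[/andP[]].
have KV : [disjoint Vs :\: X & X :\: R].
  by rewrite disjoint_sym; apply: disX.
apply: (@leq_trans (size p + 3)); first by rewrite leq_add2l.
apply: (ear_bound G bq hp up (A := Vs :\: X) (K0 := X :\: R) (x := a') (y := b')) => //.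
- by rewrite -/R setUC [_ :|: (X :\: R)]setUC -VR setUC -{1}(setID Vs R) (setIidPr _) // (subset_trans RX).
- rewrite -/R [_ :|: (X :\: R)]setUC -VR; by rewrite disjoint_sym disjoints_subset setDE subsetIr.
- exact: pc_cV pX.
- by exists c', c; split=> //; rewrite esym'.
- by rewrite lp.
move=> u v uV; rewrite -inR => vR euv; rewrite esym' in euv.
case: (only v u (subsetP RX _ vR) uV euv) => -[vE uE]; [by left | by right; rewrite lp |].
by rewrite -vE vR in cR.
Qed.

End Piece.

(** Each vertex of R has a neighbour in X \ R, so the frontier is all of X and the tree of [good]
    already spans X. *)
Lemma base_of_good X (R : {set V}) c B : R \subset X -> c \in X ->
  (forall v, v \in R -> exists2 k, k \in X :\: R & e v k) ->
  good e X R c B -> base e X (edges e R :|: B).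
Proof.
move=> RX cX hK [sB gB cB nB].
have FX : frontier e X R c = X.
  apply/setP => v; rewrite /frontier in_setU1 in_set.
  have [->|vc] /= := eqVneq v c; first by rewrite cX.
  have [vX|//] /= := boolP (v \in X); have [vR|//] /= := boolP (v \in R).
  by have [k kX evk] := hK v vR; apply/exists_inP; exists k.
rewrite FX setDDl in cB nB; split=> //.
  rewrite subUset edges_mono //; apply: subset_trans sB _; apply: edges_mono => //.
  exact: subsetDl.
by move=> S cS; rewrite subUset => /andP[? ?]; apply: gB.
Qed.

(** Starting paths from a to b avoiding c and from a to c avoiding b share a but not b, so by
    [edges_ear_neq] their families are disjoint. This doubling absorbs the factor 2 to the power 2q
    in [step]. *)
Lemma piece_many_bases X a b c a' b' c' : piece e Vs X a b c a' b' c' -> many_bases e q X.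
Proof.
have [n le] := ubnP #|X|; elim: n X a b c a' b' c' le => // n IH X a b c a' b' c' le pX.
have IHD Y x y z x' y' z' : piece e Vs Y x y z x' y' z' -> #|Y| < #|X| -> many_bases e q Y.
  by move=> pY lY; apply: IH pY; apply: leq_trans lY _.
have step x y z x' y' z' : piece e Vs X x y z x' y' z' -> exists R : {set V}, exists F : {set {set {set V}}},
    [/\ conn e R, x \in R, y \in R, z \notin R & forall B, B \in F -> base e X B] /\
    [/\ 2 ^ (#|X| + 1) <= 2 ^ (2 * q) * #|F| ^ (2 * q) &
      forall B, B \in F -> exists2 B' : {set {set V}}, B' \subset edges e (X :\: R) & B = edges e R :|: B'].
  move=> pX'; have [R [[S xR yR zR lR] hK]] := piece_start pX'.
  have [F' [h' le']] := stage_many_good G bq IHD S.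
  have RX := st_AX S; have [_ _ zX] := pc_in pX'.
  have dis : [disjoint edges e R & edges e (X :\: R)].
    apply: edges_disjoint => //; rewrite disjoint_subset; apply/subsetP => u uR.
    by rewrite inE in_setD uR.
  exists R, [set edges e R :|: B | B : {set {set V}} in F']; split; split=> //.
  - exact: st_cA S.
  - by move=> B /imsetP[B' B'F ->]; apply: (base_of_good RX zX hK); apply: h'.
  - rewrite card_in_imset; last first.
      move=> B1 B2 /h'/gd_sub s1 /h'/gd_sub s2 Eq.
      have pick (C : {set {set V}}) : C \subset edges e (X :\: R) -> (edges e R :|: C) :\: edges e R = C.
        move=> sC; rewrite setDUl setDv set0U; apply/setDidPl.
        by rewrite disjoint_sym; apply: disjointWr dis.
      by rewrite -(pick _ s1) Eq pick.
    have sq : 2 ^ (4 * #|X :\: R|) <= 2 ^ (2 * #|edges e X :\: edges e R|) * #|F'| ^ (2 * q).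
      rewrite -leq_sqr expnMn -!expnM in le'.
      by rewrite (_ : 4 * _ = 2 * #|X :\: R| * 2) 1?[2 * #|edges e X :\: _|]mulnC 1?[2 * q]mulnC // mulnAC.
    (* By [card_piece] and |E(R)| >= |R| - 1, the difference 4|X \ R| - 2|E(X) \ E(R)| is at least
       |X| + 1 - 2|R|, and |R| <= q. *)
    apply: pow2_shift sq _.
    rewrite (cardsDS RX) (cardsDS (edges_mono esym' RX)).
    have := card_piece G pX'; have := card_edges_conn G (st_cA S).
    have := subset_leq_card RX; have := subset_leq_card (edges_mono esym' RX); move: lR.
    have : 0 < #|R| by apply/card_gt0P; exists x.
    by clear; lia.
  by move=> B /imsetP[B' /h'/gd_sub s ->]; exists B'.
have [R1 [F1 [[c1 a1 b1 _ h1] [le1 f1]]]] := step _ _ _ _ _ _ pX.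
have [R2 [F2 [[c2 a2 _ b2 h2] [le2 f2]]]] := step _ _ _ _ _ _ (piece_swap pX).
have dF : F1 :&: F2 = set0.
  apply/setP => B; rewrite in_setI in_set0; apply/negbTE/negP.
  case/andP => /f1[B1 s1 E1] /f2[B2 s2 E2].
  have meet : ~~ [disjoint R1 & R2] by apply/pred0Pn; exists a; rewrite /= a1.
  have nsub : ~~ (R1 \subset R2) by apply/subsetPn; exists b.
  have dis : [disjoint R2 & X :\: R2].
    by rewrite disjoint_subset; apply/subsetP => z zP; rewrite inE in_setD zP.
  by have /eqP := edges_ear_neq G B1 c1 meet nsub dis s2; apply; rewrite -E1 -E2.
exists (F1 :|: F2); split.
  by move=> B; rewrite in_setU => /orP[/h1|/h2].
rewrite cardsU dF cards0 subn0.
have half F : 2 ^ (#|X| + 1) <= 2 ^ (2 * q) * F ^ (2 * q) -> 2 * F <= #|F1| + #|F2| ->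
    2 ^ (#|X| + 1) <= (#|F1| + #|F2|) ^ (2 * q).
  move=> h l; apply: (leq_trans h); rewrite -expnMn.
  by case: (2 * q) => [|k]; rewrite ?expn0 // leq_exp2r.
have [l12|l21] := leqP #|F1| #|F2|.
  by apply: (half #|F1|) => //; move: l12; clear; lia.
by apply: (half #|F2|) => //; move: l21; clear; lia.
Qed.

End Bases.

(** * Spanning trees and decompositions *)

Section Cycles.
Variables (V : finType).
Implicit Types (s : seq V) (x y z : V) (T : {set {set V}}) (W : {set V}) (e : rel V).

Lemma next_next_neq s x : uniq s -> 2 < size s -> x \in s -> next s (next s x) != x.
Proof.
move=> us ss xs; have [i s' rE] := rot_to xs.
rewrite -!(next_rot i us); have := us; have := ss.
rewrite -(size_rot i) -(rot_uniq i) rE.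
case: s' {rE} => [|a [|b t]] // _ us'.
have [xa xb] : x != a /\ x != b.
  by move: us'; rewrite /= !inE !negb_or => /andP[/and3P[-> ->]].
have -> : next [:: x, a, b & t] x = a by rewrite /= eqxx.
have -> : next [:: x, a, b & t] a = b by rewrite /= eq_sym (negbTE xa) eqxx.
by rewrite eq_sym.
Qed.

Lemma card_cycle_edges s : uniq s -> 2 < size s -> #|cycle_edges s| = size s.
Proof.
move=> us ss; rewrite card_in_imset; first by rewrite (card_uniqP us).
move=> x y xs ys /set2_eq[[//]|[xE yE]].
by have := next_next_neq us ss ys; rewrite -xE yE eqxx.
Qed.

(* Otherwise a connected set would remain connected with one edge too few. *)
Lemma tree_no_cycle T W s : conn (erel T) W -> #|T| < #|W| ->
  uniq s -> 2 < size s -> {subset s <= W} -> ~~ (cycle_edges s \subset T).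
Proof.
move=> cW cT us ss sW; apply/negP => sT.
have [x xs] : exists x, x \in s by case: (s) ss => // x t _; exists x; rewrite mem_head.
have [i s' rE] := rot_to xs.
have us' : uniq (x :: s') by rewrite -rE rot_uniq.
have ss' : 2 < size (x :: s') by rewrite -rE size_rot.
have cyc : cycle (erel T) (x :: s').
  rewrite -rE rot_cycle; apply: cycle_from_next => // z zs.
  by apply: (subsetP sT); apply/imsetP; exists z.
have inW : {subset x :: s' <= W} by move=> z; rewrite -rE mem_rot; apply: sW.
case: s' rE us' ss' cyc inW => [|a [|b t]] // rE us' _ cyc inW.
pose f := [set x; a].
have fT : f \in T by move: cyc => /= /andP[].
have := us'; rewrite cons_uniq => /andP[xn us2].
have lt : last b t != a.
  by apply: contraTneq us2 => <-; rewrite cons_uniq mem_last.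
have xl : x != last b t.
  by apply: contraNneq xn => ->; rewrite inE mem_last orbT.
have p1 : path (erel (T :\ f)) a (b :: t).
  apply: (@sub_in_path _ [pred z | z != x] (erel T)).
  - move=> u v; rewrite !inE /erel /= in_setD1 => ux vx ->; rewrite andbT.
    apply/eqP => /set2_eq[[E _]|[_ E]]; first by rewrite E eqxx in ux.
    by rewrite E eqxx in vx.
  - by apply/allP => z zt; rewrite inE; apply: contraNneq xn => <-.
  by move: cyc; rewrite /= rcons_path => /and3P[_ -> /andP[->]].
have cn : connect (rin (erel (T :\ f)) W) a x.
  apply: (@connect_trans _ _ (last b t)).
    have c := path_conn (@erel_sym _ _) p1.
    apply: connect_rin_mono (connP _ _ c a (last b t) _ _).
    - by apply/subsetP => z; rewrite inE => zt; apply: inW; rewrite inE zt orbT.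
    - by rewrite inE mem_head.
    by rewrite inE [_ \in _ :: _]inE mem_last orbT.
  apply: connect_rin1.
  - by apply: inW; rewrite inE [_ \in _ :: _]inE mem_last !orbT.
  - by apply: inW; rewrite mem_head.
  rewrite /erel /= in_setD1; apply/andP; split; last first.
    by move: cyc; rewrite /= rcons_path => /and4P[].
  apply/eqP => /set2_eq[[E _]|[E _]]; first by rewrite E eqxx in xl.
  by rewrite E eqxx in lt.
have cW' : conn (erel (T :\ f)) W.
  apply/connP => u v uW vW; apply: connect_sub (connP _ _ cW u v uW vW) => y z /and3P[yW zW yz].
  have [E|ne] := eqVneq [set y; z] f; last first.
    by apply: connect1; apply/and3P; split=> //; rewrite /erel /= in_setD1 ne.
  case: (set2_eq E) => -[-> ->] //.
  by rewrite connect_rin_sym //; apply: erel_sym.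
have le : #|[set g in T :\ f | g \subset W]| <= #|T :\ f|.
  by apply: subset_leq_card; apply/subsetP => g; rewrite inE => /andP[].
have := leq_trans (card_conn_edges cW') (le : _ < _.+1).
by rewrite leqNgt; move: cT; rewrite (cardsD1 f T) fT add1n => ->.
Qed.

End Cycles.

(** * From adjacency relations back to graphs *)

Section Link.
Variables (V : finType).
Implicit Types (G C H : graph V) (X : {set V}) (B T S : {set {set V}}) (x y z r : V).

Lemma adj_sym G : symmetric (adj G).
Proof. by move=> x y; rewrite /adj /= setUC. Qed.

Lemma adj_irr G : irreflexive (adj G).
Proof.
move=> x; apply/negP => /(forall_inP (graph_wf G))/andP[].
by rewrite setUid cards1.
Qed.

Lemma adj_in G x y : adj G x y -> x \in vset G.
Proof. by move=> /(forall_inP (graph_wf G))/andP[_ /subsetP]; apply; rewrite set21. Qed.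

Lemma edge_adj G f : f \in eset G -> exists x y, adj G x y /\ f = [set x; y].
Proof.
move=> fG; have /andP[/cards2P[x [y [_ E]]] _] := forall_inP (graph_wf G) _ fG.
by exists x, y; rewrite /adj /= -E.
Qed.

Lemma card_nb_degree G x : #|nb (adj G) x| = degree G x.
Proof.
have inj : {in nb (adj G) x &, injective (fun y => [set x; y])}.
  move=> y z; rewrite !inE => xy xz /set2_eq[[]//|[E _]].
  by move: xz; rewrite -E adj_irr.
rewrite -(card_in_imset inj); apply: eq_card => f; apply/imsetP/idP => [[y]|].
  by rewrite inE => xy ->; rewrite inE set21 andbT.
rewrite inE => /andP[fG xf]; have [u [v [uv E]]] := edge_adj fG.
rewrite E in xf *; move: xf; rewrite in_set2 => /orP[]/eqP->; first by exists v; rewrite ?inE.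
by exists u; [rewrite inE adj_sym | rewrite setUC].
Qed.

Lemma adj_del_vertices G X x y :
  adj (del_vertices G X) x y -> rin (adj G) (vset G :\: X) x y.
Proof.
rewrite /adj /= inE => /andP[xy dis]; have xyG : adj G x y by [].
have nX z : z \in [set x; y] -> z \notin X by move=> zxy; rewrite (disjointFr dis zxy).
by rewrite /rin /= !inE !nX ?set21 ?set22 // (adj_in xyG) (@adj_in _ _ x) ?xyG // adj_sym.
Qed.

Lemma cubic_3conn_of_graph G : k_connected 3 G -> cubic G -> cubic_3conn (adj G) (vset G).
Proof.
move=> /andP[_ /forallP k3] /forall_inP cub.
split; [exact: adj_sym | exact: adj_irr | exact: adj_in | |].
  by move=> x xG; rewrite card_nb_degree; apply/eqP/cub.
move=> X sX cX; have := k3 X; rewrite sX cX /= => /andP[_ /forall_inP h].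
apply/connP => x y xX yX.
have /forall_inP/(_ y yX) := h x xX.
by apply: connect_sub => a b /adj_del_vertices/connect1.
Qed.

Lemma cycle_graph_wf G (s : seq V) : cycle (adj G) s ->
  wf_graph ([set z in s], cycle_edges s).
Proof.
move=> cs; apply/forall_inP => f /imsetP[z zs ->] /=.
have az := next_cycle cs zs.
have ne : z != next s z by apply: contraTneq az => <-; rewrite adj_irr.
by rewrite cards2 ne subUset !sub1set !inE mem_next zs.
Qed.

Lemma is_cycle_seq C : is_cycle C ->
  exists s, [/\ uniq s, 2 < size s, vset C = [set x in s] & eset C = cycle_edges s].
Proof. by case/existsP => s /and4P[us ss /eqP vE /eqP eE]; exists s. Qed.

Lemma seq_is_cycle C (s : seq V) : uniq s -> 2 < size s ->
  vset C = [set x in s] -> eset C = cycle_edges s -> is_cycle C.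
Proof.
move=> us ss vE eE.
have sz : size s == #|vset C|.
  by rewrite vE -(card_uniqP us); apply/eqP/eq_card => z; rewrite inE.
by apply/existsP; exists (Tuple sz); apply/and4P; split=> //; apply/eqP.
Qed.

Lemma cycle_edges_sub G (s : seq V) : cycle (adj G) s -> cycle_edges s \subset eset G.
Proof. by move=> cs; apply/subsetP => f /imsetP[z zs ->]; apply: (next_cycle cs zs). Qed.

(** An edge with an end off s is not an edge of the cycle. So the complement of s stays connected
    when the cycle edges are deleted, and each vertex of s still hangs on it by its remaining
    edge. *)
Lemma peripheral_bound_of_graph G q :
  (forall C : graph V, peripheral_cycle G C -> cycle_length C <= q) ->
  peripheral_bound (adj G) (vset G) q.
Proof.
move=> hq s us ss cs sV cK hK.
pose C := Graph (cycle_graph_wf cs).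
rewrite -(card_cycle_edges us ss); apply: (hq C); apply/andP; split.
  apply/andP; split; first exact: (@seq_is_cycle C s).
  apply/andP; split; last exact: cycle_edges_sub cs.
  by apply/subsetP => z; rewrite inE => /sV.
apply/andP; split; first exact: cycle_edges_sub cs.
have notC x y : x \notin s -> [set x; y] \notin cycle_edges s.
  move=> xs; apply/negP => /imsetP[z zs /set2_eq[[E _]|[E _]]].
    by rewrite E zs in xs.
  by rewrite E mem_next zs in xs.
pose K := vset G :\: [set z in s].
have [x xs] : exists x, x \in s by case: (s) ss => // x t _; exists x; rewrite mem_head.
have [k0 k0K _] := hK x xs.
pose e' := adj (del_edges G (eset C)).
have e'sym : symmetric e' by apply: adj_sym.
have e'E a b : a \notin s -> adj G a b -> e' a b.
  by move=> na ab; rewrite /e' /adj /= inE notC.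
have KK a b : a \in K -> b \in K -> connect e' a b.
  move=> aK bK; apply: connect_sub (connP _ _ cK a b aK bK) => u v /and3P[uK vK uv].
  by apply: connect1; apply: e'E => //; move: uK; rewrite !inE => /andP[].
have toK a : a \in vset G -> connect e' k0 a.
  move=> aG; have [as'|as'] := boolP (a \in s); last first.
    by apply: KK => //; rewrite !inE as'.
  have [k kK ak] := hK a as'; apply: connect_trans (KK k0 k k0K kK) _.
  by apply: connect1; apply: e'E; [move: kK; rewrite !inE => /andP[] | rewrite adj_sym].
apply/andP; split; first by apply/set0Pn; exists k0; move: k0K; rewrite inE => /andP[].
apply/forall_inP => a aG; apply/forall_inP => b bG.
apply: connect_trans (toK b bG); rewrite (sym_connect_sym e'sym); exact: toK.
Qed.

Lemma eset_del_vertex G r : eset (del_vertex G r) = edges (adj G) (vset G :\ r).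
Proof.
apply/setP => f; apply/idP/edgesP.
  rewrite inE => /andP[fG dis]; have [x [y [xy E]]] := edge_adj fG.
  have nr z : z \in f -> z != r by move=> /(disjointFr dis); rewrite inE => /negbT.
  exists x, y; split=> //; rewrite in_setD1 nr ?E ?set21 ?set22 //=.
    exact: adj_in xy.
  by apply: (@adj_in _ _ x); rewrite adj_sym.
case=> x [y []]; rewrite !in_setD1 => /andP[xr xG] /andP[yr yG] xy ->.
by rewrite inE [_ \in _]xy /= disjoint_sym disjoints1 in_set2 negb_or ![r == _]eq_sym xr.
Qed.

Lemma base_decomposition G H B : eset H = edges (adj G) (vset H) ->
  vset H != set0 -> B != set0 -> base (adj G) (vset H) B ->
  #|edges (adj G) (vset H) :\: B| != 0 ->
  [set eset H :\: B; B] \in tree_base_decompositions 2 H.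
Proof.
move=> HE nH nB [sB gB cB cardB] nT.
rewrite -HE in sB gB cB cardB nT; set X := vset H in gB cB cardB; set T := eset H :\: B in cB cardB nT *.
have nT0 : T != set0 by rewrite -card_gt0 lt0n.
have disTB : [disjoint T & B] by rewrite disjoints_subset /T setDE subsetIr.
have TB : T != B.
  by apply: contra nB => /eqP E; have := disjoint_setI0 disTB; rewrite E setIid => ->.
have HG x y : x \in X -> y \in X -> adj G x y = adj H x y.
  by move=> xX yX; rewrite [RHS]/adj /= HE mem_edges ?xX ?yX //; apply: adj_sym.
rewrite inE; apply/andP; split.
  apply/and3P; split.
  - rewrite /cover bigcup_setU !big_set1; apply/eqP.
    by rewrite -[RHS](setID (eset H) B) (setIidPr sB) setUC.
  - apply/trivIsetP => A A'; rewrite !in_set2 => /orP[]/eqP-> /orP[]/eqP->; rewrite ?eqxx // => _.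
    by rewrite disjoint_sym.
  by rewrite in_set2 negb_or eq_sym nT0 eq_sym.
apply/existsP; exists T; apply/existsP; exists B; apply/and4P; split=> //.
  have wfT : wf_graph (vset H, T).
    by apply/forall_inP => f /setDP[fH _]; apply: (forall_inP (graph_wf H)).
  apply/existsP; exists (Graph wfT); apply/and4P; split=> //.
    by apply/andP; split; rewrite ?subxx //; apply: subsetDl.
  apply/andP; split.
    apply/andP; split=> //; apply/forall_inP => x xX; apply/forall_inP => y yX.
    apply: connect_sub (connP _ _ cB x y xX yX) => u v /and3P[_ _ uv].
    exact: connect1.
  apply/forallP => C; apply/negP => /andP[/is_cycle_seq[s [us ss vE eE]] /andP[sv se]].
  have sX : {subset s <= X} by move=> z zs; apply: (subsetP sv); rewrite vE inE.
  have ltT : #|T| < #|X| by rewrite -cardB addn1.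
  by have := tree_no_cycle cB ltT us ss sX; rewrite -eE; case/negP.
apply/andP; split=> //.
have /and3P[BR RH /forallP kc] := k_closure_closed 2 sB.
(* It remains to see that the 2-closure is closed in the sense of [closed_in]: each listed cycle is
   turned into a subgraph, and 2-closedness is used in contrapositive form. *)
rewrite eqEsubset RH /=; apply: gB BR.
move=> s us ss cs sX le2.
have csH : cycle (adj H) s.
  apply: cycle_from_next => // z zs.
  by rewrite -HG ?sX ?mem_next //; apply: next_cycle.
pose C := Graph (cycle_graph_wf csH).
have := kc C; rewrite -setD_eq0; apply: contraTT => ne; rewrite negb_imply -leqNgt le2 andbT.
apply/andP; split=> //; apply/andP; split; first exact: (@seq_is_cycle C s).
apply/andP; split; last exact: cycle_edges_sub.
by apply/subsetP => z; rewrite inE => /sX.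
Qed.

(** The three outer ends all equal r, which is the case for which [pc_dist] has its first
    alternative. *)
Lemma piece_del_vertex G r : cubic_3conn (adj G) (vset G) -> r \in vset G ->
  exists a b c, piece (adj G) (vset G) (vset G :\ r) a b c r r r.
Proof.
move=> G3 rG; have /card_gt2P[a [b [c [[ra rb rc] [ab bc ca]]]]] : 2 < #|nb (adj G) r|.
  by rewrite (c3_deg G3 rG).
rewrite !inE in ra rb rc.
have VX : vset G :\: (vset G :\ r) = [set r].
  by rewrite setDDr setDv set0U; apply/setIidPr; rewrite sub1set.
have inX z : adj G r z -> z \in vset G :\ r.
  move=> rz; rewrite in_setD1 (c3_inr G3 rz) andbT.
  by apply: contraTneq rz => ->; rewrite adj_irr.
have un : uniq [:: a; b; c] by rewrite /= !inE negb_or ab bc eq_sym ca.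
exists a, b, c; split; rewrite ?VX ?set11 //.
- exact: subD1set.
- exact: conn1.
- by rewrite !inX.
- by rewrite ![adj G _ r]adj_sym.
- move=> u v uX /set1P->; rewrite adj_sym => ru.
  have := nbrs_eq3 G3 rG un ra rb rc ru.
  by rewrite !inE => /or3P[]/eqP->; [constructor 1|constructor 2|constructor 3].
by left.
Qed.

Lemma many_decompositions G r q :
  k_connected 3 G -> cubic G -> r \in vset G ->
  (forall C : graph V, peripheral_cycle G C -> cycle_length C <= q) ->
  2 ^ #|vset G| <= #|tree_base_decompositions 2 (del_vertex G r)| ^ (2 * q).
Proof.
move=> k3 cub rG hq.
have G3 := cubic_3conn_of_graph k3 cub; have bq := peripheral_bound_of_graph hq.
have [a [b [c pX]]] := piece_del_vertex G3 rG.
set H := del_vertex G r.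
have HE : eset H = edges (adj G) (vset H) := eset_del_vertex G r.
have cX : #|vset G| = #|vset H| + 1 by rewrite (cardsD1 r) rG addnC.
have gt3 : 3 < #|vset G| by case/andP: k3.
have [F [hF leF]] := piece_many_bases G3 bq pX.
have cardE : 2 * #|eset H| + 3 = 3 * #|vset H| by rewrite HE; apply: (card_piece G3 pX).
have cardB B : B \in F -> #|B| + #|eset H :\: B| = #|eset H| /\ #|eset H :\: B| + 1 = #|vset H|.
  move=> /hF[sB _ _ cT]; split; last by rewrite HE.
  by rewrite -(cardsID B (eset H)) (setIidPr _) // HE.
rewrite cX; apply: (leq_trans leF).
suff le : #|F| <= #|tree_base_decompositions 2 H|.
  by case: (2 * q) => [|k]; rewrite ?expn0 // leq_exp2r.
(* An unordered partition still determines B: the tree has |X| - 1 edges and B only half as many, so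
   the blocks cannot be exchanged. *)
have inj : {in F &, injective (fun B => [set eset H :\: B; B])}.
  move=> B1 B2 B1F B2F /set2_eq[[]//|[E1 E2]].
  have [c1 d1] := cardB _ B1F; have [c2 d2] := cardB _ B2F.
  by exfalso; move: c1 d1 d2; rewrite E1 {1}E2; move: gt3 cX cardE; clear; lia.
rewrite -(card_in_imset inj); apply: subset_leq_card; apply/subsetP => P /imsetP[B BF ->].
have [c1 d1] := cardB _ BF.
apply: (base_decomposition HE).
- by rewrite -card_gt0; move: gt3 cX; clear; lia.
- by rewrite -card_gt0; move: c1 d1 cardE gt3 cX; clear; lia.
- exact: hF.
by rewrite -HE; move: d1 gt3 cX; clear; lia.
Qed.

End Link.
Local Open Scope ring_scope.

Theorem lemma7p3 (R : realType) (V : finType) (G : graph V) (r : V) (q : nat)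
  (h3conn : k_connected 3 G) (hcubic : cubic G) (hr : r \in vset G)
  (hq : forall C : graph V, peripheral_cycle G C -> (cycle_length C <= q)%N) :
  2 `^ (#|vset G|%:R / (2 * q%:R)) <=
    #|tree_base_decompositions 2 (del_vertex G r)|%:R :> R.
Proof.
have := many_decompositions h3conn hcubic hr hq.
set n := #|vset G|; set N := #|tree_base_decompositions 2 _|; move=> le.
have n0 : (0 < n)%N by apply/card_gt0P; exists r.
(* For q = 0 the counting bound would say that a power of 2 with positive exponent is at most 1. *)
have q0 : (0 < q)%N.
  rewrite lt0n; apply: contraTneq le => ->.
  by rewrite muln0 expn0 -ltnNge -(expn0 2) ltn_exp2l.
have qR : 2 * q%:R != 0 :> R by rewrite -natrM pnatr_eq0 -lt0n muln_gt0.
rewrite powRrM powR_mulrn // -natrX.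
(* Writing N as a 2q-th root reduces the claim to monotonicity of the root and the bound in natural
   numbers. *)
have -> : N%:R = ((N ^ (2 * q))%:R : R) `^ (2 * q%:R)^-1.
  by rewrite natrX -powR_mulrn // -powRrM natrM divff // powRr1.
apply: ge0_ler_powR; rewrite ?nnegrE ?ler0n ?ler_nat //.
by rewrite invr_ge0 -natrM ler0n.
Qed.
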